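(* Let $(\mathfrak{n},g)$ be a $7$-dimensional $2$-step nilpotent metric Lie algebra with derived algebra $\mathfrak{n}'$, and consider the $g$-orthogonal decomposition $\mathfrak{n}=\mathfrak{r}\oplus\mathfrak{n}'$. (i) If $\dim(\mathfrak{n}')=1$, there exists a purely coclosed $\mathrm{G}_2$-structure on $\mathfrak{n}$ inducing the metric $g$ if and only if $(\mathrm{tr}(j(z)^2))^2=4\,\mathrm{tr}(j(z)^4)$ for every $z\in\mathfrak{n}'$. (ii) If $\dim(\mathfrak{n}')=2$, there exists a purely coclosed $\mathrm{G}_2$-structure on $\mathfrak{n}$ inducing the metric $g$ if and only if there exists an oriented $4$-dimensional subspace $\tilde{\mathfrak{r}}\subset\mathfrak{r}$ with $\mathrm{d}(\mathfrak{n}')^*\subset\Lambda^2\tilde{\mathfrak{r}}^*$ such that for every orthonormal basis $\{\zeta_1,\zeta_2\}$ of $(\mathfrak{n}')^*$, the self-dual components $\mathrm{d}\zeta_1^+,\mathrm{d}\zeta_2^+\in\Lambda^2_+\tilde{\mathfrak{r}}^*$ of $\mathrm{d}\zeta_1,\mathrm{d}\zeta_2\in\Lambda^2\tilde{\mathfrak{r}}^*$ are orthogonal and have equal norms. (iii) If $\dim(\mathfrak{n}')=3$, there exists a purely coclosed $\mathrm{G}_2$-structure on $\mathfrak{n}$ inducing the metric $g$ if and only if for some orientation of the $4$-dimensional space $\mathfrak{r}$, and for every orthonormal basis $\{\zeta_1,\zeta_2,\zeta_3\}$ of $(\mathfrak{n}')^*$, the Gram matrix $S=(S_{ij})$, $S_{ij}:=g(\mathrm{d}\zeta_i^+,\mathrm{d}\zeta_j^+)$,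 of the self-dual components of their differentials in $\Lambda^2_+\mathfrak{r}^*$ satisfies $(\mathrm{tr}(S))^2=2\,\mathrm{tr}(S^2)$.
   Context: A metric Lie algebra $(\mathfrak{n},g)$ is a real Lie algebra with an inner product. A Lie algebra is $2$-step nilpotent if it is non-abelian and its derived algebra $\mathfrak{n}'=[\mathfrak{n},\mathfrak{n}]$ is contained in its center. For a $2$-step nilpotent metric Lie algebra, $\mathfrak{r}:=(\mathfrak{n}')^\perp$ and $j:\mathfrak{n}'\to\mathfrak{so}(\mathfrak{r})$ is the injective linear map defined by $g(j(z)x,y)=g(z,[x,y])$ for $z\in\mathfrak{n}'$, $x,y\in\mathfrak{r}$. $\mathrm{d}$ denotes the Chevalley-Eilenberg differential on $\Lambda^\bullet\mathfrak{n}^*$ ($\mathrm{d}\alpha(x,y)=-\alpha([x,y])$ for $\alpha\in\mathfrak{n}^*$, extended as a graded derivation). For a subspace $\mathfrak{k}\subset\mathfrak{n}$, $\mathfrak{k}^*$ is viewed in $\mathfrak{n}^*$ as the covectors vanishing on the $g$-orthogonal complement of $\mathfrak{k}$; $\mathrm{d}$ vanishes on $\mathfrak{r}^*$ and maps $(\mathfrak{n}')^*$ into $\Lambda^2\mathfrak{r}^*$. The metric on $2$-forms is the one for which $\{e^i\wedge e^j\}_{i<j}$ is orthonormal when $\{e^i\}$ is an orthonormal coframe. For an oriented $4$-dimensional Euclidean space $W$, $\Lambda^2_+W^*=\{\sigma\in\Lambda^2W^*: *\sigma=\sigma\}$ is the space of self-dual forms and $\sigma^+=\frac12(\sigma+*\sigma)$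 is the self-dual component of $\sigma$. A $\mathrm{G}_2$-structure on a $7$-dimensional real vector space $V$ is a $3$-form $\varphi\in\Lambda^3V^*$ such that $(v\lrcorner\varphi)\wedge(v\lrcorner\varphi)\wedge\varphi\neq0$ for all $v\in V\smallsetminus\{0\}$. It determines a unique inner product $g_\varphi$ and orientation, with volume form $\mathrm{vol}_\varphi$, such that $g_\varphi(v,w)\mathrm{vol}_\varphi=\frac16\,(v\lrcorner\varphi)\wedge(w\lrcorner\varphi)\wedge\varphi$; $*_\varphi$ is the corresponding Hodge operator. $\varphi$ induces $g$ if $g_\varphi=g$. A $\mathrm{G}_2$-structure $\varphi$ on $\mathfrak{n}$ is purely coclosed if $\mathrm{d}*_\varphi\varphi=0$ and $\mathrm{d}\varphi\wedge\varphi=0$. *)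

(* Defs.v *)
From HB Require Import structures.
From mathcomp Require Import all_boot all_order all_fingroup all_algebra.
From mathcomp Require Import boolp classical_sets reals.

Set Implicit Arguments.
Unset Strict Implicit.
Unset Printing Implicit Defensive.

Import Order.TTheory GRing.Theory Num.Theory.
Local Open Scope ring_scope.

(** * Exterior forms on a real vector space *)

(* A [k]-form is a function of [k] vectors satisfying [is_form]; the operations
   below are defined on all functions of [k] vectors. *)
Definition kform (R : realType) (V : vectType R) (k : nat) := ('I_k -> V) -> R.

Section Forms.
Variables (R : realType) (V : vectType R).

Definition vcons k (v : V) (x : 'I_k -> V) : 'I_k.+1 -> V :=
  fun i => if unlift ord0 i is Some j then x j else v.

Definition vcat k m (x : 'I_k -> V) (y : 'I_m -> V) : 'I_(k + m) -> V :=
  fun i => match split i with inl a => x a | inr b => y b end.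

Record is_form k (alpha : kform V k) : Prop := IsForm {
  form_linear : forall (x : 'I_k -> V) (i : 'I_k) (a : R) (u v : V),
    alpha [eta x with i |-> a *: u + v] =
    a * alpha [eta x with i |-> u] + alpha [eta x with i |-> v];
  form_alternating : forall (x : 'I_k -> V) (i j : 'I_k),
    i != j -> x i = x j -> alpha x = 0
}.

Definition zero_form k (alpha : kform V k) : Prop := forall x, alpha x = 0.

Definition interior k (v : V) (alpha : kform V k.+1) : kform V k :=
  fun x => alpha (vcons v x).

(* Normalised so that [(e^1 /\ ... /\ e^k) (e_1, ..., e_k) = 1]. *)
Definition wedge p q (alpha : kform V p) (beta : kform V q) : kform V (p + q) :=
  fun x => (p`! * q`!)%:R^-1 *
    \sum_(s : 'S_(p + q)) (-1) ^+ s *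
      alpha (fun i => x (s (lshift q i))) * beta (fun i => x (s (rshift p i))).

(** ** Euclidean structure on forms *)

Variable g : {dot V for idfun}.

(* Some orthonormal basis of [U]: one exists since [g] is positive definite, and
   the operations below do not depend on which one is chosen. *)
Definition onbasis (U : {vspace V}) : (\dim U).-tuple V :=
  xget (vbasis U) [set e : (\dim U).-tuple V | basis_of U e && orthonormal g e].

(* [Lambda^k U^*], seen inside [Lambda^k V^*]: the forms killed by contraction
   with any vector of the orthogonal complement of [U]. *)
Definition form_on (U : {vspace V}) k (alpha : kform V k) : Prop :=
  is_form alpha /\
  forall (x : 'I_k -> V) (i : 'I_k), x i \in orthov g U -> alpha x = 0.

(* The inner product of [Lambda^k U^*] making the [e^{i_1} /\ ... /\ e^{i_k}],
   [i_1 < ... < i_k], orthonormal: summing over all [k]-tuples of indices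
   instead of increasing ones counts every term [k!] times. *)
Definition form_dot (U : {vspace V}) k (alpha beta : kform V k) : R :=
  k`!%:R^-1 * \sum_(f : {ffun 'I_k -> 'I_(\dim U)})
    alpha (fun i => tnth (onbasis U) (f i)) *
    beta (fun i => tnth (onbasis U) (f i)).

Definition form_norm (U : {vspace V}) k (alpha : kform V k) : R :=
  Num.sqrt (form_dot U alpha alpha).

(* Orientations of [U] are encoded by their volume forms, that is, by the two
   forms of top degree and unit norm on [U]. *)
Definition volume_form (U : {vspace V}) k (vol : kform V k) : Prop :=
  [/\ k = \dim U, form_on U vol & form_dot U vol vol = 1].

(* The Hodge star [Lambda^k U^* -> Lambda^m U^*], [k + m = \dim U], of the
   orientation given by [vol]; it maps [e^1 /\ ... /\ e^k] to
   [e^{k+1} /\ ... /\ e^{k+m}] for every oriented orthonormal coframe. *)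
Definition hodge (U : {vspace V}) k m (vol : kform V (k + m))
    (alpha : kform V k) : kform V m :=
  fun x => k`!%:R^-1 * \sum_(f : {ffun 'I_k -> 'I_(\dim U)})
    alpha (fun i => tnth (onbasis U) (f i)) *
    vol (vcat (fun i => tnth (onbasis U) (f i)) x).

Definition self_dual_part (U : {vspace V}) (vol : kform V 4)
    (sigma : kform V 2) : kform V 2 :=
  fun x => 2^-1 * (sigma x + @hodge U 2 2 vol sigma x).

Definition orthonormal_cobasis (U : {vspace V}) m (zeta : 'I_m -> kform V 1) :
    Prop :=
  [/\ forall i, form_on U (zeta i),
      forall i j, form_dot U (zeta i) (zeta j) = (i == j)%:R
    & forall alpha : kform V 1, form_on U alpha ->
        exists c : 'I_m -> R, forall x, alpha x = \sum_i c i * zeta i x].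

End Forms.

(** * Lie algebras *)

Section Lie.
Variables (R : realType) (n : vectType R) (br : {bilinear n -> n -> n}).

Record lie_bracket : Prop := LieBracket {
  bracket_alternating : forall x, br x x = 0;
  bracket_jacobi : forall x y z,
    br x (br y z) + br y (br z x) + br z (br x y) = 0
}.

Definition derived_algebra : {vspace n} :=
  <<[seq br x y | x <- vbasis {:n}, y <- vbasis {:n}]>>%VS.

Definition central (x : n) : Prop := forall y, br x y = 0.

Definition two_step_nilpotent : Prop :=
  (exists x y, br x y <> 0) /\ (forall z, z \in derived_algebra -> central z).

(* The Chevalley-Eilenberg differential
     d alpha (x_0, ..., x_{p+1}) = sum_{i < j} (-1)^{i+j}
       alpha ([x_i, x_j], x_0, ..., ^x_i, ..., ^x_j, ..., x_{p+1}),
   the graded derivation with [d alpha (x, y) = - alpha [x, y]] in degree one.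
   For [i < j] the index [lift j i] is [i], and [lift j \o lift i] enumerates
   the indices other than [i] and [j]. *)
Definition ce_diff p (alpha : kform n p.+1) : kform n p.+2 :=
  fun x => \sum_(j < p.+2) \sum_(i < p.+1 | (i < j)%N) (-1) ^+ (i + j) *
    alpha (vcons (br (x (lift j i)) (x j)) (fun l => x (lift j (lift i l)))).

Variable g : {dot n for idfun}.

Definition horizontal : {vspace n} := orthov g derived_algebra.

(* [jmap z] is the endomorphism [j(z)] of [horizontal]; the set below is a
   singleton since [g] is nondegenerate on [horizontal]. *)
Definition jmap (z : n) : 'End(subvs_of horizontal) :=
  xget 0 [set J : 'End(subvs_of horizontal) |
    forall x y : subvs_of horizontal, g (vsval (J x)) (vsval y) =
      g z (br (vsval x) (vsval y))].

End Lie.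

Definition lfun_trace (R : realType) (V : vectType R) (f : 'End(V)) : R :=
  \tr (passmx.mxof (vbasis {:V}) (vbasis {:V}) f).

(** * G2-structures *)

Section G2.
Variables (R : realType) (V : vectType R).

Definition G2_structure (phi : kform V 3) : Prop :=
  is_form phi /\ forall v : V, v != 0 ->
    ~ zero_form (wedge (wedge (interior v phi) (interior v phi)) phi).

Definition G2_metric (phi : kform V 3) (g : {dot V for idfun})
    (vol : kform V 7) : Prop :=
  volume_form g {:V} vol /\
  forall (v w : V) (x : 'I_7 -> V), g v w * vol x =
    6^-1 * wedge (wedge (interior v phi) (interior w phi)) phi x.

Definition G2_induces (phi : kform V 3) (g : {dot V for idfun}) : Prop :=
  exists vol : kform V 7, G2_metric phi g vol.

End G2.

Definition purely_coclosed (R : realType) (n : vectType R)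
    (br : {bilinear n -> n -> n}) (phi : kform n 3) : Prop :=
  (exists (h : {dot n for idfun}) (vol : kform n 7),
     G2_metric phi h vol /\
     zero_form (ce_diff br (@hodge R n h {:n} 3 4 vol phi))) /\
  zero_form (wedge (ce_diff br phi) phi).

Definition has_purely_coclosed_G2 (R : realType) (n : vectType R)
    (br : {bilinear n -> n -> n}) (g : {dot n for idfun}) : Prop :=
  exists phi : kform n 3,
    [/\ G2_structure phi, purely_coclosed br phi & G2_induces phi g].

(* Main.v *)
(* In an orthonormal frame adapted to phi, the equations d psi = 0 and d phi /\ phi = 0
   are linear in the structure constants g(e_m, [e_i, e_j]).  Any orthonormal
   u, v, w with phi(u, v, w) = 0 extend to such a frame, because u x v defined by
   g(u x v, w) = phi(u, v, w) is a cross product; so the frame can be fitted to n'.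
   Conversely a G2-structure inducing g is given by an orthonormal frame.
   - dim n' = 1: the equations say that j(z) lies in su(3), the stabiliser of z
     acting on r.  The skew map j(z) has normal form diag(aJ, bJ, cJ), and the trace
     condition says that one of a + b + c, a + b - c, a - b + c, a - b - c vanishes; up
     to reversing planes, a + b + c = 0.
   - dim n' = 3, and dim n' = 2 after adding to n' the unit vector of r orthogonal to
     the 4-plane: if the complement is coassociative, the equations say that the 3x3
     matrix M of the self-dual parts of the d zeta_i is symmetric and traceless.
     Rotating the frame of n' multiplies M by an orthogonal matrix, and some QM is
     symmetric and traceless exactly when (tr S)^2 = 2 tr S^2 for S = M M^T.
     If the complement is not coassociative, the equations still force this. *)
From HB Require Import structures.
Require Import Defs.
From mathcomp Require Import all_boot all_order all_fingroup all_algebra.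
From mathcomp Require Import boolp classical_sets reals.
From mathcomp Require complex.
From mathcomp Require Import ring lra zify.

Set Implicit Arguments.
Unset Strict Implicit.
Unset Printing Implicit Defensive.

Import Order.TTheory GRing.Theory Num.Theory.
Local Open Scope ring_scope.

(** * Forms evaluated on lists, and wedge products as sums over shuffles *)

Section FormsOnLists.
Variables (R : realType) (V : vectType R).
Implicit Types (v w : V).

(** That [u x v] is a cross product must be extracted from the cubic identity defining the metric.
    Fix a unit vector [u] and write [phi] as [u] wedge a 2-form [omega], plus a 3-form [rho] on the
    orthogonal 6-space. The cubic identity forces [omega /\ rho = 0] and makes the matrix of [omega]
    inverse, up to a scalar, to Hitchin's endomorphism of [rho], whose square is always scalar.
    Hence the square of [omega] is scalar too, and [x] to [u x x] is a multiple of an isometry of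
    the 6-space. The multiple does not depend on [u], and the normalisation of the volume form makes
    it 1. The obstacle in dimension three is that a frame fitted to [z_0, z_1] in [n'] has its
    vector [e_2 = z_0 x z_1] prescribed, in general outside [n']. Taking [e_3] in the plane of [e_2]
    and [z_2] leaves a single angle, [z_2 = c e_2 - s e_3]; if [s] is nonzero it can be cancelled
    from the equations. Forms are handled through their values on lists of frame indices, so that
    the identities above become polynomial identities in finitely many coefficients. *)

Definition ev k (alpha : kform V k) (s : seq V) : R := alpha (fun i => s`_i).

Lemma evE k (alpha : kform V k) x : alpha x = ev alpha [seq x i | i <- enum 'I_k].
Proof.
rewrite /ev; congr alpha; apply: funext => i.
by rewrite (nth_map i) ?size_enum_ord // nth_ord_enum.
Qed.

Lemma vcons_nth k v (s : seq V) :
  vcons v (fun i : 'I_k => s`_i) = (fun i : 'I_k.+1 => (v :: s)`_i).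
Proof.
by apply: funext => i; rewrite /vcons; case: (unliftP ord0 i) => [j|] ->.
Qed.

Lemma ev_interior k (alpha : kform V k.+1) v s :
  ev (interior v alpha) s = ev alpha (v :: s).
Proof. by rewrite /ev /interior vcons_nth. Qed.

Lemma vcons0 k v (x : 'I_k -> V) : vcons v x ord0 = v.
Proof. by rewrite /vcons unlift_none. Qed.

Lemma vcons_lift k v (x : 'I_k -> V) i : vcons v x (lift ord0 i) = x i.
Proof. by rewrite /vcons liftK. Qed.

Lemma vcons_split k (x : 'I_k.+1 -> V) : x = vcons (x ord0) (fun i => x (lift ord0 i)).
Proof.
by apply: funext => i; rewrite /vcons; case: (unliftP ord0 i) => [j|] ->.
Qed.

Definition perm_alternating k (alpha : kform V k) :=
  forall (s : 'S_k) x, alpha (fun i => x (s i)) = (-1) ^+ s * alpha x.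

Lemma form_perm_alternating k (alpha : kform V k) :
  is_form alpha -> perm_alternating alpha.
Proof.
move=> [lin alt] s.
have swap (i j : 'I_k) x : i != j -> alpha (fun l => x (tperm i j l)) = - alpha x.
  move=> ij; pose z u v : 'I_k -> V := [eta [eta x with j |-> v] with i |-> u].
  have zlinl a u u' v : alpha (z (a *: u + u') v) = a * alpha (z u v) + alpha (z u' v).
    exact: lin.
  have zE u v : z u v = [eta [eta x with i |-> u] with j |-> v].
    apply: funext => l; rewrite /z /=; case: (eqVneq l i) => [->|//].
    by rewrite (negbTE ij).
  have zlinr a u v v' : alpha (z u (a *: v + v')) = a * alpha (z u v) + alpha (z u v').
    by rewrite !zE; apply: lin.
  have zz u : alpha (z u u) = 0.
    by apply: (alt _ _ _ ij); rewrite /z /= eqxx (eq_sym j) (negbTE ij) /= eqxx.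
  have -> : (fun l => x (tperm i j l)) = z (x j) (x i).
    apply: funext => l; rewrite /z /=; case: tpermP => [->|->|].
    - by rewrite eqxx.
    - by rewrite eq_sym (negbTE ij) eqxx.
    - by move=> /eqP li /eqP lj; rewrite (negbTE li) (negbTE lj).
  have -> : alpha x = alpha (z (x i) (x j)).
    by congr alpha; apply: funext => l; rewrite /z /=; case: (eqVneq l i) => [->//|_]; case: (eqVneq l j) => [->|].
  have := zz (1 *: x i + x j); rewrite zlinl !zlinr !zz !mul1r addr0 add0r => /eqP.
  by rewrite addrC addr_eq0 => /eqP.
have [ts -> dts] := prod_tpermP s.
elim: ts dts => [_|[i j] ts IH /= /andP[ij dts]] x.
  by rewrite big_nil odd_perm1 mul1r; congr alpha; apply: funext => l; rewrite perm1.
rewrite big_cons odd_mul_tperm ij signr_addb -mulrA -IH // mulN1r -(swap _ _ _ ij).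
by congr alpha; apply: funext => l; rewrite permM.
Qed.

Lemma interior_perm_alternating k (alpha : kform V k.+1) v :
  perm_alternating alpha -> perm_alternating (interior v alpha).
Proof.
move=> alt s x; rewrite /interior.
have := alt (lift_perm ord0 ord0 s) (vcons v x).
rewrite odd_lift_perm /= => <-; congr alpha; apply: funext => i.
rewrite [in LHS]/vcons; case: (unliftP ord0 i) => [j|] ->.
  by rewrite lift_perm_lift vcons_lift.
by rewrite lift_perm_id vcons0.
Qed.

(** The length [m] is a separate variable because the induction removes an argument from either
    factor, and [p + q.+1] is not convertible to [(p + q).+1]. *)
Definition perm_sum p q m (H : (p + q)%N = m) (alpha : kform V p)
    (beta : kform V q) (x : 'I_m -> V) : R :=
  \sum_(s : 'S_m) (-1) ^+ s * alpha (fun i => x (s (cast_ord H (lshift q i)))) *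
    beta (fun i => x (s (cast_ord H (rshift p i)))).

Lemma wedgeE p q (alpha : kform V p) (beta : kform V q) x :
  wedge alpha beta x = (p`! * q`!)%:R^-1 * perm_sum erefl alpha beta x.
Proof.
rewrite /wedge /perm_sum; congr (_ * _); apply: eq_bigr => s _.
by congr (_ * alpha _ * beta _); apply: funext => i; rewrite cast_ord_id.
Qed.

(** Here [i] is the position sent to [ord0] and [t] is the rest of the permutation; both sides have
    the same number of terms, so injectivity is enough. *)
Lemma sum_lift_perm m (F : 'S_m.+1 -> R) :
  \sum_s F s = \sum_(i < m.+1) \sum_(t : 'S_m) F (lift_perm i ord0 t).
Proof.
rewrite pair_big /= (reindex (fun u : 'I_m.+1 * 'S_m => lift_perm u.1 ord0 u.2)) //=.
apply/onW_bij/inj_card_bij; last first.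
  by rewrite card_prod !card_Sn card_ord factS.
move=> [i s] [j t] /= /permP st.
have ij : i = j.
  apply/eqP; move: (st i); rewrite lift_perm_id.
  case: (unliftP j i) => [l|] -> //; rewrite lift_perm_lift => /eqP.
  by rewrite (negbTE (neq_lift _ _)).
move: st; rewrite ij => st; congr pair; apply/permP => l; move: (st (lift j l)).
by rewrite !lift_perm_lift => /lift_inj.
Qed.

Lemma alternating_insert p (alpha : kform V p.+1) v (y : 'I_p.+1 -> V) (a : 'I_p.+1) :
  perm_alternating alpha -> y a = v ->
  alpha y = (-1) ^+ a * alpha (vcons v (fun l => y (lift a l))).
Proof.
move=> alt ya; have := alt (lift_perm a ord0 1%g) (vcons v (fun l => y (lift a l))).
rewrite odd_lift_perm /= odd_perm1 addbF addbF signr_odd => <-; congr alpha.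
apply: funext => k; case: (unliftP a k) => [l|] ->.
  by rewrite lift_perm_lift vcons_lift perm1.
by rewrite lift_perm_id vcons0.
Qed.

(** The sign of the lifted permutation cancels the sign of bringing [v] to the front of [alpha], so
    the result is the same for each slot [a]. Summing over the [p.+1] slots turns [p!] into
    [p.+1!]. *)
Lemma perm_sum_left p q m (H : (p.+1 + q)%N = m.+1) (H' : (p + q)%N = m)
    (alpha : kform V p.+1) (beta : kform V q) v x (a : 'I_p.+1) :
  perm_alternating alpha ->
  \sum_(t : 'S_m) (fun s : 'S_m.+1 =>
     (-1) ^+ s * alpha (fun i => vcons v x (s (cast_ord H (lshift q i)))) *
     beta (fun i => vcons v x (s (cast_ord H (rshift p.+1 i)))))
     (lift_perm (cast_ord H (lshift q a)) ord0 t) =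
  perm_sum H' (interior v alpha) beta x.
Proof.
move=> alt; apply: eq_bigr => t _; rewrite odd_lift_perm /= addbF signr_addb signr_odd.
rewrite (alternating_insert (v := v) (a := a)) //; last by rewrite lift_perm_id vcons0.
have -> : (fun i => vcons v x (lift_perm (cast_ord H (lshift q a)) ord0 t
    (cast_ord H (lshift q (lift a i))))) = (fun i => x (t (cast_ord H' (lshift q i)))).
  apply: funext => l.
  have -> : cast_ord H (lshift q (lift a l)) =
     lift (cast_ord H (lshift q a)) (cast_ord H' (lshift q l)) by apply: val_inj.
  by rewrite lift_perm_lift vcons_lift.
have -> : (fun i => vcons v x (lift_perm (cast_ord H (lshift q a)) ord0 t
    (cast_ord H (rshift p.+1 i)))) = (fun i => x (t (cast_ord H' (rshift p i)))).
  apply: funext => l.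
  have -> : cast_ord H (rshift p.+1 l) =
    lift (cast_ord H (lshift q a)) (cast_ord H' (rshift p l)).
    by apply: val_inj; rewrite /= /bump (leq_trans _ (leq_addr _ _)) // -ltnS.
  by rewrite lift_perm_lift vcons_lift.
rewrite /interior; set A := alpha _; set B := beta _; set e := (-1) ^+ t.
have aa : (-1) ^+ a * (-1) ^+ a = 1 :> R by rewrite -expr2 sqrr_sign.
transitivity (((-1) ^+ a * (-1) ^+ a) * (e * A * B)); first by ring.
by rewrite aa mul1r.
Qed.

(** As on the left, except that [v] also crosses the [p] arguments of [alpha]. *)
Lemma perm_sum_right p q m (H : (p + q.+1)%N = m.+1) (H' : (p + q)%N = m)
    (alpha : kform V p) (beta : kform V q.+1) v x (b : 'I_q.+1) :
  perm_alternating beta ->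
  \sum_(t : 'S_m) (fun s : 'S_m.+1 =>
     (-1) ^+ s * alpha (fun i => vcons v x (s (cast_ord H (lshift q.+1 i)))) *
     beta (fun i => vcons v x (s (cast_ord H (rshift p i)))))
     (lift_perm (cast_ord H (rshift p b)) ord0 t) =
  (-1) ^+ p * perm_sum H' alpha (interior v beta) x.
Proof.
move=> alt; rewrite /perm_sum mulr_sumr; apply: eq_bigr => t _.
rewrite odd_lift_perm /= addbF signr_addb signr_odd exprD.
rewrite [beta _](alternating_insert (v := v) (a := b)) //; last by rewrite lift_perm_id vcons0.
have -> : (fun i => vcons v x (lift_perm (cast_ord H (rshift p b)) ord0 t
    (cast_ord H (lshift q.+1 i)))) = (fun i => x (t (cast_ord H' (lshift q i)))).
  apply: funext => l.
  have -> : cast_ord H (lshift q.+1 l) =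
    lift (cast_ord H (rshift p b)) (cast_ord H' (lshift q l)).
    by apply: val_inj; rewrite /= /bump leqNgt (leq_trans (ltn_ord l)) ?leq_addr.
  by rewrite lift_perm_lift vcons_lift.
have -> : (fun i => vcons v x (lift_perm (cast_ord H (rshift p b)) ord0 t
    (cast_ord H (rshift p (lift b i))))) = (fun i => x (t (cast_ord H' (rshift p i)))).
  apply: funext => l.
  have -> : cast_ord H (rshift p (lift b l)) =
    lift (cast_ord H (rshift p b)) (cast_ord H' (rshift p l)).
    by apply: val_inj; rewrite /= /bump leq_add2l addnCA.
  by rewrite lift_perm_lift vcons_lift.
rewrite /interior.
set A := alpha _; set B := beta _; set e := (-1) ^+ t; set f := (-1) ^+ p.
have bb : (-1) ^+ b * (-1) ^+ b = 1 :> R by rewrite -expr2 sqrr_sign.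
transitivity (((-1) ^+ b * (-1) ^+ b) * (f * (e * A * B))); first by ring.
by rewrite bb mul1r.
Qed.

Lemma perm_sum_cons p q m (H : (p + q)%N = m.+1) (alpha : kform V p)
    (beta : kform V q) v x :
  perm_sum H alpha beta (vcons v x) =
  \sum_(i < m.+1) \sum_(t : 'S_m) (fun s : 'S_m.+1 =>
     (-1) ^+ s * alpha (fun i => vcons v x (s (cast_ord H (lshift q i)))) *
     beta (fun i => vcons v x (s (cast_ord H (rshift p i))))) (lift_perm i ord0 t).
Proof. by rewrite -[RHS]sum_lift_perm. Qed.

Lemma sum_cast_split p q m (H : (p + q)%N = m) (F : 'I_m -> R) :
  \sum_i F i =
  \sum_(i < p) F (cast_ord H (lshift q i)) + \sum_(j < q) F (cast_ord H (rshift p j)).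
Proof.
by case: m / H F => F; rewrite big_split_ord /=; congr (_ + _); apply: eq_bigr => i _;
   rewrite cast_ord_id.
Qed.

(* The antiderivation rule for contractions, with the head of the list as the
   contracted vector, unfolds a wedge product into a signed sum over shuffles. *)
Fixpoint shuffle_sum T (p q : nat) (A B : seq T -> R) (s : seq T) : R :=
  match s with
  | [::] => A [::] * B [::]
  | v :: s' =>
    (if p is p'.+1 then shuffle_sum p' q (fun t => A (v :: t)) B s' else 0) +
    (if q is q'.+1 then
       (-1) ^+ p * shuffle_sum p q' A (fun t => B (v :: t)) s' else 0)
  end.

Lemma perm_sum_shuffle p q m (H : (p + q)%N = m) (alpha : kform V p)
    (beta : kform V q) s :
  perm_alternating alpha -> perm_alternating beta -> size s = m ->
  perm_sum H alpha beta (fun i => s`_i) =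
  (p`! * q`!)%:R * shuffle_sum p q (ev alpha) (ev beta) s.
Proof.
elim: s p q m H alpha beta => [|v s IH] p q [|m] H alpha beta alta altb //.
  move=> _; case: p q H alpha beta alta altb => [|//] [|//] H alpha beta _ _.
  rewrite /perm_sum /= mul1r [index_enum _](_ : _ = [:: 1%g]); last first.
    apply/perm_small_eq => //; apply: uniq_perm => [|//|t].
      by rewrite index_enum_uniq.
    by rewrite mem_index_enum inE; apply/esym/eqP/permP; case.
  rewrite big_seq1 odd_perm1 mul1r /ev.
  by congr (alpha _ * beta _); apply: funext; case.
move=> [sm]; rewrite -vcons_nth perm_sum_cons (sum_cast_split H) /= mulrDr.
congr (_ + _).
  case: p H alpha alta => [|p] H alpha alta; first by rewrite big_ord0 mulr0.
  have H' : (p + q)%N = m by case: H.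
  under eq_bigr do rewrite (perm_sum_left H H') //.
  rewrite sumr_const card_ord (IH _ _ _ H') //; last exact: interior_perm_alternating.
  have -> : ev (interior v alpha) = (fun t => ev alpha (v :: t)).
    by apply: funext => t; rewrite ev_interior.
  by rewrite factS -[LHS]mulr_natl !natrM; ring.
case: q H beta altb => [|q] H beta altb; first by rewrite big_ord0 mulr0.
have H' : (p + q)%N = m by move: H; rewrite addnS => -[].
under eq_bigr do rewrite (perm_sum_right H H') //.
rewrite sumr_const card_ord (IH _ _ _ H') //; last exact: interior_perm_alternating.
have -> : ev (interior v beta) = (fun t => ev beta (v :: t)).
  by apply: funext => t; rewrite ev_interior.
by rewrite factS -[LHS]mulr_natl !natrM; ring.
Qed.

Lemma ev_wedge p q (alpha : kform V p) (beta : kform V q) s :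
  perm_alternating alpha -> perm_alternating beta -> size s = (p + q)%N ->
  ev (wedge alpha beta) s = shuffle_sum p q (ev alpha) (ev beta) s.
Proof.
move=> alta altb ss; rewrite [LHS]wedgeE perm_sum_shuffle // mulKf //.
by rewrite pnatr_eq0 -lt0n muln_gt0 !fact_gt0.
Qed.

Lemma wedge_perm_alternating p q (alpha : kform V p) (beta : kform V q) :
  perm_alternating (wedge alpha beta).
Proof.
move=> s x; rewrite !wedgeE mulrCA; congr (_ * _); rewrite /perm_sum mulr_sumr.
rewrite (reindex_inj (mulIg s^-1%g)); apply: eq_bigr => t _.
rewrite odd_permM odd_permV signr_addb mulrA -!mulrA mulrCA !mulrA.
have E (i : 'I_(p + q)) : s ((t * s^-1)%g i) = t i by rewrite -permM mulgKV.
congr (_ * alpha _ * beta _); apply: funext => i; exact: (congr1 x (E _)).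
Qed.

Lemma form_congr k (alpha : kform V k) x y : x =1 y -> alpha x = alpha y.
Proof. by move=> xy; congr alpha; apply: funext. Qed.

(** In each term the varied slot falls into exactly one factor. Alternation follows from the effect
    of a transposition, 2 being invertible. *)
Lemma wedge_form p q (alpha : kform V p) (beta : kform V q) :
  is_form alpha -> is_form beta -> is_form (wedge alpha beta).
Proof.
move=> [lina _] [linb _]; split=> [x i a u v|x i j ij xij].
  rewrite !wedgeE [in RHS]mulrCA -mulrDr; congr (_ * _); rewrite mulr_sumr -big_split /=.
  apply: eq_bigr => s _; rewrite -!mulrA [a * _]mulrCA -mulrDr; congr (_ * _).
  pose X w := [eta x with i |-> w] : _ -> V.
  rewrite -/(X (a *: u + v)) -/(X u) -/(X v).
  case: (splitP (s^-1 i)%g) => [k ik|k ik].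
    have Ei : s (cast_ord erefl (lshift q k)) = i.
      by rewrite -[RHS](permKV s); congr (s _); apply: val_inj; rewrite /= ik.
    have EA w : alpha (fun l => X w (s (cast_ord erefl (lshift q l)))) =
        alpha [eta (fun l => x (s (cast_ord erefl (lshift q l)))) with k |-> w].
      apply: form_congr => l; rewrite /X /=; case: (eqVneq l k) => [->|lk].
        by rewrite Ei eqxx.
      by rewrite -Ei (inj_eq perm_inj) -val_eqE /= val_eqE (negbTE lk).
    have EB w w' : beta (fun l => X w (s (cast_ord erefl (rshift p l)))) =
        beta (fun l => X w' (s (cast_ord erefl (rshift p l)))).
      apply: form_congr => l; rewrite /X /= -Ei (inj_eq perm_inj) -val_eqE /=.
      by rewrite gtn_eqF // (leq_trans (ltn_ord k)) // leq_addr.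
    by rewrite !EA lina (EB u (a *: u + v)) (EB v (a *: u + v)); ring.
  have Ei : s (cast_ord erefl (rshift p k)) = i.
    by rewrite -[RHS](permKV s); congr (s _); apply: val_inj; rewrite /= ik.
  have EB w : beta (fun l => X w (s (cast_ord erefl (rshift p l)))) =
      beta [eta (fun l => x (s (cast_ord erefl (rshift p l)))) with k |-> w].
    apply: form_congr => l; rewrite /X /=; case: (eqVneq l k) => [->|lk].
      by rewrite Ei eqxx.
    by rewrite -Ei (inj_eq perm_inj) -val_eqE /= eqn_add2l val_eqE (negbTE lk).
  have EA w w' : alpha (fun l => X w (s (cast_ord erefl (lshift q l)))) =
      alpha (fun l => X w' (s (cast_ord erefl (lshift q l)))).
    apply: form_congr => l; rewrite /X /= -Ei (inj_eq perm_inj) -val_eqE /=.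
    by rewrite ltn_eqF // (leq_trans (ltn_ord l)) // leq_addr.
  by rewrite !EB linb (EA u (a *: u + v)) (EA v (a *: u + v)); ring.
have := wedge_perm_alternating alpha beta (tperm i j) x.
rewrite odd_tperm ij expr1 mulN1r (@form_congr _ _ _ x).
  by move=> /eqP; rewrite -addr_eq0 -mulr2n mulrn_eq0 => /eqP.
by move=> l; case: tpermP => [->|->|].
Qed.

Lemma interior_form k (alpha : kform V k.+1) v :
  is_form alpha -> is_form (interior v alpha).
Proof.
move=> [lin alt]; split=> [x i a u w|x i j ij xij].
  have E z : interior v alpha [eta x with i |-> z] =
      alpha [eta (vcons v x) with lift ord0 i |-> z].
    rewrite /interior; apply: form_congr => l; case: (unliftP ord0 l) => [m|] ->.
      by rewrite vcons_lift /= (inj_eq lift_inj) vcons_lift.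
    by rewrite vcons0 /= vcons0.
  by rewrite !E lin.
apply: (alt _ (lift ord0 i) (lift ord0 j)); first by rewrite (inj_eq lift_inj).
by rewrite !vcons_lift.
Qed.

End FormsOnLists.

(** * Orthonormal bases of subspaces and of their orthogonal complements *)

Section OrthonormalBases.
Variables (R : realType) (V : vectType R) (g : {dot V for idfun}).
Implicit Types (u v w x y : V) (U W : {vspace V}) (e f : seq V).

Lemma dotC u v : g u v = g v u.
Proof. by rewrite hermC /= expr0 mul1r. Qed.

Lemma dotDr u v w : g u (v + w) = g u v + g u w.
Proof. exact: linearDr. Qed.

Lemma dotZr a u v : g u (a *: v) = a * g u v.
Proof. by rewrite linearZr_LR. Qed.

Lemma dotDl u v w : g (v + w) u = g v u + g w u.
Proof. exact: linearDl. Qed.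

Lemma dotZl a u v : g (a *: v) u = a * g v u.
Proof. by rewrite linearZl_LR. Qed.

Lemma dotNr u v : g u (- v) = - g u v.
Proof. exact: linearNr. Qed.

Lemma dotNl u v : g (- v) u = - g v u.
Proof. exact: linearNl. Qed.

Lemma dot0r u : g u 0 = 0.
Proof. exact: linear0r. Qed.

Lemma dot0l u : g 0 u = 0.
Proof. exact: linear0l. Qed.

Lemma dot_sumr u (I : Type) (r : seq I) (P : pred I) (F : I -> V) :
  g u (\sum_(i <- r | P i) F i) = \sum_(i <- r | P i) g u (F i).
Proof. by apply: (big_morph (g u)) => [x y|]; rewrite ?dotDr ?dot0r. Qed.

Lemma dot_suml u (I : Type) (r : seq I) (P : pred I) (F : I -> V) :
  g (\sum_(i <- r | P i) F i) u = \sum_(i <- r | P i) g (F i) u.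
Proof. by apply: (big_morph (g^~ u)) => [x y|]; rewrite ?dotDl ?dot0l. Qed.

Lemma dot_gt0 u : u != 0 -> 0 < g u u.
Proof. exact: neq0_dnorm_gt0. Qed.

Lemma dot_eq0 u : (g u u == 0) = (u == 0).
Proof.
have [->|u0] := eqVneq u 0; first by rewrite dot0r eqxx.
by rewrite gt_eqF ?dot_gt0.
Qed.

Definition orthonormal_seq e :=
  forall i j, (i < size e)%N -> (j < size e)%N -> g e`_i e`_j = (i == j)%:R.

Definition onb U e :=
  [/\ size e = \dim U, {subset e <= U} & orthonormal_seq e].

Lemma orthonormal_seq_coord e (c : nat -> R) j : orthonormal_seq e -> (j < size e)%N ->
  g e`_j (\sum_(i < size e) c i *: e`_i) = c j.
Proof.
move=> on jn; rewrite dot_sumr (bigD1 (Ordinal jn)) //= dotZr on // eqxx mulr1.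
rewrite big1 ?addr0 // => i; rewrite -val_eqE /= => ij.
by rewrite dotZr on // eq_sym (negbTE ij) mulr0.
Qed.

Lemma orthonormal_seq_free e : orthonormal_seq e -> free e.
Proof.
move=> on; rewrite -[e]in_tupleE; apply/freeP => c c0 i.
pose C n := if insub n is Some l then c l else 0.
have Cc (l : 'I_(size e)) : C l = c l by rewrite /C valK.
rewrite -Cc -(orthonormal_seq_coord C on (ltn_ord i)).
rewrite [X in g _ X](_ : _ = 0) ?dot0r // -[RHS]c0.
by apply: eq_bigr => l _; rewrite Cc in_tupleE.
Qed.

Lemma onb_basis U e : onb U e -> basis_of U e.
Proof.
move=> [se eU on]; rewrite basisEfree orthonormal_seq_free // se leqnn andbT /=.
exact/span_subvP.
Qed.

Lemma onb_expand U e x : onb U e -> x \in U ->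
  x = \sum_(i < size e) g e`_i x *: e`_i.
Proof.
move=> ob xU; have be := onb_basis ob; case: (ob) => se eU on.
have [c xE] : exists c : nat -> R, x = \sum_(i < size e) c i *: e`_i.
  have be' : basis_of U (in_tuple e) by rewrite in_tupleE.
  exists (fun n => if insub n is Some l then coord (in_tuple e) l x else 0).
  rewrite {1}(coord_basis be' xU); apply: eq_bigr => i _.
  by rewrite valK in_tupleE.
rewrite {1}xE; apply: eq_bigr => i _; congr (_ *: _).
by rewrite xE orthonormal_seq_coord.
Qed.

Lemma onb_eq U e x y : onb U e -> x \in U -> y \in U ->
  (forall i, (i < size e)%N -> g e`_i x = g e`_i y) -> x = y.
Proof.
move=> ob xU yU xy; rewrite (onb_expand ob xU) (onb_expand ob yU).
by apply: eq_bigr => i _; rewrite xy.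
Qed.

Lemma unit_normal U e : orthonormal_seq e -> {subset e <= U} -> (size e < \dim U)%N ->
  exists v, [/\ v \in U, g v v = 1 & forall i, (i < size e)%N -> g e`_i v = 0].
Proof.
move=> on eU lt.
have [x xU xe] : exists2 x, x \in U & x \notin <<e>>%VS.
  apply/subvPn; apply/negP => /dimvS; rewrite leqNgt => /negP; apply.
  exact: leq_ltn_trans (dim_span e) lt.
pose y := x - \sum_(i < size e) g e`_i x *: e`_i.
have y0 : y != 0.
  apply: contra xe; rewrite subr_eq0 => /eqP ->; apply: memv_suml => i _.
  by apply/memvZ/memv_span/mem_nth.
have ye i : (i < size e)%N -> g e`_i y = 0.
  by move=> ie; rewrite dotDr dotNr (orthonormal_seq_coord (fun n => g e`_n x)) // subrr.
have yU : y \in U.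
  by apply: memvB => //; apply: memv_suml => i _; apply/memvZ/eU/mem_nth.
exists ((Num.sqrt (g y y))^-1 *: y); split=> [||i ie].
- exact: memvZ.
- rewrite dotZl dotZr mulrA -expr2 exprVn sqr_sqrtr ?ltW ?dot_gt0 //.
  by rewrite mulVf // dot_eq0.
- by rewrite dotZr ye // mulr0.
Qed.

Lemma orthonormal_seq_rcons e v : orthonormal_seq e -> g v v = 1 ->
  (forall i, (i < size e)%N -> g e`_i v = 0) -> orthonormal_seq (rcons e v).
Proof.
move=> on v1 ve i j; rewrite size_rcons !ltnS !nth_rcons.
case: (ltngtP i (size e)) => // [ie|->]; case: (ltngtP j (size e)) => // je _ _.
- exact: on.
- by rewrite je ve // ltn_eqF.
- by rewrite dotC ve.
Qed.

Lemma onb_extend U e : orthonormal_seq e -> {subset e <= U} ->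
  exists e', onb U (e ++ e').
Proof.
have [n] := ubnP (\dim U - size e); elim: n e => // n IH e; rewrite ltnS => le on eU.
have le' : (size e <= \dim U)%N.
  rewrite -(eqnP (orthonormal_seq_free on)); exact/dimvS/span_subvP.
have [lt|ge] := ltnP (size e) (\dim U); last first.
  by exists [::]; rewrite cats0; split=> //; apply/eqP; rewrite eqn_leq le'.
have [v [vU v1 ve]] := unit_normal on eU lt.
case: (IH (rcons e v)) => [|||e' ob].
- rewrite size_rcons; apply: leq_trans le; rewrite subnS prednK ?subn_gt0 //.
- exact: orthonormal_seq_rcons.
- by move=> x; rewrite mem_rcons inE => /orP[/eqP ->|/eU].
- by exists (v :: e'); rewrite -cat_rcons.
Qed.

Lemma onb_exists U : exists e, onb U e.
Proof. by case: (@onb_extend U [::]) => // e; exists e. Qed.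

Lemma orthonormal_onb U e : basis_of U e && orthonormal g e <-> onb U e.
Proof.
have pairP s : pair_ortho_rec g s <->
    (forall i j, (i < j)%N -> (j < size s)%N -> g s`_i s`_j = 0).
  elim: s => [|x s IH] /=; first by split.
  rewrite /ortho_rec /= andbT; split=> [/andP[/allP xs /IH ps] [|i] [|j] //= ij js|ps].
  - by apply/eqP/xs/mem_nth.
  - exact: ps.
  - apply/andP; split; last by apply/IH => i j ij js; apply: (ps i.+1 j.+1).
    by apply/allP => y /(nthP 0)[j js <-] /=; apply/eqP/(ps 0%N j.+1).
split=> [/andP[be /andP[/allP e1 /pairP ep]]|ob].
  split=> [|x xe|i j ie je]; first by rewrite (size_basis (X := in_tuple e) be).
    exact: (basis_mem be).
  case: (ltngtP i j) => [ij|ji|->].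
  - exact: ep.
  - by rewrite dotC; apply: ep.
  - exact/eqP/e1/mem_nth.
rewrite onb_basis //=; case: ob => _ _ on; apply/andP; split.
  by apply/allP => x /(nthP 0)[i ie <-] /=; rewrite on // eqxx.
apply/pairP => i j ij je; rewrite on ?ltn_eqF //; exact: ltn_trans je.
Qed.

(** An orthonormal basis exists, so [xget] does not fall back on its default [vbasis U]. *)
Lemma onbasisP U : onb U (onbasis g U).
Proof.
apply/orthonormal_onb; rewrite /onbasis.
have [e ob] := onb_exists U; have se : size e == \dim U by case: ob => ->.
by case: xgetP => [x _ //|/(_ (Tuple se))[]]; apply/orthonormal_onb.
Qed.

Lemma orthov_dotP U x : reflect (forall y, y \in U -> g x y = 0) (x \in orthov g U).
Proof. exact: mem_orthovP. Qed.

Lemma onb_orthov U e e' : onb U e -> onb {:V} (e ++ e') -> onb (orthov g U) e'.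
Proof.
move=> obU ob; case: (ob) => [ss _ on]; case: (obU) => se eU _.
have nthe' i : e'`_i = (e ++ e')`_(size e + i) by rewrite nth_cat ltnNge leq_addr addKn.
have nthe i : (i < size e)%N -> e`_i = (e ++ e')`_i by move=> ie; rewrite nth_cat ie.
have on' : orthonormal_seq e'.
  move=> i j ie je; rewrite !nthe' on ?size_cat ?ltn_add2l //.
  by rewrite eqn_add2l.
have sub : {subset e' <= orthov g U}.
  move=> x /(nthP 0)[i ie <-]; apply/orthov_dotP => y yU.
  rewrite (onb_expand obU yU) dot_sumr big1 // => j _.
  rewrite dotZr nthe' nthe // on ?size_cat ?ltn_add2l ?(leq_trans _ (leq_addr _ _)) //.
  by rewrite gtn_eqF ?mulr0 // (leq_trans (ltn_ord j)) // leq_addr.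
split=> //; apply/eqP; rewrite eqn_leq -(eqnP (orthonormal_seq_free on')).
rewrite dimvS //=; last exact/span_subvP.
apply: dimvS; apply/subvP => x /orthov_dotP xU.
rewrite (onb_expand ob (memvf x)) size_cat big_split_ord /= big1 ?add0r.
  apply: memv_suml => i _; rewrite -nthe'; apply/memvZ/memv_span/mem_nth/ltn_ord.
by move=> i _; rewrite -nthe // dotC xU ?scale0r //; apply/eU/mem_nth.
Qed.

Lemma onb_orthov_compl U e e' : onb U e -> onb (orthov g U) e' -> onb {:V} (e ++ e').
Proof.
move=> obU obU'; case: (obU) => se eU on; case: (obU') => se' eU' on'.
have [f ob] := onb_extend on (fun x _ => memvf x).
have [sf _ _] := onb_orthov obU ob; split=> [|x _|i j].
- by case: ob => <- _ _; rewrite !size_cat se' sf.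
- exact: memvf.
have ort k l : (k < size e)%N -> (l < size e')%N -> g e'`_l e`_k = 0.
  move=> ke le; have /eU' /orthov_dotP := mem_nth 0 le; apply.
  exact/eU/mem_nth.
rewrite !nth_cat size_cat; case: (ltnP i (size e)) => ie; case: (ltnP j (size e)) => je.
- by move=> _ _; apply: on.
- rewrite -(ltn_subLR _ je) => _ jl; rewrite dotC ort // ltn_eqF //; exact: leq_trans je.
- rewrite -(ltn_subLR _ ie) => il _; rewrite ort // gtn_eqF //; exact: leq_trans ie.
- by rewrite -(ltn_subLR _ ie) -(ltn_subLR _ je) => il jl; rewrite on' // eqn_sub2rE.
Qed.

End OrthonormalBases.

(** * Independence of the basis for the inner product of forms and the Hodge star *)

Section Coefficients.
Variables (R : realType) (V : vectType R) (g : {dot V for idfun}).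
Implicit Types (u v w x y : V) (U W : {vspace V}) (e f : seq V).

Definition fcoef k (alpha : kform V k) e (t : seq nat) : R :=
  ev alpha [seq e`_i | i <- t].

Definition multilinear k (alpha : kform V k) :=
  forall (x : 'I_k -> V) (i : 'I_k) (a : R) (u v : V),
    alpha [eta x with i |-> a *: u + v] =
    a * alpha [eta x with i |-> u] + alpha [eta x with i |-> v].

Lemma interior_multilinear k (alpha : kform V k.+1) v :
  multilinear alpha -> multilinear (interior v alpha).
Proof.
move=> lin x i a u w.
have E z : interior v alpha [eta x with i |-> z] =
    alpha [eta (vcons v x) with lift ord0 i |-> z].
  rewrite /interior; apply: form_congr => l; case: (unliftP ord0 l) => [m|] ->.
    by rewrite vcons_lift /= (inj_eq lift_inj) vcons_lift.
  by rewrite vcons0 /= vcons0.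
by rewrite !E lin.
Qed.

Lemma fcoef_cons k (alpha : kform V k.+1) e i t :
  fcoef alpha e (i :: t) = fcoef (interior e`_i alpha) e t.
Proof. by rewrite /fcoef ev_interior. Qed.

Lemma ev_head_linear k (alpha : kform V k.+1) s a u v : multilinear alpha ->
  ev alpha (a *: u + v :: s) = a * ev alpha (u :: s) + ev alpha (v :: s).
Proof.
move=> lin; have E z : ev alpha (z :: s) =
    alpha [eta (fun i : 'I_k.+1 => (z :: s)`_i) with ord0 |-> z].
  by apply: form_congr => l; case: (unliftP ord0 l) => [m|] ->.
have E' z z' : alpha [eta (fun i : 'I_k.+1 => (z' :: s)`_i) with ord0 |-> z] =
    ev alpha (z :: s).
  by rewrite E; apply: form_congr => l; case: (unliftP ord0 l) => [m|] ->.
by rewrite E lin !E'.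
Qed.

Lemma linear_sum_scale (a : V -> R) e (c : nat -> R) :
  (forall b u v, a (b *: u + v) = b * a u + a v) ->
  a (\sum_(i < size e) c i *: e`_i) = \sum_(i < size e) c i * a e`_i.
Proof.
move=> lin; have a0 : a 0 = 0 by have := lin (-1) 0 0; rewrite scaler0 addr0 mulN1r addNr.
have aD u v : a (u + v) = a u + a v by have := lin 1 u v; rewrite scale1r mul1r.
rewrite (big_morph a aD a0); apply: eq_bigr => i _.
by rewrite -[_ *: _]addr0 lin a0 addr0.
Qed.

Lemma ev_head_expand k (alpha : kform V k.+1) s e U v : multilinear alpha ->
  onb g U e -> v \in U ->
  ev alpha (v :: s) = \sum_(i < size e) g e`_i v * ev alpha (e`_i :: s).
Proof.
move=> lin ob vU; rewrite {1}(onb_expand ob vU).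
apply: (@linear_sum_scale (fun z => ev alpha (z :: s)) e (fun i => g e`_i v)).
by move=> b z w; apply: ev_head_linear.
Qed.

(** Nested sums replace sums over index functions: one slot can be treated at a time, and small
    cases unfold by computation. *)
Fixpoint tuple_sum (d k : nat) (F : seq nat -> R) : R :=
  if k is k'.+1 then \sum_(i < d) tuple_sum d k' (fun t => F (val i :: t)) else F [::].

Lemma eq_tuple_sum d k (F G : seq nat -> R) :
  (forall t, size t = k -> all (ltn^~ d) t -> F t = G t) ->
  tuple_sum d k F = tuple_sum d k G.
Proof.
elim: k F G => [|k IH] F G FG /=; first exact: FG.
apply: eq_bigr => i _; apply: IH => t tk td; apply: FG => /=; first by rewrite tk.
by rewrite ltn_ord.
Qed.

Lemma exchange_tuple_sum d d' k (F : 'I_d' -> seq nat -> R) :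
  \sum_(i < d') tuple_sum d k (F i) = tuple_sum d k (fun t => \sum_(i < d') F i t).
Proof.
elim: k F => [//|k IH] F /=; rewrite exchange_big /=.
by apply: eq_bigr => i _; rewrite IH.
Qed.

Lemma sum_ffun_tuple d k (F : seq nat -> R) :
  \sum_(f : {ffun 'I_k -> 'I_d}) F [seq val (f i) | i <- enum 'I_k] = tuple_sum d k F.
Proof.
elim: k F => [|k IH] F /=.
  have E : (enum 'I_0) = [::] by apply: size0nil; rewrite size_enum_ord.
  rewrite E (eq_bigr (fun=> F [::])) // sumr_const card_ffun !card_ord expn0 mulr1n //.
pose h (u : 'I_d * {ffun 'I_k -> 'I_d}) : {ffun 'I_k.+1 -> 'I_d} :=
  [ffun i => if unlift ord0 i is Some j then u.2 j else u.1].
have h_bij : bijective h.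
  exists (fun f : {ffun 'I_k.+1 -> 'I_d} => (f ord0, [ffun i => f (lift ord0 i)])).
    move=> [i f]; congr pair; first by rewrite ffunE unlift_none.
    by apply/ffunP => j; rewrite !ffunE liftK.
  move=> f; apply/ffunP => j; rewrite ffunE /=.
  by case: (unliftP ord0 j) => [l|] ->; rewrite ?ffunE.
rewrite (reindex h) /=; last exact: onW_bij.
rewrite -(pair_bigA _ (fun (i : 'I_d) (f : {ffun 'I_k -> 'I_d}) =>
  F [seq val (h (i, f) j) | j <- enum 'I_k.+1])) /=.
apply: eq_bigr => i _; rewrite -IH; apply: eq_bigr => f _; congr F.
rewrite enum_ordSl /= ffunE unlift_none; congr (_ :: _).
by rewrite -map_comp; apply: eq_map => j /=; rewrite ffunE liftK.
Qed.

(** The slots pass from [e] to [f] one at a time. For a single slot, [lin1] is the invariance of the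
    trace of a bilinear form under an orthonormal change of basis. *)
Lemma tuple_sum_onb k U e f (alpha beta : kform V k) :
  multilinear alpha -> multilinear beta -> onb g U e -> onb g U f ->
  tuple_sum (\dim U) k (fun t => fcoef alpha e t * fcoef beta e t) =
  tuple_sum (\dim U) k (fun t => fcoef alpha f t * fcoef beta f t).
Proof.
move=> + + obe obf; have [se eU one] := obe; have [sf fU onf] := obf.
have lin1 (a b : V -> R) :
    (forall c u v, a (c *: u + v) = c * a u + a v) ->
    (forall c u v, b (c *: u + v) = c * b u + b v) ->
    \sum_(i < \dim U) a e`_i * b e`_i = \sum_(i < \dim U) a f`_i * b f`_i.
  move=> la lb.
  have Eb (i : 'I_(\dim U)) : a e`_i * b e`_i =
      \sum_(j < \dim U) a e`_i * (g f`_j e`_i * b f`_j).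
    rewrite -mulr_sumr; congr (_ * _).
    have eiU : e`_i \in U by apply/eU/mem_nth; rewrite se.
    by rewrite {1}(onb_expand obf eiU) (linear_sum_scale _ (fun j => g f`_j e`_i)) // sf.
  under eq_bigr do rewrite Eb; rewrite exchange_big /=; apply: eq_bigr => j _.
  have fjU : f`_j \in U by apply/fU/mem_nth; rewrite sf.
  rewrite [in RHS](onb_expand obe fjU) (linear_sum_scale _ (fun i => g e`_i f`_j)) //.
  rewrite -(onb_expand obe fjU) se mulr_suml; apply: eq_bigr => i _.
  by rewrite (dotC g f`_j); ring.
elim: k alpha beta => [//|k IH] alpha beta la lb /=.
transitivity (\sum_(i < \dim U) tuple_sum (\dim U) k (fun t =>
    fcoef (interior e`_i alpha) f t * fcoef (interior e`_i beta) f t)).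
  apply: eq_bigr => i _; rewrite -(IH _ _ (interior_multilinear _ la)
    (interior_multilinear _ lb)).
  by apply: eq_tuple_sum => t _ _; rewrite !fcoef_cons.
rewrite exchange_tuple_sum.
transitivity (\sum_(i < \dim U) tuple_sum (\dim U) k (fun t =>
    fcoef (interior f`_i alpha) f t * fcoef (interior f`_i beta) f t)); last first.
  by apply: eq_bigr => i _; apply: eq_tuple_sum => t _ _; rewrite !fcoef_cons.
rewrite exchange_tuple_sum; apply: eq_tuple_sum => t _ _; rewrite /fcoef.
rewrite (eq_bigr (fun i : 'I_(\dim U) => ev alpha (e`_i :: [seq f`_j | j <- t]) *
   ev beta (e`_i :: [seq f`_j | j <- t]))); last by move=> i _; rewrite !ev_interior.
rewrite [RHS](eq_bigr (fun i : 'I_(\dim U) => ev alpha (f`_i :: [seq f`_j | j <- t]) *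
   ev beta (f`_i :: [seq f`_j | j <- t]))); last by move=> i _; rewrite !ev_interior.
apply: (lin1 (fun z => ev alpha (z :: _)) (fun z => ev beta (z :: _))) => c u v;
  exact: ev_head_linear.
Qed.

Lemma ffun_fcoef k U e (alpha : kform V k) (f : {ffun 'I_k -> 'I_(\dim U)}) :
  alpha (fun i => e`_(f i)) = fcoef alpha e [seq val (f i) | i <- enum 'I_k].
Proof. by rewrite /fcoef -map_comp; apply: evE. Qed.

Lemma form_dotE k U e (alpha beta : kform V k) :
  multilinear alpha -> multilinear beta -> onb g U e ->
  form_dot g U alpha beta =
  k`!%:R^-1 * tuple_sum (\dim U) k (fun t => fcoef alpha e t * fcoef beta e t).
Proof.
move=> la lb ob; rewrite /form_dot; congr (_ * _).
rewrite (tuple_sum_onb la lb ob (onbasisP g U)) -sum_ffun_tuple; apply: eq_bigr => f _.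
rewrite -!ffun_fcoef.
by congr (alpha _ * beta _); apply: funext => i; rewrite (tnth_nth 0).
Qed.

Lemma vcat_nth k m (s : seq V) (x : 'I_m -> V) (y : 'I_k -> V) (s' : seq V) :
  size s = k -> y =1 (fun i => s`_i) -> x =1 (fun i => s'`_i) ->
  vcat y x =1 (fun i => (s ++ s')`_i).
Proof.
move=> ss ys xs i; rewrite /vcat nth_cat; case: splitP => j ->.
  by rewrite ss ltn_ord ys.
by rewrite ss ltnNge leq_addr /= addKn xs.
Qed.

Lemma vcat_multilinear k m (vol : kform V (k + m)) (x : 'I_m -> V) :
  multilinear vol -> multilinear (fun y : 'I_k -> V => vol (vcat y x)).
Proof.
move=> lin y i a u v.
have E z : vol (vcat [eta y with i |-> z] x) = vol [eta (vcat y x) with lshift m i |-> z].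
  apply: form_congr => l; rewrite /vcat /=; case: splitP => j lj.
    have -> : l = lshift m j by apply: val_inj.
    by rewrite -val_eqE /= val_eqE.
  have -> : l = rshift k j by apply: val_inj.
  by rewrite -val_eqE /= gtn_eqF // (leq_trans (ltn_ord i)) // leq_addr.
by rewrite !E lin.
Qed.

Lemma hodgeE k m U e (vol : kform V (k + m)) (alpha : kform V k) s :
  multilinear alpha -> multilinear vol -> onb g U e ->
  ev (hodge g U vol alpha) s =
  k`!%:R^-1 * tuple_sum (\dim U) k
    (fun t => fcoef alpha e t * ev vol ([seq e`_i | i <- t] ++ s)).
Proof.
move=> la lv ob; rewrite /ev /hodge; congr (_ * _).
have lv' := vcat_multilinear (fun i => s`_i) lv.
transitivity (tuple_sum (\dim U) k (fun t => fcoef alpha (onbasis g U) t *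
  fcoef (fun y : 'I_k -> V => vol (vcat y (fun i => s`_i))) (onbasis g U) t)).
  rewrite -sum_ffun_tuple; apply: eq_bigr => f _; rewrite -!ffun_fcoef; congr (_ * _).
    by apply: form_congr => i; rewrite (tnth_nth 0).
  by congr (vol (vcat _ _)); apply: funext => i; rewrite (tnth_nth 0).
rewrite (tuple_sum_onb la lv' (onbasisP g U) ob); apply: eq_tuple_sum => t tk _.
congr (_ * _); rewrite /fcoef /ev.
apply: form_congr => i; rewrite (@vcat_nth _ _ [seq e`_j | j <- t] _ _ s) ?size_map //.
Qed.

End Coefficients.

(** The sign of the permutation sorting the list, and 0 if an entry is repeated; each factor counts
    the inversions that start at the head. Integer values allow evaluation by computation. *)
Fixpoint list_sign (s : seq nat) : int :=
  if s is x :: s' then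
    if x \in s' then 0 else (-1) ^+ count (ltn^~ x) s' * list_sign s'
  else 1.

Lemma list_sign_uniq s : uniq s -> list_sign s ^+ 2 = 1.
Proof.
elim: s => [//|x s IH] /= /andP[/negbTE -> us].
by rewrite exprMn IH // mulr1 sqrr_sign.
Qed.

Lemma list_sign_nuniq s : ~~ uniq s -> list_sign s = 0.
Proof. by elim: s => [//|x s IH] /=; case: (x \in s) => //= /IH ->; rewrite mulr0. Qed.

Lemma sort_ltn_sorted s : uniq s -> sorted ltn (sort leq s).
Proof.
by move=> us; rewrite ltn_sorted_uniq_leq sort_uniq us sort_sorted //; apply: leq_total.
Qed.

Lemma sorted_iota N t : sorted ltn t -> all (ltn^~ N) t -> size t = N -> t = iota 0 N.
Proof.
move=> st tN sN.
apply: (irr_sorted_eq ltn_trans ltnn st (iota_ltn_sorted _ _)) => i.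
rewrite mem_iota /= add0n.
have ut : uniq t := sorted_uniq ltn_trans ltnn st.
have sub : {subset t <= iota 0 N} by move=> j /(allP tN); rewrite mem_iota.
have [] := uniq_min_size ut sub; first by rewrite size_iota sN.
by move=> _ ->; rewrite mem_iota.
Qed.

(** Used to count signs: when [x] is inserted into the sorted tail it crosses exactly the smaller
    entries, whose number is the exponent in [list_sign]. *)
Lemma sort_cons_leq x s :
  sort leq (x :: s) =
  [seq y <- sort leq s | (y < x)%N] ++ x :: [seq y <- sort leq s | (x <= y)%N] /\
  sort leq s = [seq y <- sort leq s | (y < x)%N] ++ [seq y <- sort leq s | (x <= y)%N].
Proof.
have leq_tot : total leq by move=> a b; apply: leq_total.
set t := sort leq s; have st : sorted leq t by apply: sort_sorted.
set t1 := filter _ t; set t2 := filter _ t.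
have s1 : sorted leq t1 by apply: sorted_filter st; apply: leq_trans.
have s2 : sorted leq t2 by apply: sorted_filter st; apply: leq_trans.
have pt : perm_eq (t1 ++ t2) t.
  rewrite /t2 (eq_filter (a2 := predC (fun y => y < x)%N)); last by move=> y /=; rewrite leqNgt.
  by apply/permPl/perm_filterC.
have le12 y z : y \in t1 -> z \in t2 -> (y < x)%N /\ (x <= z)%N.
  by rewrite !mem_filter => /andP[-> _] /andP[-> _].
split; apply: (sorted_eq leq_trans anti_leq) => //.
- exact: sort_sorted.
- rewrite sorted_pairwise ?pairwise_cat //=; last exact: leq_trans.
  rewrite -!sorted_pairwise ?s1 ?s2 ?andbT //; try exact: leq_trans.
  apply/andP; split; last by apply/allP => z; rewrite mem_filter => /andP[].
  apply/allrelP => y z y1; rewrite inE => /orP[/eqP -> |z2].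
    by move: y1; rewrite mem_filter => /andP[/ltnW].
  by have [yx xz] := le12 _ _ y1 z2; apply: leq_trans xz; apply: ltnW.
- rewrite perm_sym (perm_catCA t1 [:: x] t2) /= perm_sym perm_sort.
  by rewrite perm_cons perm_sym (perm_trans pt) // perm_sort.
- rewrite sorted_pairwise ?pairwise_cat //=; last exact: leq_trans.
  rewrite -!sorted_pairwise ?s1 ?s2 ?andbT //; try exact: leq_trans.
  apply/allrelP => y z y1 z2.
  by have [yx xz] := le12 _ _ y1 z2; apply: leq_trans xz; apply: ltnW.
- by rewrite perm_sym.
Qed.

(** * Forms determined by their coefficients, top-degree forms and volume forms *)

Section VolumeForms.
Variables (R : realType) (V : vectType R) (g : {dot V for idfun}).
Implicit Types (u v w : V) (U W : {vspace V}) (e f : seq V).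

Lemma map_nth_iota0_id k e : size e = k -> [seq e`_i | i <- iota 0 k] = e.
Proof. by move=> <-; apply: mkseq_nth. Qed.

Lemma form_multilinear k (alpha : kform V k) : is_form alpha -> multilinear alpha.
Proof. by case. Qed.

Lemma fcoef_nuniq k (alpha : kform V k) e t :
  is_form alpha -> size t = k -> ~~ uniq t -> fcoef alpha e t = 0.
Proof.
move=> [_ alt] tk /(uniqPn 0%N)[i [j [ij jt tij]]].
have it : (i < size t)%N by apply: ltn_trans jt.
have ik : (i < k)%N by rewrite -tk.
have jk : (j < k)%N by rewrite -tk.
apply: (alt _ (Ordinal ik) (Ordinal jk)); first by rewrite -val_eqE /= ltn_eqF.
by rewrite /= !(nth_map 0%N) // tij.
Qed.

Lemma ev_insert k (alpha : kform V k) s1 s2 v :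
  perm_alternating alpha -> size (s1 ++ v :: s2) = k ->
  ev alpha (s1 ++ v :: s2) = (-1) ^+ size s1 * ev alpha (v :: s1 ++ s2).
Proof.
case: k alpha => [|k] alpha alt; first by rewrite size_cat addnS.
move=> sk; have lt : (size s1 < k.+1)%N by rewrite -sk size_cat addnS ltnS leq_addr.
rewrite /ev (@alternating_insert _ _ _ _ v _ (Ordinal lt)) //; last first.
  by rewrite nth_cat ltnn subnn.
congr (_ * _); rewrite -vcons_nth; congr (alpha (vcons _ _)); apply: funext => i /=.
rewrite !nth_cat /bump; case: (leqP (size s1) i) => si /=.
  by rewrite add1n ltnNge leqW //= subSn // [(i < _)%N]ltnNge si.
by rewrite add0n si.
Qed.

Lemma fcoef_sort k (alpha : kform V k) e t : is_form alpha -> size t = k ->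
  fcoef alpha e t = (list_sign t)%:~R * fcoef alpha e (sort leq t).
Proof.
elim: t k alpha => [|x t IH] [|k] alpha fa //.
- by rewrite mul1r.
- move=> [tk]; rewrite fcoef_cons (IH _ _ (interior_form _ fa) tk) -fcoef_cons /=.
  have [xt|xt] := boolP (x \in t).
    by rewrite fcoef_nuniq ?mulr0 ?mul0r //= ?size_sort ?tk // mem_sort xt.
  have [-> st] := sort_cons_leq x t.
  set t1 := filter _ _; set t2 := filter _ _.
  have E : sort leq t = t1 ++ t2 by exact: st.
  rewrite E /fcoef !map_cat /= map_cat ev_insert; last first.
  - by rewrite size_cat /= !size_map addnS -size_cat -E size_sort tk.
  - exact: form_perm_alternating.
  have -> : count (ltn^~ x) t = size t1.
    by rewrite size_filter; apply/seq.permP; rewrite perm_sym perm_sort.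
  rewrite size_map intrM rmorphXn /= rmorphN1.
  set a := _ ^+ _; have aa : a * a = 1 by rewrite -expr2 sqrr_sign.
  set b := ev _ _; set c := _%:~R; transitivity (a * a * (c * b)); last by ring.
  by rewrite aa mul1r.
Qed.

Lemma form_eq0 k (alpha : kform V k) e : is_form alpha -> onb g {:V} e ->
  (forall t, sorted ltn t -> all (ltn^~ (size e)) t -> size t = k ->
     fcoef alpha e t = 0) ->
  zero_form alpha.
Proof.
move=> fa ob z.
have {}z t : all (ltn^~ (size e)) t -> size t = k -> fcoef alpha e t = 0.
  move=> te tk; have [ut|ut] := boolP (uniq t); last by rewrite fcoef_nuniq.
  rewrite fcoef_sort // z ?mulr0 ?all_sort ?size_sort //.
  exact: sort_ltn_sorted.
elim: k alpha fa z => [|k IH] alpha fa z x.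
  by rewrite -(z [::]) //; apply: form_congr; case.
rewrite (vcons_split x) -/(interior _ alpha _).
apply: (IH _ (interior_form _ fa)) => t te tk; rewrite /fcoef ev_interior.
rewrite (ev_head_expand (g := g) _ (form_multilinear fa) ob (memvf _)) big1 // => i _.
by rewrite [ev _ _](z (val i :: t)) ?mulr0 //= ?tk // ltn_ord.
Qed.

Lemma form_scale k (alpha : kform V k) a :
  is_form alpha -> is_form (fun x => a * alpha x).
Proof.
move=> [lin alt]; split=> [x i b u v|x i j ij xij]; first by rewrite lin; ring.
by rewrite (alt _ _ _ ij xij) mulr0.
Qed.

Lemma form_add k (alpha beta : kform V k) :
  is_form alpha -> is_form beta -> is_form (fun x => alpha x + beta x).
Proof.
move=> [lina alta] [linb altb]; split=> [x i b u v|x i j ij xij].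
  by rewrite lina linb; ring.
by rewrite (alta _ _ _ ij xij) (altb _ _ _ ij xij) addr0.
Qed.

Lemma form_sum (I : Type) (r : seq I) k (alpha : I -> kform V k) :
  (forall i, is_form (alpha i)) -> is_form (fun x => \sum_(i <- r) alpha i x).
Proof.
move=> fa; split=> [x i b u v|x i j ij xij].
  rewrite mulr_sumr -big_split; apply: eq_bigr => l _; exact: form_linear.
by rewrite big1 // => l _; apply: form_alternating ij xij.
Qed.

Lemma form_eq_top k (alpha beta : kform V k) e : k = \dim {:V} ->
  is_form alpha -> is_form beta -> onb g {:V} e -> ev alpha e = ev beta e ->
  forall x, alpha x = beta x.
Proof.
move=> kV fa fb ob ab x; have se : size e = k by case: ob; rewrite -kV.
suff z : zero_form (fun y => alpha y + (-1) * beta y).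
  by have /eqP := z x; rewrite mulN1r subr_eq0 => /eqP.
apply: (form_eq0 _ ob) => [|t st te tk]; first exact/form_add/form_scale.
rewrite se in te; rewrite (sorted_iota st te tk) /fcoef.
rewrite map_nth_iota0_id //.
by move: ab; rewrite /ev => ->; rewrite mulN1r subrr.
Qed.

Lemma fcoef_top k (alpha : kform V k) e t : is_form alpha -> size e = k ->
  size t = k -> all (ltn^~ k) t -> fcoef alpha e t = (list_sign t)%:~R * ev alpha e.
Proof.
move=> fa se st tk; have [ut|ut] := boolP (uniq t); last first.
  by rewrite fcoef_nuniq // list_sign_nuniq // mul0r.
rewrite fcoef_sort // (@sorted_iota k (sort leq t)) ?size_sort ?all_sort //.
  by rewrite /fcoef map_nth_iota0_id.
exact: sort_ltn_sorted.
Qed.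

(** Only injective index functions contribute. There are [k!] of them, and their signs disappear in
    the square. *)
Lemma tuple_sum_top k (alpha : kform V k) e : is_form alpha -> size e = k ->
  tuple_sum k k (fun t => fcoef alpha e t * fcoef alpha e t) = k`!%:R * ev alpha e ^+ 2.
Proof.
move=> fa se; rewrite -(sum_ffun_tuple k k (fun t => fcoef alpha e t * fcoef alpha e t)).
transitivity (\sum_(f : {ffun 'I_k -> 'I_k} | injectiveb f) ev alpha e ^+ 2); last first.
  rewrite sumr_const -[in LHS](mulr_natl) -cardsE card_inj_ffuns !card_ord ffactnn //.
rewrite [RHS]big_mkcond; apply: eq_bigr => f _.
have uE : injectiveb f = uniq [seq val (f i) | i <- enum 'I_k].
  by rewrite /injectiveb /dinjectiveb (map_comp val f) (map_inj_uniq val_inj).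
have sE : size [seq val (f i) | i <- enum 'I_k] = k by rewrite size_map size_enum_ord.
case: ifPn; rewrite uE => uf; last by rewrite fcoef_nuniq ?mul0r.
rewrite fcoef_top //; last by apply/allP => i /mapP[j _ ->]; apply: ltn_ord.
have -> : forall a b : R, a * b * (a * b) = a ^+ 2 * b ^+ 2 by move=> a b; ring.
by rewrite -rmorphXn /= list_sign_uniq // mul1r.
Qed.

Lemma volume_form_onb k U (vol : kform V k) e :
  volume_form g U vol -> onb g U e -> ev vol e ^+ 2 = 1.
Proof.
move=> [kU [fv _] v1] ob; have se : size e = k by case: ob; rewrite kU.
have fm := form_multilinear fv.
move: v1; rewrite (form_dotE fm fm ob) -kU tuple_sum_top // mulKf //.
by rewrite pnatr_eq0 -lt0n fact_gt0.
Qed.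

(** The wedge product of the covectors dual to the vectors of [b], from which volume forms and the
    model 3-form are built. *)
Definition det_form k (b : seq V) : kform V k :=
  fun x => \det (\matrix_(i < k, j < k) g b`_j (x i)).

Lemma det_form_is_form k b : is_form (@det_form k b).
Proof.
split=> [x i a u v|x i j ij xij].
  rewrite -[X in _ = _ + X]mul1r; apply: (determinant_multilinear (i0 := i)).
  - by apply/rowP => j; rewrite !mxE /= eqxx mul1r dotDr dotZr.
  - by apply/matrixP => l j; rewrite !mxE /= eq_sym (negbTE (neq_lift _ _)).
  - by apply/matrixP => l j; rewrite !mxE /= eq_sym (negbTE (neq_lift _ _)).
by apply: (determinant_alternate ij) => l; rewrite !mxE xij.
Qed.

Lemma det_form_zero k b x i : (forall j, (j < k)%N -> g b`_j (x i) = 0) ->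
  @det_form k b x = 0.
Proof.
move=> z; rewrite /det_form (expand_det_row _ i) big1 // => j _.
by rewrite mxE z ?mul0r.
Qed.

Lemma ev_det_form_onb k b : size b = k -> orthonormal_seq g b ->
  ev (@det_form k b) b = 1.
Proof.
move=> <- on; rewrite /ev /det_form -[RHS](det1 _ (size b)); congr (\det _).
by apply/matrixP => i j; rewrite !mxE on // eq_sym.
Qed.

Lemma fcoef_det_form k e l t : orthonormal_seq g e ->
  sorted ltn l -> all (ltn^~ (size e)) l -> size l = k ->
  sorted ltn t -> all (ltn^~ (size e)) t -> size t = k ->
  fcoef (@det_form k [seq e`_i | i <- l]) e t = (l == t)%:R.
Proof.
move=> on sl le lk st te tk.
have ul : uniq l := sorted_uniq ltn_trans ltnn sl.
have ut : uniq t := sorted_uniq ltn_trans ltnn st.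
have [<-|nlt] := eqVneq l t.
  rewrite /fcoef ev_det_form_onb ?size_map // => i j; rewrite size_map => il jl.
  by rewrite !(nth_map 0%N) // on ?nth_uniq //; apply: (allP le); apply: mem_nth.
have [sub|/allPn[x xt xl]] := boolP (all (mem l) t).
  have [_ lt] := uniq_min_size ut (allP sub) (eq_leq (etrans lk (esym tk))).
  by case/eqP: nlt; apply: (irr_sorted_eq ltn_trans ltnn sl st) => i; rewrite lt.
(* An index of [t] missing from [l] gives a zero row in the determinant. *)
have [j jt xE] := nthP 0%N xt; rewrite tk in jt; rewrite -{}xE in xl.
apply: (@det_form_zero _ _ _ (Ordinal jt)) => i ik /=.
rewrite !(nth_map 0%N) ?lk ?tk // on; last 2 first.
- by apply: (allP le); rewrite mem_nth ?lk.
- by apply: (allP te); rewrite mem_nth ?tk.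
by case: eqP => // E; move: xl; rewrite -E /= mem_nth ?lk.
Qed.

Lemma det_volume_form k U e (a : R) : onb g U e -> k = \dim U -> a ^+ 2 = 1 ->
  volume_form g U (fun x => a * @det_form k e x).
Proof.
move=> ob kU a1; have [se eU on] := ob; have sk : size e = k by rewrite se.
have ff := form_scale a (det_form_is_form k e); split=> //.
  split=> // x i /orthov_dotP xi; rewrite (@det_form_zero _ _ _ i) ?mulr0 // => j jk.
  by rewrite dotC; apply/xi/eU/mem_nth; rewrite sk.
have fm := form_multilinear ff.
rewrite (form_dotE fm fm ob) -kU tuple_sum_top // mulKf; last first.
  by rewrite pnatr_eq0 -lt0n fact_gt0.
by rewrite /ev exprMn a1 mul1r [det_form _ _](ev_det_form_onb sk on) expr1n.
Qed.

End VolumeForms.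

(** * The cubic form of a 3-form in dimension seven, and Hitchin's endomorphism *)

Section ThreeFormsInDimensionSeven.
Variable R : realType.

(** A strict comparison by structural recursion, so that [cbn] decides it on numerals without
    unfolding arithmetic. *)
Fixpoint before (m n : nat) : bool :=
  match m, n with
  | _, 0 => false
  | 0, _.+1 => true
  | m'.+1, n'.+1 => before m' n'
  end.

Lemma beforeE m n : before m n = (m < n)%N.
Proof. by elim: m n => [|m IH] [|n] //=; rewrite IH ltnS. Qed.

(** Reads [q] at increasing triples only. A 3-form is thus described by 35 independent unknowns, and
    identities between forms become goals for [ring]. *)
Definition alt3 (q : nat -> nat -> nat -> R) (i j k : nat) : R :=
  if before i j then
    if before j k then q i j k else
    if before k i then q k i j else
    if before i k then if before k j then - q i k j else 0 else 0
  else if before j i then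
    if before i k then - q j i k else
    if before k j then - q k j i else
    if before j k then if before k i then q j k i else 0 else 0
  else 0.

Definition alt3_seq q (t : seq nat) : R :=
  if t is [:: i; j; k] then alt3 q i j k else 0.

Variable q : nat -> nat -> nat -> R.
Let p := alt3_seq q.

(** The coefficient of [(e_j -| phi) /\ (e_k -| phi) /\ phi] on the frame [e_0, ..., e_6], where
    [phi] has coefficients [p]. *)
Definition cubic_form j k : R :=
  shuffle_sum 4 3 (shuffle_sum 2 2 (fun t => p (j :: t)) (fun t => p (k :: t))) p
    [:: 0; 1; 2; 3; 4; 5; 6]%N.

Let I6 := [:: 1; 2; 3; 4; 5; 6]%N.

Definition others (l : nat) : seq nat := [seq i <- I6 | before i l || before l i].

(* With [omega] and [rho] the parts of the 3-form containing and not containing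
   the first vector, [tau] is [omega /\ rho], a 5-form on the 6-dimensional
   complement, and [hitchin] the endomorphism attached by Hitchin to [rho]. *)
Definition tau l : R := (-1) ^+ l * shuffle_sum 2 3 (fun t => p (0%N :: t)) p (others l).

Definition hitchin l k : R :=
  (-1) ^+ l * shuffle_sum 2 3 (fun t => p (k :: t)) p (others l).

(** This and the next lemma split off the first frame vector. Both are polynomial identities in the
    35 coefficients, checked for each choice of indices. *)
Lemma cubic_form0E k : k \in I6 ->
  cubic_form 0 k = 3 * \sum_(l <- I6) p [:: 0%N; k; l] * tau l.
Proof.
rewrite !inE !big_cons big_nil.
do ![case/orP]; move=> /eqP ->; rewrite /cubic_form /tau /p;
  cbn [shuffle_sum alt3_seq alt3 before others filter orb I6]; ring.
Qed.

Lemma cubic_formE j k : j \in I6 -> k \in I6 ->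
  cubic_form j k = 3 * \sum_(l <- I6) p [:: 0%N; j; l] * hitchin l k
                   - 3 * \sum_(l <- I6) p [:: j; k; l] * tau l.
Proof.
rewrite !inE !big_cons !big_nil.
do ![case/orP]; move=> /eqP ->; do ![case/orP]; move=> /eqP ->;
  rewrite /cubic_form /tau /hitchin /p;
  cbn [shuffle_sum alt3_seq alt3 before others filter orb I6]; ring.
Qed.

(** Hitchin's identity: the endomorphism attached to a 3-form in dimension six has scalar square;
    the scalar is read off at the first diagonal entry. *)
Lemma hitchin_sqr j k : j \in I6 -> k \in I6 ->
  \sum_(l <- I6) hitchin j l * hitchin l k =
  (j == k)%:R * \sum_(l <- I6) hitchin 1 l * hitchin l 1.
Proof.
rewrite !inE !big_cons !big_nil.
do ![case/orP]; move=> /eqP ->; do ![case/orP]; move=> /eqP ->;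
  rewrite /hitchin /p [X in X%:R]/=;
  cbn [shuffle_sum alt3_seq alt3 before others filter orb I6]; ring.
Qed.

Lemma alt3_swap12 i j k : alt3 q j i k = - alt3 q i j k.
Proof.
rewrite /alt3 !beforeE; case: (ltngtP i j) => ij; case: (ltngtP i k) => ik;
  case: (ltngtP j k) => jk; rewrite ?opprK ?oppr0 //; lia.
Qed.

Lemma alt3_swap23 i j k : alt3 q i k j = - alt3 q i j k.
Proof.
rewrite /alt3 !beforeE; case: (ltngtP i j) => ij; case: (ltngtP i k) => ik;
  case: (ltngtP j k) => jk; rewrite ?opprK ?oppr0 //; lia.
Qed.

(** Let [Om] be the matrix of [omega] and [K] that of [hitchin]. Once [tau = 0] is known, the
    hypothesis reads [Om K = a] with [a = c / 3]. Since [K^2 = la], multiplying out [Om Om K K]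
    gives [la Om^2 = a^2], and [Om] is skew, so [Om Om^T] is the scalar [m = - a^2 / la]. It is
    positive, being nonzero and a sum of squares. *)
Lemma cubic_form_definite (c : R) : c != 0 ->
  (forall j k, (j < 7)%N -> (k < 7)%N -> cubic_form j k = c * (j == k)%:R) ->
  exists2 m : R, 0 < m & forall j k, j \in I6 -> k \in I6 ->
    \sum_(l <- I6) p [:: 0%N; j; l] * p [:: 0%N; k; l] = m * (j == k)%:R.
Proof.
move=> c0 cE.
have sumE (F : nat -> R) : \sum_(l <- I6) F l = \sum_(i < 6) F i.+1.
  by rewrite !big_ord_recl big_ord0 !big_cons big_nil.
have inI (i : 'I_6) : i.+1 \in I6 by case: i; do 6?[case=> //].
have lt7 (i : 'I_6) : (i.+1 < 7)%N by rewrite ltnS.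
pose Om := \matrix_(i < 6, j < 6) p [:: 0; i.+1; j.+1]%N.
pose K := \matrix_(i < 6, j < 6) hitchin i.+1 j.+1.
have OmT : Om^T = - Om by apply/matrixP => i j; rewrite !mxE /= alt3_swap23.
have Om_tau (i : 'I_6) : \sum_(l < 6) Om i l * tau l.+1 = 0.
  have := cE 0%N i.+1 isT (lt7 i); rewrite cubic_form0E // mulr0 sumE => /eqP.
  rewrite mulf_eq0 pnatr_eq0 /= => /eqP S0; rewrite -[RHS]S0.
  by apply: eq_bigr => l _; rewrite !mxE.
have tau0 : forall n, n \in I6 -> tau n = 0.
  move=> n.
  suff z (k : 'I_6) : tau k.+1 = 0.
    by rewrite !inE; do ![case/orP]; move=> /eqP ->;
      [apply: (z 0)|apply: (z 1)|apply: (z 2%:R)|apply: (z 3%:R)|apply: (z 4%:R)|apply: (z 5%:R)].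
  (* Pair the hypothesis with [tau]: the left side becomes [c tau_k]. On the right, the Hitchin term
     vanishes because [Om tau = 0] and [Om] is skew. *)
  apply: (mulfI c0); rewrite mulr0.
  transitivity (\sum_(j < 6) tau j.+1 * cubic_form j.+1 k.+1).
    rewrite (bigD1 k) //= cE // eqxx mulr1 mulrC big1 ?addr0 // => j jk.
    by rewrite cE // eqSS val_eqE (negbTE jk) !mulr0.
  under eq_bigr do rewrite cubic_formE // !sumE mulrBr !mulr_sumr.
  rewrite big_split /= sumrN exchange_big /=.
  have -> : \sum_(l < 6) \sum_(j < 6) tau j.+1 * (3 * (p [:: 0%N; j.+1; l.+1] *
     hitchin l.+1 k.+1)) = 0.
    apply: big1 => l _.
    transitivity ((\sum_(j < 6) Om l j * tau j.+1) * (- 3 * hitchin l.+1 k.+1)); last first.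
      by rewrite Om_tau mul0r.
    by rewrite mulr_suml; apply: eq_bigr => j _; rewrite mxE /= alt3_swap23; ring.
  (* The remaining double sum is skew in [j] and [l]: added to its copy with the two indices
     exchanged, it vanishes term by term. *)
  rewrite add0r; apply/eqP; rewrite oppr_eq0 -[X in X == 0](mulKf (_ : 2 != 0 :> R)) ?pnatr_eq0 //.
  rewrite mulf_eq0 invr_eq0 pnatr_eq0 /= mulr_natl mulr2n {2}exchange_big -big_split /=.
  apply/eqP; apply: big1 => j _; rewrite -big_split /=; apply: big1 => l _.
  have -> : alt3 q j.+1 k.+1 l.+1 = - alt3 q l.+1 k.+1 j.+1.
    by rewrite alt3_swap12 alt3_swap23 alt3_swap12 !opprK.
  by ring.
have OK : Om *m K = (c / 3)%:M.
  apply/matrixP => i k; rewrite !mxE.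
  have := cE i.+1 k.+1 (lt7 i) (lt7 k); rewrite cubic_formE //.
  have -> : \sum_(l <- I6) p [:: i.+1; k.+1; l] * tau l = 0.
    by rewrite big_seq; apply: big1 => l lI; rewrite tau0 ?mulr0.
  rewrite mulr0 subr0 sumE eqSS val_eqE => E.
  rewrite -[RHS]mulr_natr mulrAC -E mulrC mulKf ?pnatr_eq0 //.
  by apply: eq_bigr => l _; rewrite !mxE.
have KK : exists la, K *m K = la%:M.
  exists (\sum_(l <- I6) hitchin 1 l * hitchin l 1); apply/matrixP => i k.
  rewrite !mxE -[RHS]mulr_natl -val_eqE -eqSS.
  rewrite -[RHS](hitchin_sqr (inI i) (inI k)) sumE.
  by apply: eq_bigr => l _; rewrite !mxE.
have [la {}KK] := KK; set a := c / 3 in OK.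
have a0 : a != 0 by rewrite mulf_neq0 // invr_eq0 pnatr_eq0.
have OOla : la *: (Om *m Om) = (a ^+ 2)%:M.
  rewrite -mul_mx_scalar -KK mulmxA -(mulmxA Om Om) OK mul_mx_scalar -scalemxAl OK.
  by rewrite scale_scalar_mx.
have la0 : la != 0.
  apply/eqP => la0; move: OOla; rewrite la0 scale0r => /matrixP/(_ 0 0)/eqP.
  by rewrite !mxE eqxx mulr1n eq_sym sqrf_eq0 (negbTE a0).
pose m := - (a ^+ 2 / la).
have OOT : Om *m Om^T = m%:M.
  rewrite OmT mulmxN -[X in - X](scalerK la0) OOla scale_scalar_mx.
  by rewrite -(raddfN (@scalar_mx R 6)) mulrC.
have OE (i k : 'I_6) : \sum_(l <- I6) p [:: 0; i.+1; l]%N * p [:: 0; k.+1; l]%N =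
    m * (i == k)%:R.
  move/matrixP: OOT => /(_ i k); rewrite !mxE mulr_natr => <-; rewrite sumE.
  by apply: eq_bigr => l _; rewrite !mxE.
exists m.
  rewrite lt_def oppr_eq0 mulf_neq0 ?invr_eq0 ?sqrf_eq0 //=.
  by have := OE 0 0; rewrite eqxx mulr1 => <-; apply: sumr_ge0 => l _; apply: sqr_ge0.
suff H (i k : 'I_6) : \sum_(l <- I6) p [:: 0; i.+1; l]%N * p [:: 0; k.+1; l]%N =
    m * (i.+1 == k.+1)%:R.
  move=> j k jI kI; have jE : j = (inord j.-1 : 'I_6).+1.
    by move: jI; rewrite !inE; do ![case/orP]; move=> /eqP ->; rewrite inordK.
  have kE : k = (inord k.-1 : 'I_6).+1.
    by move: kI; rewrite !inE; do ![case/orP]; move=> /eqP ->; rewrite inordK.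
  by rewrite {1 2}jE {1 2}kE; apply: H.
by rewrite eqSS val_eqE.
Qed.

End ThreeFormsInDimensionSeven.

(* The model 3-form e^012 + e^034 + e^056 + e^135 - e^146 - e^236 - e^245; junk
   value 0 on index lists that are not increasing. *)
Definition std_phi (t : seq nat) : int :=
  match t with
  | [:: 0; 1; 2] | [:: 0; 3; 4] | [:: 0; 5; 6] | [:: 1; 3; 5] => 1%R
  | [:: 1; 4; 6] | [:: 2; 3; 6] | [:: 2; 4; 5] => (-1)%R
  | _ => 0%R
  end%N.

(** * The orthonormal frame generated by three vectors under a cross product *)

Section CrossProductBasis.
Variables (R : realType) (V : vectType R) (g : {dot V for idfun}).
Implicit Types (u v w : V).

Variable cr : V -> V -> V.
Hypothesis cr_anti : forall u v, cr u v = - cr v u.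
Hypothesis crNr : forall u v, cr u (- v) = - cr u v.
Hypothesis cr_triple : forall u v w, g (cr u v) w = - g (cr u w) v.
(** The polarisation in [u] of the identity [u x (u x w) = - |u|^2 w + g(u, w) u]. *)
Hypothesis cr_cr : forall u v w,
  cr u (cr v w) + cr v (cr u w) = - (2 * g u v) *: w + g u w *: v + g v w *: u.

Let cr_self u v : cr u (cr u v) = - g u u *: v + g u v *: u.
Proof.
have := cr_cr u u v; rewrite -!mulr2n -!scaler_nat => /(congr1 (fun x => 2^-1 *: x)).
rewrite !scalerA mulVf ?pnatr_eq0 // scale1r => ->.
by rewrite -addrA -scalerDl scalerDr !scalerA; congr (_ *: _ + _ *: _); field.
Qed.

Let cr_orth u v w : g u v = 0 -> g u w = 0 -> g v w = 0 ->
  cr u (cr v w) = - cr v (cr u w).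
Proof.
move=> uv uw vw; have := cr_cr u v w.
by rewrite uv uw vw mulr0 oppr0 !scale0r !addr0 => /eqP; rewrite addr_eq0 => /eqP.
Qed.

Variables (e0 e1 e3 : V).
Hypotheses (e00 : g e0 e0 = 1) (e11 : g e1 e1 = 1) (e33 : g e3 e3 = 1).
Hypotheses (e01 : g e0 e1 = 0) (e03 : g e0 e3 = 0) (e13 : g e1 e3 = 0).
Hypothesis e013 : g (cr e0 e1) e3 = 0.

(** The products that [std_phi] prescribes; its coefficient -1 on [[:: 2; 3; 6]] is the reason for
    the sign of [e6]. The cross product identities then determine the whole multiplication table. *)
Let e2 := cr e0 e1.
Let e4 := cr e0 e3.
Let e5 := cr e1 e3.
Let e6 := - cr e2 e3.

Definition cross_seq := [:: e0; e1; e2; e3; e4; e5; e6].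

Let e10 : g e1 e0 = 0. Proof. by rewrite dotC. Qed.
Let e30 : g e3 e0 = 0. Proof. by rewrite dotC. Qed.
Let e31 : g e3 e1 = 0. Proof. by rewrite dotC. Qed.
Let e23 : g e2 e3 = 0. Proof. by []. Qed.
Let e32 : g e3 e2 = 0. Proof. by rewrite dotC. Qed.
Let cr_uu u : cr u u = 0.
Proof.
have /eqP := cr_anti u u; rewrite -subr_eq0 opprK -mulr2n -scaler_nat.
by rewrite scaler_eq0 pnatr_eq0 => /eqP.
Qed.
Let cr_u u v : g (cr u v) u = 0.
Proof. by rewrite cr_triple cr_uu dot0l oppr0. Qed.
Let cr_v u v : g (cr u v) v = 0.
Proof. by rewrite cr_anti dotNl cr_u oppr0. Qed.
Let e20 : g e2 e0 = 0. Proof. exact: cr_u. Qed.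
Let e21 : g e2 e1 = 0. Proof. exact: cr_v. Qed.
Let e02 : g e0 e2 = 0. Proof. by rewrite dotC. Qed.
Let e12 : g e1 e2 = 0. Proof. by rewrite dotC. Qed.

Let c01 : cr e0 e1 = e2. Proof. by []. Qed.
Let c02 : cr e0 e2 = - e1.
Proof. by rewrite cr_self e00 e01 scaleN1r scale0r addr0. Qed.
Let c12 : cr e1 e2 = e0.
Proof.
by rewrite /e2 [cr e0 e1]cr_anti crNr cr_self e11 e10 scaleN1r scale0r addr0 opprK.
Qed.
Let e22 : g e2 e2 = 1.
Proof. by rewrite {1}/e2 cr_triple c02 dotNl opprK. Qed.
Let c03 : cr e0 e3 = e4. Proof. by []. Qed.
Let c13 : cr e1 e3 = e5. Proof. by []. Qed.
Let c23 : cr e2 e3 = - e6. Proof. by rewrite opprK. Qed.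
Let c04 : cr e0 e4 = - e3.
Proof. by rewrite cr_self e00 e03 scaleN1r scale0r addr0. Qed.
Let c15 : cr e1 e5 = - e3.
Proof. by rewrite cr_self e11 e13 scaleN1r scale0r addr0. Qed.
Let c26 : cr e2 e6 = e3.
Proof. by rewrite crNr cr_self e22 e23 scaleN1r scale0r addr0 opprK. Qed.
Let e40 : g e4 e0 = 0. Proof. exact: cr_u. Qed.
Let e41 : g e4 e1 = 0. Proof. by rewrite cr_triple c01 e23 oppr0. Qed.
Let e42 : g e4 e2 = 0. Proof. by rewrite cr_triple c02 dotNl e13 !oppr0. Qed.
Let e43 : g e4 e3 = 0. Proof. exact: cr_v. Qed.
Let e50 : g e5 e0 = 0.
Proof. by rewrite cr_triple cr_anti dotNl opprK; exact: e23. Qed.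
Let e51 : g e5 e1 = 0. Proof. exact: cr_u. Qed.
Let e52 : g e5 e2 = 0. Proof. by rewrite cr_triple c12 e03 oppr0. Qed.
Let e53 : g e5 e3 = 0. Proof. exact: cr_v. Qed.
Let e60 : g e6 e0 = 0.
Proof. by rewrite dotNl cr_triple cr_anti c02 !opprK. Qed.
Let e61 : g e6 e1 = 0.
Proof. by rewrite dotNl cr_triple cr_anti c12 dotNl e03 !oppr0. Qed.
Let e62 : g e6 e2 = 0. Proof. by rewrite dotNl cr_u oppr0. Qed.
Let e63 : g e6 e3 = 0. Proof. by rewrite dotNl cr_v oppr0. Qed.
Let c05 : cr e0 e5 = e6.
Proof.
have := cr_orth e30 e31 e01; rewrite -/e2 [cr e3 e1]cr_anti crNr opprK -/e5 => <-.
by rewrite cr_anti.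
Qed.
Let c14 : cr e1 e4 = - e6. Proof. by rewrite -c05 /e5 cr_orth // opprK. Qed.
Let e05 : g e0 e5 = 0. Proof. by rewrite dotC. Qed.
Let e14 : g e1 e4 = 0. Proof. by rewrite dotC. Qed.
Let c06 : cr e0 e6 = - e5.
Proof. by rewrite -c05 cr_self e00 e05 scaleN1r scale0r addr0. Qed.
Let c16 : cr e1 e6 = e4.
Proof. by rewrite -[e6]opprK -c14 crNr cr_self e11 e14 scaleN1r scale0r addr0 opprK. Qed.
Let c24 : cr e2 e4 = - e5.
Proof. by rewrite cr_orth // c23 crNr c06 opprK. Qed.
Let c25 : cr e2 e5 = e4.
Proof. by rewrite cr_orth // c23 crNr c16 opprK. Qed.
Let c34 : cr e3 e4 = e0.
Proof.
by rewrite /e4 [cr e0 e3]cr_anti crNr cr_self e33 e30 scaleN1r scale0r addr0 opprK.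
Qed.
Let c35 : cr e3 e5 = e1.
Proof.
by rewrite /e5 [cr e1 e3]cr_anti crNr cr_self e33 e31 scaleN1r scale0r addr0 opprK.
Qed.
Let c45 : cr e4 e5 = - e2.
Proof. by rewrite cr_orth // [cr e4 e3]cr_anti c34 crNr opprK cr_anti. Qed.
Let e44 : g e4 e4 = 1.
Proof. by rewrite {1}/e4 cr_triple c04 dotNl opprK. Qed.
Let e55 : g e5 e5 = 1.
Proof. by rewrite {1}/e5 cr_triple c15 dotNl opprK. Qed.
Let e66 : g e6 e6 = 1.
Proof. by rewrite {1}/e6 dotNl cr_triple c26 opprK. Qed.
Let e45 : g e4 e5 = 0.
Proof. by rewrite cr_triple c05 e63 oppr0. Qed.
Let e46 : g e4 e6 = 0.
Proof. by rewrite cr_triple c06 dotNl e53 !oppr0. Qed.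
Let e56 : g e5 e6 = 0.
Proof. by rewrite cr_triple c16 e43 oppr0. Qed.

Lemma cross_seq_orthonormal : orthonormal_seq g cross_seq.
Proof.
by case=> [|[|[|[|[|[|[|i]]]]]]] // [|[|[|[|[|[|[|j]]]]]]] // _ _ /=; rewrite // dotC.
Qed.

Lemma cross_seq_table i j k : (i < j)%N -> (j < k)%N -> (k < 7)%N ->
  g (cr cross_seq`_i cross_seq`_j) cross_seq`_k = (std_phi [:: i; j; k])%:~R.
Proof.
case: i => [|[|[|[|[|[|[|i]]]]]]] //; case: j => [|[|[|[|[|[|[|j]]]]]]] //;
  case: k => [|[|[|[|[|[|[|k]]]]]]] // _ _ _ /=;
  clearbody e6 e5 e4 e2;
  rewrite ?c01 ?c02 ?c03 ?c04 ?c05 ?c06 ?c12 ?c13 ?c14 ?c15 ?c16 ?c23 ?c24 ?c25 ?c34 ?c35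
    ?c45 ?dotNl ?e11 ?e22 ?e33 ?e44 ?e55 ?e66 ?rmorphN //;
  apply/eqP; rewrite ?oppr_eq0; apply/eqP; rewrite // dotC //.
Qed.

End CrossProductBasis.

Section ShuffleSums.
Variable R : realType.

Lemma shuffle_sum_map T T' (h : T -> T') p q (A B : seq T' -> R) s :
  shuffle_sum p q A B [seq h i | i <- s] =
  shuffle_sum p q (fun t => A [seq h i | i <- t]) (fun t => B [seq h i | i <- t]) s.
Proof. by elim: s p q A B => [//|x s IH] [|p] [|q] A B /=; rewrite ?IH. Qed.

Lemma eq_shuffle_sum (T : eqType) p q (A A' B B' : seq T -> R) s : size s = (p + q)%N ->
  (forall t, size t = p -> subseq t s -> A t = A' t) ->
  (forall t, size t = q -> subseq t s -> B t = B' t) ->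
  shuffle_sum p q A B s = shuffle_sum p q A' B' s.
Proof.
elim: s p q A A' B B' => [|x s IH] p q A A' B B'.
  by case: p q => [|p] [|q] // _ AA BB /=; rewrite AA // BB.
have sub t : subseq t s -> subseq (x :: t) (x :: s) by rewrite /= eqxx.
have sub' t : subseq t s -> subseq t (x :: s).
  by move=> /subseq_trans; apply; apply: subseq_cons.
case: p q => [|p] [|q] // [spq] AA BB /=; rewrite ?addr0 ?add0r.
- congr (_ * _); apply: IH => // t tq ts; last by apply: BB; rewrite /= ?tq //; apply: sub.
  by apply: AA => //; apply: sub'.
- apply: IH => // t tp ts; first by apply: AA; rewrite /= ?tp //; apply: sub.
  by apply: BB => //; apply: sub'.
congr (_ + _ * _); apply: IH; rewrite ?spq ?addnS // => t ts tsub.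
- by apply: AA; rewrite /= ?ts //; apply: sub.
- by apply: BB => //; apply: sub'.
- by apply: AA => //; apply: sub'.
- by apply: BB; rewrite /= ?ts //; apply: sub.
Qed.

Lemma alt3E (F : nat -> nat -> nat -> R) :
  (forall i j k, F j i k = - F i j k) -> (forall i j k, F i k j = - F i j k) ->
  forall i j k, F i j k = alt3 F i j k.
Proof.
move=> s12 s23 i j k.
have z12 x y : F x x y = 0 by have := s12 x x y; lra.
have z23 x y : F x y y = 0 by have := s23 x y y; lra.
have z13 x y : F x y x = 0 by rewrite s23 z12 oppr0.
rewrite /alt3 !beforeE.
case: (ltngtP i j) => ij; case: (ltngtP j k) => jk; case: (ltngtP i k) => ik;
  try lia; subst; rewrite ?z12 ?z23 ?z13 ?oppr0 //.
all: first [by rewrite [LHS]s12 | by rewrite [LHS]s23 | by rewrite [LHS]s12 s23 opprK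
  | by rewrite [LHS]s23 s12 opprK | by rewrite [LHS]s12 s23 s12 !opprK].
Qed.

End ShuffleSums.

(** * The cross product of a G2-structure and its adapted frames *)

Section G2Forms.
Variables (R : realType) (V : vectType R) (g : {dot V for idfun}).
Implicit Types (u v w : V) (e f : seq V).

Section ThreeForm.
Variables (phi : kform V 3).
Hypothesis phi_form : is_form phi.

Let alt := form_perm_alternating phi_form.

Lemma ev3_swap12 u v w : ev phi [:: v; u; w] = - ev phi [:: u; v; w].
Proof. by rewrite (@ev_insert _ _ _ phi [:: v] [:: w] u alt) // expr1 mulN1r. Qed.

Lemma ev3_swap23 u v w : ev phi [:: u; w; v] = - ev phi [:: u; v; w].
Proof.
have := @ev_insert _ _ _ (interior u phi) [:: w] [::] v (interior_perm_alternating _ alt).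
by rewrite !ev_interior => -> //; rewrite expr1 mulN1r.
Qed.

Lemma fcoef3E e t : size t = 3%N ->
  fcoef phi e t = alt3_seq (fun i j k => fcoef phi e [:: i; j; k]) t.
Proof.
case: t => [|i [|j [|k []]]] // _; rewrite /alt3_seq.
apply: (alt3E (F := fun i j k => fcoef phi e [:: i; j; k])) => *.
  exact: ev3_swap12.
exact: ev3_swap23.
Qed.

(** Turns [G2_metric] into the hypothesis of [cubic_form_definite], the constant being six times the
    volume of the frame. *)
Lemma fcoef_cubic (vol : kform V 7) e j k : G2_metric phi g vol -> size e = 7%N ->
  cubic_form (fun i j k => fcoef phi e [:: i; j; k]) j k =
  6 * g e`_j e`_k * ev vol e.
Proof.
move=> [_ Gm] se; rewrite -mulrA [g _ _ * _]Gm mulrA mulfV ?pnatr_eq0 // mul1r.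
rewrite -[wedge _ _ _]/(ev (wedge _ phi) e) ev_wedge //; last exact: wedge_perm_alternating.
rewrite -[X in _ = shuffle_sum _ _ _ _ X](map_nth_iota0_id se) shuffle_sum_map /cubic_form.
apply: eq_shuffle_sum => // t st _; last by rewrite -fcoef3E.
rewrite ev_wedge ?size_map //; try exact: interior_perm_alternating.
rewrite shuffle_sum_map; apply: eq_shuffle_sum => // t' st' _.
  by rewrite ev_interior -fcoef3E //= ?st'.
by rewrite ev_interior -fcoef3E //= ?st'.
Qed.

End ThreeForm.

Section Metric.
Variables (phi : kform V 3) (vol : kform V 7).
Hypotheses (phi_form : is_form phi) (phi_g : G2_metric phi g vol).

Let dim7 : \dim {:V} = 7%N. Proof. by case: phi_g => -[<-]. Qed.

Lemma onb7_size e : onb g {:V} e -> size e = 7%N.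
Proof. by case=> ->. Qed.

Lemma onb7_vol e : onb g {:V} e -> ev vol e ^+ 2 = 1.
Proof. by apply: volume_form_onb; case: phi_g. Qed.

Lemma fcoef_definite e : onb g {:V} e ->
  exists2 m : R, 0 < m & forall j k, j \in [:: 1; 2; 3; 4; 5; 6]%N ->
    k \in [:: 1; 2; 3; 4; 5; 6]%N ->
    \sum_(l <- [:: 1; 2; 3; 4; 5; 6]%N)
       fcoef phi e [:: 0; j; l]%N * fcoef phi e [:: 0; k; l]%N = m * (j == k)%:R.
Proof.
move=> ob; have se := onb7_size ob; have [_ _ on] := ob.
have [||m m0 H] := @cubic_form_definite _ (fun i j k => fcoef phi e [:: i; j; k]) (6 * ev vol e).
- by rewrite mulf_neq0 ?pnatr_eq0 // -sqrf_eq0 onb7_vol ?oner_eq0.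
- by move=> j k j7 k7; rewrite (fcoef_cubic _ _ _ phi_g) // on ?se // mulrAC.
exists m => // j k jI kI; rewrite -H //; apply: eq_bigr => l _.
by rewrite -!fcoef3E.
Qed.

Variable b : seq V.
Hypothesis bP : onb g {:V} b.

(** The basis [b] serves to produce a vector; [dot_cross] characterises it independently of [b]. *)
Definition cross u v : V := \sum_(i < size b) ev phi [:: u; v; b`_i] *: b`_i.

Lemma ev3_linear u v a w w' :
  ev phi [:: u; v; a *: w + w'] = a * ev phi [:: u; v; w] + ev phi [:: u; v; w'].
Proof.
have := ev_head_linear [::] a w w'
  (interior_multilinear v (interior_multilinear u (form_multilinear phi_form))).
by rewrite !ev_interior.
Qed.

Lemma ev3_linear2 u v a w w' :
  ev phi [:: u; a *: w + w'; v] = a * ev phi [:: u; w; v] + ev phi [:: u; w'; v].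
Proof.
have := ev_head_linear [:: v] a w w'
  (interior_multilinear u (form_multilinear phi_form)).
by rewrite !ev_interior.
Qed.

Lemma dot_cross u v w : g (cross u v) w = ev phi [:: u; v; w].
Proof.
rewrite dot_suml [in RHS](onb_expand bP (memvf w)).
rewrite (@linear_sum_scale _ _ (fun z => ev phi [:: u; v; z]) b (fun i => g b`_i w)).
  by apply: eq_bigr => i _; rewrite dotZl mulrC.
by move=> a z z'; apply: ev3_linear.
Qed.

Lemma dot_inj u v : (forall w, g u w = g v w) -> u = v.
Proof.
move=> uv; apply/eqP; rewrite -subr_eq0 -(dot_eq0 g) dotDl dotNl uv subrr //.
Qed.

Lemma cross_linear u a w w' : cross u (a *: w + w') = a *: cross u w + cross u w'.
Proof. by apply: dot_inj => z; rewrite dotDl dotZl !dot_cross ev3_linear2. Qed.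

Lemma cross_anti u v : cross u v = - cross v u.
Proof. by apply: dot_inj => w; rewrite dotNl !dot_cross (ev3_swap12 phi_form). Qed.

Lemma dot_onb (U : {vspace V}) e u v : onb g U e -> u \in U ->
  g u v = \sum_(i < size e) g e`_i u * g e`_i v.
Proof.
move=> ob uU; rewrite {1}(onb_expand ob uU) dot_suml.
by apply: eq_bigr => i _; rewrite dotZl.
Qed.

Lemma big_ord7 (F : nat -> R) n : n = 7%N ->
  \sum_(i < n) F i = F 0%N + \sum_(i <- [:: 1; 2; 3; 4; 5; 6]%N) F i.
Proof.
move=> ->; rewrite !big_ord_recl big_ord0 !big_cons big_nil /=.
by [].
Qed.

(** In an orthonormal frame starting with [u], the rows [phi(u, e_j, -)] for [j > 0] are pairwise
    orthogonal and of equal norm, by [fcoef_definite]. *)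
Lemma cross_norm_at u : g u u = 1 -> exists2 m : R, 0 < m &
  forall w, g u w = 0 -> g (cross u w) (cross u w) = m * g w w.
Proof.
move=> u1; have [|f ob] := @onb_extend _ _ g {:V} [:: u] _ (fun x _ => memvf x).
  by move=> [|i] [|j].
have sf := onb7_size ob; set h := ([:: u] ++ f) in ob sf.
have [m m0 mE] := fcoef_definite ob; exists m => // w uw.
rewrite (dot_onb _ ob (memvf _)) (dot_onb w ob (memvf w)).
rewrite (big_ord7 (fun i => g h`_i (cross u w) * g h`_i (cross u w)) sf).
rewrite (big_ord7 (fun i => g h`_i w * g h`_i w) sf).
rewrite -[h`_0]/u uw mul0r add0r dotC dot_cross.
have z0 x : ev phi [:: u; x; u] = 0.
  by have := ev3_swap12 phi_form u u x; have := ev3_swap23 phi_form u u x; lra.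
rewrite z0 mul0r add0r.
have E l : g h`_l (cross u w) = \sum_(j <- [:: 1; 2; 3; 4; 5; 6]%N)
    g h`_j w * fcoef phi h [:: 0%N; j; l].
  rewrite dotC dot_cross {1}(onb_expand ob (memvf w)).
  rewrite (@linear_sum_scale _ _ (fun z => ev phi [:: u; z; h`_l]) h (fun i => g h`_i w)).
    by rewrite (big_ord7 (fun i => g h`_i w * ev phi [:: u; h`_i; h`_l]) sf) uw mul0r add0r.
  by move=> a z z'; apply: ev3_linear2.
under eq_bigr do rewrite E mulr_suml.
rewrite exchange_big mulr_sumr big_seq [RHS]big_seq /=; apply: eq_bigr => j jI.
under eq_bigr do rewrite mulr_sumr.
rewrite exchange_big /=.
transitivity (\sum_(k <- [:: 1; 2; 3; 4; 5; 6]%N)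
   (g h`_j w * g h`_k w) * (m * (j == k)%:R)).
  by apply: eq_big_seq => k kI; rewrite -mE // mulr_sumr; apply: eq_bigr => l _; ring.
rewrite (bigD1_seq j) //= eqxx mulr1 big1 ?addr0 => [|k]; first by rewrite mulrC.
by rewrite eq_sym => /negbTE ->; rewrite !mulr0.
Qed.

Lemma unit_normal_sub (U : {vspace V}) : (\dim U < 7)%N ->
  exists2 x, g x x = 1 & forall y, y \in U -> g y x = 0.
Proof.
move=> dU; have [e ob] := onb_exists g U; have [se eU on] := ob.
have [||x [_ x1 ex]] := @unit_normal _ _ g {:V} e on; [by move=> ? _; apply: memvf| |].
  by rewrite se dim7.
exists x => // y yU; rewrite (onb_expand ob yU) dot_suml big1 // => i _.
by rewrite dotZl ex // mulr0.
Qed.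

Lemma cross_self u : cross u u = 0.
Proof.
apply: dot_inj => w; rewrite dot_cross dot0l.
by have := ev3_swap12 phi_form u u w; lra.
Qed.

Lemma crossZl a u v : cross (a *: u) v = a *: cross u v.
Proof.
have H := cross_linear v a u 0; rewrite addr0 in H; rewrite cross_anti H.
have -> : cross v 0 = 0 by have := cross_linear v (-1) 0 0; rewrite scaler0 addr0 scaleN1r addNr.
by rewrite addr0 -scalerN -cross_anti.
Qed.

(** The factor of [cross_norm_at] does not depend on the unit vector: two unit vectors have a common
    unit normal [y], and by skewness each has the same factor as [y]. The general case follows by
    scaling [u] and removing from [w] its component along [u]. *)
Lemma cross_norm : exists2 m : R, 0 < m & forall u w,
  g (cross u w) (cross u w) = m * (g u u * g w w - g u w ^+ 2).
Proof.
have [e ob] := onb_exists g {:V}; have [_ _ on] := ob.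
have e1 : g e`_0 e`_0 = 1 by rewrite on ?eqxx // (onb7_size ob).
have [m m0 mE] := cross_norm_at e1; exists m => // u w.
have sym x y : g (cross x y) (cross x y) = g (cross y x) (cross y x).
  by rewrite cross_anti dotNl dotNr opprK.
have unitE v x : g v v = 1 -> g v x = 0 -> g (cross v x) (cross v x) = m * g x x.
  move=> v1 vx; have [mv _ mvE] := cross_norm_at v1; rewrite mvE //; congr (_ * _).
  have [|y y1 yU] := @unit_normal_sub <<[:: e`_0; v]>>.
    by apply: leq_ltn_trans (dim_span _) _.
  have ve : g v y = 0 by apply/yU/memv_span; rewrite !inE eqxx orbT.
  have ee : g e`_0 y = 0 by apply/yU/memv_span; rewrite !inE eqxx.
  have [my _ myE] := cross_norm_at y1.
  have := mvE y ve; rewrite y1 mulr1 => <-; rewrite sym myE 1?dotC // v1 mulr1.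
  have := mE y ee; rewrite y1 mulr1 => <-; rewrite sym myE 1?dotC // e1 mulr1 //.
have [->|u0] := eqVneq u 0.
  by rewrite -(scale0r (0 : V)) crossZl !scale0r !dot0l; ring.
pose n := Num.sqrt (g u u).
have n2 : n ^+ 2 = g u u by rewrite sqr_sqrtr // ltW // dot_gt0.
have n0 : n != 0 by rewrite -sqrf_eq0 n2 dot_eq0.
pose v := n^-1 *: u; have uE : u = n *: v by rewrite scalerA mulfV // scale1r.
have v1 : g v v = 1 by rewrite dotZl dotZr -n2; field.
clearbody v; pose x := - g v w *: v + w.
have vx : g v x = 0 by rewrite /x dotDr dotZr v1; ring.
have cx : cross v x = cross v w by rewrite cross_linear cross_self scaler0 add0r.
rewrite uE crossZl !dotZl !dotZr -cx unitE // /x dotDl !dotDr !dotZl !dotZr v1 (dotC g w v).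
by ring.
Qed.

Lemma cross_polar : exists2 m : R, 0 < m & forall u v x y,
  g (cross u x) (cross v y) + g (cross v x) (cross u y) =
  m * (2 * g u v * g x y - g u x * g v y - g v x * g u y).
Proof.
have [m m0 mE] := cross_norm; exists m => // u v x y.
have crossD z a c : cross z (a + c) = cross z a + cross z c.
  by rewrite -[X in cross z (X + _)]scale1r cross_linear scale1r.
have crossDl z a c : cross (a + c) z = cross a z + cross c z.
  by rewrite cross_anti crossD opprD -!cross_anti.
have P1 a z w : g (cross a z) (cross a w) = m * (g a a * g z w - g a z * g a w).
  have := mE a (z + w); rewrite crossD !dotDl !dotDr (dotC g (cross a w)) (dotC g w z) !mE.
  by lra.
have := P1 (u + v) x y; rewrite !crossDl !dotDl !dotDr !P1 (dotC g v u) => H.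
by lra.
Qed.

(** Write the factor of [cross_polar] as [s^2]. Then [s^-1] times [cross] satisfies the cross
    product identities, so in the generated frame [phi] is [s] times the model form. The cubic form
    at [(0, 0)] is then [6 s^3], hence [vol] takes the value [s^3] on the frame; as that value
    squares to one and [s > 0], [s = 1]. *)
Lemma G2_adapted_basis u v w :
  g u u = 1 -> g v v = 1 -> g w w = 1 -> g u v = 0 -> g u w = 0 -> g v w = 0 ->
  ev phi [:: u; v; w] = 0 ->
  exists e, [/\ onb g {:V} e, [/\ e`_0 = u, e`_1 = v & e`_3 = w], ev vol e = 1 &
    forall i j k, (i < j)%N -> (j < k)%N -> (k < 7)%N ->
      fcoef phi e [:: i; j; k] = (std_phi [:: i; j; k])%:~R].
Proof.
move=> u1 v1 w1 uv uw vw uvw; have [m m0 mE] := cross_polar.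
pose s := Num.sqrt m; have s2 : s ^+ 2 = m by rewrite sqr_sqrtr // ltW.
have s0 : 0 < s by rewrite sqrtr_gt0.
pose cr x y := s^-1 *: cross x y.
have sn0 : s != 0 by rewrite gt_eqF.
have cr_anti x y : cr x y = - cr y x by rewrite /cr cross_anti scalerN.
have crNr x y : cr x (- y) = - cr x y.
  by rewrite /cr -scalerN [in LHS]cross_anti -(scaleN1r y) crossZl scaleN1r opprK (cross_anti y).
have crE x y z : g (cr x y) z = s^-1 * ev phi [:: x; y; z] by rewrite dotZl dot_cross.
have cr_triple x y z : g (cr x y) z = - g (cr x z) y.
  by rewrite !crE -mulrN (ev3_swap23 phi_form).
have crc x y z t : g (cr x y) (cr z t) = s^-1 ^+ 2 * g (cross x y) (cross z t).
  by rewrite dotZl dotZr mulrA expr2.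
clearbody cr.
have cr_cr x y z : cr x (cr y z) + cr y (cr x z) =
    - (2 * g x y) *: z + g x z *: y + g y z *: x.
  apply: dot_inj => t; rewrite !dotDl !dotZl.
  have -> : g (cr x (cr y z)) t = - g (cr y z) (cr x t) by rewrite cr_triple dotC.
  have -> : g (cr y (cr x z)) t = - g (cr x z) (cr y t) by rewrite cr_triple dotC.
  rewrite !crc -opprD addrC -mulrDr mE -s2.
  by field.
pose e := cross_seq cr u v w.
have uvw' : g (cr u v) w = 0 by rewrite crE uvw mulr0.
have on : orthonormal_seq g e by apply: cross_seq_orthonormal.
have ob : onb g {:V} e.
  by split=> [|? _|//]; [rewrite dim7|apply: memvf].
have tab i j k : (i < j)%N -> (j < k)%N -> (k < 7)%N ->
    fcoef phi e [:: i; j; k] = s * (std_phi [:: i; j; k])%:~R.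
  move=> ij jk k7; have <- := cross_seq_table cr_anti crNr cr_triple cr_cr
    u1 v1 w1 uv uw vw uvw' ij jk k7.
  by rewrite crE mulrA mulfV // mul1r.
have nu2 := onb7_vol ob.
have cub : cubic_form (fun i j k => fcoef phi e [:: i; j; k]) 0 0 = 6 * s ^+ 3.
  rewrite /cubic_form; cbn [shuffle_sum alt3_seq alt3 before].
  rewrite !tab // [std_phi _]/=; ring.
have snu : s ^+ 3 = ev vol e.
  move: cub; rewrite (fcoef_cubic _ _ _ phi_g) // on // eqxx mulr1 => /mulfI ->.
    by [].
  by rewrite pnatr_eq0.
have s1 : s = 1.
  apply/eqP; rewrite -(@pexpr_eq1 _ _ 6) ?ltW //.
  by rewrite (_ : 6 = 3 * 2)%N // exprM snu nu2.
exists e; split=> //; first by rewrite -snu s1 expr1n.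
by move=> i j k *; rewrite tab // s1 mul1r.
Qed.

End Metric.

End G2Forms.

(* The Hodge dual of the model 3-form, with the same convention. *)
Definition std_psi (t : seq nat) : int :=
  match t with
  | [:: 3; 4; 5; 6] | [:: 1; 2; 5; 6] | [:: 1; 2; 3; 4] | [:: 0; 2; 4; 6] => 1%R
  | [:: 0; 2; 3; 5] | [:: 0; 1; 4; 5] | [:: 0; 1; 3; 6] => (-1)%R
  | _ => 0%R
  end%N.

(** The totally skew extensions of the tables to all index lists, kept in the integers so that
    identities between them can be decided by evaluation. *)
Definition phi0 (t : seq nat) : int := list_sign t * std_phi (sort leq t).
Definition psi0 (t : seq nat) : int := list_sign t * std_psi (sort leq t).

Fixpoint tuples (d k : nat) : seq (seq nat) :=
  if k is k'.+1 then [seq i :: t | i <- iota 0 d, t <- tuples d k'] else [:: [::]].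

Lemma mem_tuples d k t : size t = k -> all (ltn^~ d) t -> t \in tuples d k.
Proof.
elim: k t => [|k IH] [|i t] //= [tk] /andP[id td].
by apply/allpairsP; exists (i, t); rewrite /= mem_iota id IH.
Qed.

(** * Hodge duality of the model 3-form and 4-form *)

Section StandardForms.
Variables (R : realType) (V : vectType R) (g : {dot V for idfun}).
Implicit Types (u v w : V) (e f : seq V).

Lemma tuple_sumE d k (F : seq nat -> R) :
  tuple_sum d k F = \sum_(t <- tuples d k) F t.
Proof.
elim: k F => [|k IH] F /=; first by rewrite big_seq1.
rewrite big_allpairs_dep -[in RHS](subn0 d) -/(index_iota 0 d) big_mkord /=.
by apply: eq_bigr => i _; rewrite IH subn0.
Qed.

Lemma sum_intr (I : Type) (r : seq I) (F : I -> int) :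
  \sum_(i <- r) (F i)%:~R = (foldr (fun i z => F i + z) 0 r)%:~R :> R.
Proof. by elim: r => [|i r IH]; rewrite ?big_nil // big_cons IH /= intrD. Qed.

(** Evaluated on all lists [s]. The filter keeps the 42 orderings of the seven model triples, and
    the factor 6 is the number of orderings of each triple, divided out in [hodge]. *)
Lemma hodge_table s : s \in tuples 7 4 ->
  foldr (fun t z => phi0 t * list_sign (t ++ s) + z) 0
    [seq t <- tuples 7 3 | phi0 t != 0] = 6 * psi0 s.
Proof.
move=> sT; apply/eqP.
have : all (fun s => foldr (fun t z => phi0 t * list_sign (t ++ s) + z) 0
    [seq t <- tuples 7 3 | phi0 t != 0] == 6 * psi0 s) (tuples 7 4).
  by vm_cast_no_check (erefl true).
by move=> /allP/(_ _ sT).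
Qed.

Lemma table_fcoef (phi : kform V 3) e t : is_form phi ->
  (forall i j k, (i < j)%N -> (j < k)%N -> (k < 7)%N ->
     fcoef phi e [:: i; j; k] = (std_phi [:: i; j; k])%:~R) ->
  size t = 3%N -> all (ltn^~ 7) t -> fcoef phi e t = (phi0 t)%:~R.
Proof.
move=> fp tab st t7; rewrite fcoef_sort // /phi0 intrM.
have [ut|ut] := boolP (uniq t); last by rewrite list_sign_nuniq // !mul0r.
congr (_ * _); have := sort_ltn_sorted ut.
move: t7; rewrite -(all_sort _ leq); have := size_sort leq t; rewrite st.
case: (sort leq t) => [|i [|j [|k []]]] // _ /= /and4P[_ _ k7 _] /and3P[ij jk _].
exact: tab.
Qed.

Lemma hodge_fcoef (phi : kform V 3) (vol : kform V 7) e s :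
  is_form phi -> is_form vol -> onb g {:V} e -> size e = 7%N -> ev vol e = 1 ->
  (forall i j k, (i < j)%N -> (j < k)%N -> (k < 7)%N ->
     fcoef phi e [:: i; j; k] = (std_phi [:: i; j; k])%:~R) ->
  size s = 4%N -> all (ltn^~ 7) s ->
  fcoef (@hodge R V g {:V} 3 4 vol phi) e s = (psi0 s)%:~R.
Proof.
move=> fp fv ob se v1 tab ss s7; have [dV _ _] := ob.
rewrite /fcoef (hodgeE _ (form_multilinear fp) (form_multilinear fv) ob) -dV se.
rewrite (@eq_tuple_sum _ _ _ _ (fun t => (phi0 t * list_sign (t ++ s))%:~R)); last first.
  move=> t t3 t7; rewrite table_fcoef // -map_cat intrM; congr (_ * _).
  by rewrite [LHS](fcoef_top fv se) ?v1 ?mulr1 ?size_cat ?t3 ?ss // all_cat t7.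
rewrite tuple_sumE (bigID (fun t => phi0 t != 0)) /= [X in _ + X]big1 ?addr0; last first.
  by move=> t; rewrite negbK => /eqP ->; rewrite mul0r.
rewrite -big_filter sum_intr hodge_table; last exact: mem_tuples.
by rewrite intrM mulKf // pnatr_eq0.
Qed.

End StandardForms.

(** * The Chevalley-Eilenberg differential in an orthonormal frame *)

Section Differential.
Variables (R : realType) (V : vectType R) (g : {dot V for idfun}).
Variable br : {bilinear V -> V -> V}.
Implicit Types (u v w : V) (e f : seq V).

Lemma ev_ce_diff p (alpha : kform V p.+1) s :
  ev (ce_diff br alpha) s = \sum_(j <- iota 0 p.+2) \sum_(i <- iota 0 p.+1 | (i < j)%N)
    (-1) ^+ (i + j) * ev alpha (br s`_i s`_j ::
      [seq s`_l | l <- [seq bump j (bump i l) | l <- iota 0 p]]).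
Proof.
rewrite -[iota 0 p.+2]/(index_iota 0 p.+2) big_mkord; apply: eq_bigr => j _.
rewrite -[iota 0 p.+1]/(index_iota 0 p.+1) big_mkord; apply: eq_bigr => i ij.
congr (_ * _); rewrite -ev_interior /interior /ev.
apply: form_congr => l; rewrite /vcons; case: unliftP => [k _|_] /=.
  by rewrite -map_comp (nth_map 0%N) ?size_iota // nth_iota.
by rewrite [bump j i]/bump leqNgt ij.
Qed.

Definition dcoef e (m i j : nat) : R := g e`_m (br e`_i e`_j).

(** The negative of the differential of the covector [g v], so that its coefficients on a frame are
    the structure constants themselves. *)
Definition dcovector v : kform V 2 := fun x => g v (br (x ord0) (x ord_max)).

Lemma dcovector_form v : (forall w, br w w = 0) -> is_form (dcovector v).
Proof.
move=> alt; split=> [x i a u w|x i j]; rewrite /dcovector /=.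
  case: (unliftP ord0 i) => [k|] -> /=.
    have -> : lift ord0 k = ord_max by apply: val_inj; case: k => -[].
    by rewrite /= linearPr dotDr dotZr.
  by rewrite /= linearPl dotDr dotZr.
have altn u w : br u w = - br w u.
  have := alt (u + w); rewrite linearDl !linearDr /= !alt add0r addr0 => /eqP.
  by rewrite addr_eq0 => /eqP.
move=> ij xij; have {ij xij} -> : x ord0 = x ord_max.
  move: ij xij; case: (unliftP ord0 i) => [k|] ->; case: (unliftP ord0 j) => [l|] -> //.
  - by case: k l => -[] // ? [[]] // ?; rewrite eqxx.
  - by move=> _ <-; congr x; apply: val_inj; case: k => -[].
  - by move=> _ ->; congr x; apply: val_inj; case: l => -[].
by rewrite alt dot0r.
Qed.

Lemma ev_dcovector v s : ev (dcovector v) s = g v (br s`_0 s`_1).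
Proof. by []. Qed.

(** The derivation property in a frame: [d alpha] is the sum of [d e^m /\ (e_m -| alpha)]. The minus
    sign is the one left out of [dcovector]. *)
Lemma ce_diff3E (alpha : kform V 3) e s : is_form alpha -> onb g {:V} e ->
  size s = 4%N -> ev (ce_diff br alpha) s =
  \sum_(m < size e) - shuffle_sum 2 2 (ev (dcovector e`_m)) (fun t => ev alpha (e`_m :: t)) s.
Proof.
move=> fa ob; case: s => [|x0 [|x1 [|x2 [|x3 []]]]] // _.
rewrite ev_ce_diff /= !big_cons !big_nil /= /bump /=.
rewrite !(ev_head_expand _ (form_multilinear fa) ob (memvf (br _ _))).
rewrite !mulr_sumr ?addr0 ?add0r -!big_split /=; apply: eq_bigr => m _.
by rewrite !ev_dcovector /=; ring.
Qed.

Lemma ce_diff4E (alpha : kform V 4) e s : is_form alpha -> onb g {:V} e ->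
  size s = 5%N -> ev (ce_diff br alpha) s =
  \sum_(m < size e) - shuffle_sum 2 3 (ev (dcovector e`_m)) (fun t => ev alpha (e`_m :: t)) s.
Proof.
move=> fa ob; case: s => [|x0 [|x1 [|x2 [|x3 [|x4 []]]]]] // _.
rewrite ev_ce_diff /= !big_cons !big_nil /= /bump /=.
rewrite !(ev_head_expand _ (form_multilinear fa) ob (memvf (br _ _))).
rewrite !mulr_sumr ?addr0 ?add0r -!big_split /=; apply: eq_bigr => m _.
by rewrite !ev_dcovector /=; ring.
Qed.

Hypothesis br_alt : forall v, br v v = 0.

Lemma ce_diff_form p (alpha : kform V p.+1) e : is_form alpha ->
  (forall s, size s = p.+2 -> ev (ce_diff br alpha) s =
    \sum_(m < size e) - shuffle_sum 2 p (ev (dcovector e`_m)) (fun t => ev alpha (e`_m :: t)) s) ->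
  is_form (ce_diff br alpha).
Proof.
move=> fa dE; have -> : ce_diff br alpha = fun x => \sum_(m <- index_enum 'I_(size e))
    -1 * wedge (dcovector e`_m) (interior e`_m alpha) x.
  apply: funext => x; rewrite [LHS]evE dE ?size_map -?enumT ?size_enum_ord //.
  apply: eq_bigr => m _; rewrite mulN1r (evE (wedge _ _)) ev_wedge ?size_map -?enumT ?size_enum_ord //.
  - congr (- shuffle_sum _ _ _ _ _); apply: funext => t; exact/esym/ev_interior.
  - exact/form_perm_alternating/dcovector_form.
  - exact/form_perm_alternating/interior_form.
apply: (form_sum _ (alpha := fun (m : 'I_(size e)) x =>
  -1 * wedge (dcovector e`_m) (interior e`_m alpha) x)) => m.
by apply/form_scale/wedge_form; [apply: dcovector_form|apply: interior_form].
Qed.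

Lemma ce_diff3_form (alpha : kform V 3) e : is_form alpha -> onb g {:V} e ->
  is_form (ce_diff br alpha).
Proof. by move=> fa ob; apply: (ce_diff_form (e := e)) => // s; apply: ce_diff3E. Qed.

Lemma ce_diff4_form (alpha : kform V 4) e : is_form alpha -> onb g {:V} e ->
  is_form (ce_diff br alpha).
Proof. by move=> fa ob; apply: (ce_diff_form (e := e)) => // s; apply: ce_diff4E. Qed.

(* The coefficients of [d psi] and of [d phi /\ phi] on a frame in which [phi] and
   [psi] are the model forms, as functions of [A m i j = g e_m [e_i, e_j]]. *)
Definition d_psi (A : nat -> nat -> nat -> R) (s : seq nat) : R :=
  \sum_(m <- iota 0 7) - shuffle_sum 2 3 (fun t => A m (nth 0%N t 0) (nth 0%N t 1))
    (fun t => (psi0 (m :: t))%:~R) s.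

Definition d_phi_phi (A : nat -> nat -> nat -> R) : R :=
  shuffle_sum 4 3
    (fun t => \sum_(m <- iota 0 7) - shuffle_sum 2 2
       (fun t' => A m (nth 0%N t' 0) (nth 0%N t' 1)) (fun t' => (phi0 (m :: t'))%:~R) t)
    (fun t => (phi0 t)%:~R) (iota 0 7).

Lemma ev_dcovector_map e m t : size t = 2%N ->
  ev (dcovector e`_m) [seq e`_i | i <- t] = dcoef e m (nth 0%N t 0) (nth 0%N t 1).
Proof. by case: t => [|i [|j []]]. Qed.

Lemma vcat_form k m (vol : kform V (k + m)) (y : 'I_k -> V) :
  is_form vol -> is_form (fun x : 'I_m -> V => vol (vcat y x)).
Proof.
move=> [lin alt]; split=> [x i a u v|x i j ij xij].
  have E z : vol (vcat y [eta x with i |-> z]) = vol [eta (vcat y x) with rshift k i |-> z].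
    apply: form_congr => l; rewrite /vcat /=; case: splitP => n ln.
      have -> : l = lshift m n by apply: val_inj.
      by rewrite eq_lrshift.
    have -> : l = rshift k n by apply: val_inj.
    by rewrite eq_rshift.
  by rewrite !E lin.
apply: (alt _ (rshift k i) (rshift k j)); first by rewrite eq_rshift.
have vE l : vcat y x (rshift k l) = x l.
  by rewrite /vcat -[rshift k l]/(unsplit (inr l)) unsplitK.
by rewrite !vE.
Qed.

Lemma hodge_form (U : {vspace V}) k m (vol : kform V (k + m)) (alpha : kform V k) :
  is_form vol -> is_form (hodge g U vol alpha).
Proof.
move=> fv; apply: (@form_scale _ _ m (fun x => \sum_(f : {ffun 'I_k -> 'I_(\dim U)}) _)).
apply: (form_sum _ (alpha := fun (f : {ffun 'I_k -> 'I_(\dim U)}) (x : 'I_m -> V) =>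
  alpha (fun i => tnth (onbasis g U) (f i)) *
  vol (vcat (fun i => tnth (onbasis g U) (f i)) x))) => f.
exact/(@form_scale _ _ m)/vcat_form.
Qed.

Section StandardFrame.
Variables (phi : kform V 3) (vol : kform V 7) (e : seq V).
Hypotheses (phi_form : is_form phi) (vol_form : is_form vol).
Hypotheses (ob : onb g {:V} e) (se : size e = 7%N) (vol1 : ev vol e = 1).
Hypothesis tab : forall i j k, (i < j)%N -> (j < k)%N -> (k < 7)%N ->
  fcoef phi e [:: i; j; k] = (std_phi [:: i; j; k])%:~R.

Lemma fcoef_d_psi s : size s = 5%N -> all (ltn^~ 7) s ->
  fcoef (ce_diff br (@hodge R V g {:V} 3 4 vol phi)) e s = d_psi (dcoef e) s.
Proof.
move=> s5 s7; rewrite /fcoef (ce_diff4E (@hodge_form {:V} 3 4 vol phi vol_form) ob) ?size_map //.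
rewrite /d_psi -[iota 0 7]/(index_iota 0 7) big_mkord se; apply: eq_bigr => m _.
congr (- _); rewrite shuffle_sum_map; apply: eq_shuffle_sum => // t st ts.
  exact: ev_dcovector_map.
rewrite -(hodge_fcoef (g := g) phi_form vol_form ob se vol1 tab) //= ?st ?ltn_ord //.
by apply/allP => i /(mem_subseq ts) /(allP s7).
Qed.

Lemma fcoef_d_phi_phi :
  ev (wedge (ce_diff br phi) phi) e = d_phi_phi (dcoef e).
Proof.
rewrite ev_wedge //; first last.
- exact: form_perm_alternating.
- exact/form_perm_alternating/(ce_diff3_form phi_form ob).
rewrite -[X in shuffle_sum _ _ _ _ X](map_nth_iota0_id se) shuffle_sum_map.
apply: eq_shuffle_sum => // t st ts; last first.
  by apply: table_fcoef => //; apply/allP => i /(mem_subseq ts); rewrite mem_iota.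
rewrite (ce_diff3E phi_form ob) ?size_map //.
rewrite -[in RHS](_ : index_iota 0 7 = iota 0 7) // big_mkord se; apply: eq_bigr => m _.
congr (- _); rewrite shuffle_sum_map; apply: eq_shuffle_sum => // t' st' ts'.
  exact: ev_dcovector_map.
rewrite -(table_fcoef phi_form tab) //= ?st' ?ltn_ord //.
by apply/allP => i /(mem_subseq ts')/(mem_subseq ts); rewrite mem_iota.
Qed.

End StandardFrame.

End Differential.

(** * Purely coclosed G2-structures as orthonormal frames satisfying linear equations *)

Section PurelyCoclosedFrames.
Variables (R : realType) (V : vectType R) (g : {dot V for idfun}).
Variable br : {bilinear V -> V -> V}.
Hypothesis br_alt : forall v, br v v = 0.
Implicit Types (u v w : V) (e f : seq V).

Lemma ev_scale k (alpha : kform V k) a s : multilinear alpha -> size s = k ->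
  ev alpha [seq a *: v | v <- s] = a ^+ k * ev alpha s.
Proof.
elim: s k alpha => [|v s IH] [|k] alpha lin //=; first by rewrite mul1r.
move=> [sk].
have Z u t : ev alpha (a *: u :: t) = a * ev alpha (u :: t).
  have z0 : ev alpha (0 :: t) = 0.
    have := ev_head_linear t (-1) 0 0 lin; rewrite scaler0 addr0; lra.
  by have := ev_head_linear t a u 0 lin; rewrite addr0 z0 addr0.
by rewrite Z -ev_interior IH //; [rewrite ev_interior mulrA -exprS|apply: interior_multilinear].
Qed.

(** [purely_coclosed] brings its own metric and volume form, which have to be identified with [g]
    and [vol]. Comparing the cubic identities on [e] gives [g = c h] with [c] the value of the
    second volume form on [e]; positivity and its normalisation force [c = 1]. *)
Lemma G2_metric_unique (phi : kform V 3) (vol : kform V 7) (h : {dot V for idfun})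
    (vol' : kform V 7) e :
  G2_metric phi g vol -> G2_metric phi h vol' -> onb g {:V} e -> ev vol e = 1 ->
  (forall u v, h u v = g u v) /\ ev vol' e = 1.
Proof.
move=> [_ gm] [hv hm] ob v1; set c := ev vol' e.
have [se _ on] := ob; have d7 : 7%N = \dim {:V} by case: hv.
have gE u v : g u v = c * h u v.
  have := gm u v (fun i => e`_i); rewrite -hm -[vol _]/(ev vol e) v1 mulr1.
  by rewrite mulrC => <-.
have e1 : g e`_0 e`_0 = 1 by rewrite on ?se -?d7.
have c_gt0 : 0 < c.
  have h0 : 0 < h e`_0 e`_0.
    by apply: dot_gt0; apply: contra_eq_neq e1 => ->; rewrite dot0r eq_sym oner_eq0.
  by rewrite -(pmulr_lgt0 _ h0) -gE e1.
pose s := Num.sqrt c; have s2 : s ^+ 2 = c by rewrite sqr_sqrtr // ltW.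
have obh : onb h {:V} [seq s *: x | x <- e].
  split=> [|x _|i j]; rewrite ?size_map ?memvf // => ie je.
  by rewrite !(nth_map 0) // dotZl dotZr mulrA -expr2 s2 -gE on.
have := volume_form_onb hv obh; rewrite ev_scale ?se //; last first.
  by case: hv => _ [/form_multilinear].
rewrite -/c -s2 exprMn -!exprM -exprD /= => /eqP; rewrite pexpr_eq1 ?sqrtr_ge0 // => /eqP s1.
have c1 : c = 1 by rewrite -s2 s1 expr1n.
by split; [move=> u v; rewrite gE c1 mul1r|rewrite s2].
Qed.

Lemma purely_coclosed_frame (phi : kform V 3) (vol : kform V 7) e :
  is_form phi -> purely_coclosed br phi -> G2_metric phi g vol ->
  onb g {:V} e -> ev vol e = 1 ->
  (forall i j k, (i < j)%N -> (j < k)%N -> (k < 7)%N ->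
    fcoef phi e [:: i; j; k] = (std_phi [:: i; j; k])%:~R) ->
  (forall s, size s = 5%N -> all (ltn^~ 7) s -> d_psi (dcoef g br e) s = 0) /\
  d_phi_phi (dcoef g br e) = 0.
Proof.
move=> fp [[h [vol' [hm z5]]] z7] gm ob v1 tab.
have [hE v1'] := G2_metric_unique gm hm ob v1.
have se : size e = 7%N by apply: onb7_size gm _ ob.
have obh : onb h {:V} e.
  by case: ob => ? ? on; split=> // i j ie je; rewrite hE on.
have dE : dcoef h br e = dcoef g br e.
  by apply: funext => m; apply: funext => i; apply: funext => j; apply: hE.
have fv' : is_form vol' by case: hm => -[_ []].
split=> [s s5 s7|]; last first.
  rewrite -(fcoef_d_phi_phi br_alt fp ob se tab); exact: z7.
rewrite -dE -(fcoef_d_psi br fp fv' obh se v1' tab) //; exact: z5.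
Qed.

Definition std_form e : kform V 3 :=
  fun x => \sum_(t <- [seq t <- tuples 7 3 | sorted ltn t])
    (std_phi t)%:~R * @det_form R V g 3 [seq e`_i | i <- t] x.

Lemma std_form_form e : is_form (std_form e).
Proof.
apply: (form_sum _ (alpha := fun t x =>
  (std_phi t)%:~R * @det_form R V g 3 [seq e`_i | i <- t] x)) => t.
exact/form_scale/det_form_is_form.
Qed.

Lemma std_form_table e i j k : onb g {:V} e -> size e = 7%N ->
  (i < j)%N -> (j < k)%N -> (k < 7)%N ->
  fcoef (std_form e) e [:: i; j; k] = (std_phi [:: i; j; k])%:~R.
Proof.
move=> [_ _ on] se ij jk k7; have st : sorted ltn [:: i; j; k] by rewrite /= ij jk.
have t7 : all (ltn^~ 7) [:: i; j; k].
  by rewrite /= k7 (ltn_trans jk) // (ltn_trans ij) // (ltn_trans jk).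
have tin : [:: i; j; k] \in [seq t <- tuples 7 3 | sorted ltn t].
  by rewrite mem_filter st mem_tuples.
have u : uniq [seq t <- tuples 7 3 | sorted ltn t] by vm_compute.
have tT l : l \in [seq t <- tuples 7 3 | sorted ltn t] -> [/\ sorted ltn l, size l = 3%N & all (ltn^~ 7) l].
  have : all (fun t => (size t == 3%N) && all (ltn^~ 7) t) (tuples 7 3) by vm_compute.
  by move=> /allP H; rewrite mem_filter => /andP[sl /H /andP[/eqP]].
have D l : l \in [seq t <- tuples 7 3 | sorted ltn t] ->
    @det_form R V g 3 [seq e`_i | i <- l] (fun n => [seq e`_i | i <- [:: i; j; k]]`_n) =
    (l == [:: i; j; k])%:R.
  move=> /tT[sl l3 l7].
  by have := @fcoef_det_form _ _ g 3 e l [:: i; j; k] on sl; rewrite se; apply.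
rewrite /fcoef /ev /std_form (bigD1_seq _ tin u) big_seq_cond big1 ?addr0 => [|t].
  by rewrite D // eqxx mulr1 /= addr0.
by move=> /andP[/D -> /negbTE ->]; rewrite mulr0.
Qed.

Lemma ev3_head_expand (phi : kform V 3) e u s : is_form phi -> onb g {:V} e ->
  size e = 7%N -> ev phi (u :: [seq e`_i | i <- s]) =
  \sum_(i <- iota 0 7) g e`_i u * fcoef phi e (i :: s).
Proof.
move=> fp ob se; rewrite (ev_head_expand _ (form_multilinear fp) ob (memvf u)) se.
by rewrite -[iota 0 7]/(index_iota 0 7) big_mkord.
Qed.

Lemma std_form_cubic e u v : onb g {:V} e -> size e = 7%N ->
  ev (wedge (wedge (interior u (std_form e)) (interior v (std_form e))) (std_form e)) e =
  6 * g u v.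
Proof.
move=> ob se; have fp := std_form_form e; have tab := std_form_table ob se.
have T t : size t = 3%N -> all (ltn^~ 7) t -> fcoef (std_form e) e t = (phi0 t)%:~R.
  by apply: table_fcoef.
pose h z (t : seq nat) : R := \sum_(i <- iota 0 7) g e`_i z * (phi0 (i :: t))%:~R.
have -> : ev (wedge (wedge (interior u (std_form e)) (interior v (std_form e)))
   (std_form e)) e =
  shuffle_sum 4 3 (shuffle_sum 2 2 (h u) (h v)) (fun t => (phi0 t)%:~R) (iota 0 7).
  rewrite ev_wedge //; [|exact: wedge_perm_alternating|exact: form_perm_alternating].
  rewrite -[X in shuffle_sum _ _ _ _ X](map_nth_iota0_id se) shuffle_sum_map.
  apply: eq_shuffle_sum => // t st ts; last first.
    by apply: T => //; apply/allP => i /(mem_subseq ts); rewrite mem_iota.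
  rewrite ev_wedge ?size_map //;
    try exact/interior_perm_alternating/form_perm_alternating.
  rewrite shuffle_sum_map; apply: eq_shuffle_sum => // t' st' ts';
    rewrite ev_interior ev3_head_expand //; apply: eq_big_seq => i; rewrite mem_iota /= => i7;
    rewrite T //= ?st' ?i7 //; apply/allP => l /(mem_subseq ts')/(mem_subseq ts); rewrite mem_iota //.
pose x i := g e`_i u; pose y i := g e`_i v.
rewrite (dot_onb v ob (memvf u)) se -(big_mkord predT (fun i => x i * y i)).
(* Every pair of indices lies in exactly one of the seven triples of [std_phi], so each coefficient
   of a contraction is a single coordinate up to sign. This closed form keeps the final polynomial
   small. *)
pose hh (x : nat -> R) (t : seq nat) : R := match t with
  | [:: 0; 1]%N => x 2%N | [:: 0; 2]%N => - x 1%N | [:: 1; 2]%N => x 0%N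
  | [:: 0; 3]%N => x 4%N | [:: 0; 4]%N => - x 3%N | [:: 3; 4]%N => x 0%N
  | [:: 0; 5]%N => x 6%N | [:: 0; 6]%N => - x 5%N | [:: 5; 6]%N => x 0%N
  | [:: 1; 3]%N => x 5%N | [:: 1; 5]%N => - x 3%N | [:: 3; 5]%N => x 1%N
  | [:: 1; 4]%N => - x 6%N | [:: 1; 6]%N => x 4%N | [:: 4; 6]%N => - x 1%N
  | [:: 2; 3]%N => - x 6%N | [:: 2; 6]%N => x 3%N | [:: 3; 6]%N => - x 2%N
  | [:: 2; 4]%N => - x 5%N | [:: 2; 5]%N => x 4%N | [:: 4; 5]%N => - x 2%N
  | _ => 0 end.
have hE z t : size t = 2%N -> subseq t (iota 0 7) -> h z t = hh (fun i => g e`_i z) t.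
  case: t => [|a [|b []]] // _ st.
  have [ab b7] : (a < b)%N /\ (b < 7)%N.
    have : sorted ltn [:: a; b] := subseq_sorted ltn_trans st (iota_ltn_sorted 0 7).
    have : b \in iota 0 7 by apply: (mem_subseq st); rewrite !inE eqxx orbT.
    by rewrite mem_iota /= andbT.
  rewrite /h !big_cons big_nil.
  by move: a b ab b7 {st} => [|[|[|[|[|[|[|a]]]]]]] // [|[|[|[|[|[|[|b]]]]]]] // _ _;
    rewrite /phi0 /=; ring.
have -> : shuffle_sum 4 3 (shuffle_sum 2 2 (h u) (h v)) (fun t => (phi0 t)%:~R) (iota 0 7) =
    shuffle_sum 4 3 (shuffle_sum 2 2 (hh x) (hh y))
      (fun t => (phi0 t)%:~R) (iota 0 7).
  apply: eq_shuffle_sum => // t st ts; apply: eq_shuffle_sum => // t' st' ts';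
    by apply: hE => //; apply: subseq_trans ts' ts.
rewrite -[iota 0 7]/[:: 0; 1; 2; 3; 4; 5; 6]%N -[index_iota 0 7]/[:: 0; 1; 2; 3; 4; 5; 6]%N.
rewrite !big_cons big_nil.
move: x y => x y; cbn [shuffle_sum hh]; rewrite /phi0 /=; ring.
Qed.

Lemma frame_purely_coclosed e : onb g {:V} e -> size e = 7%N ->
  (forall s, sorted ltn s -> size s = 5%N -> all (ltn^~ 7) s -> d_psi (dcoef g br e) s = 0) ->
  d_phi_phi (dcoef g br e) = 0 -> has_purely_coclosed_G2 br g.
Proof.
move=> ob se dpsi dphi; have [eV _ on] := ob.
have fp := std_form_form e; have tab i j k := @std_form_table e i j k ob se.
pose vol : kform V 7 := fun x => 1 * @det_form R V g 7 e x.
have vol_vol : volume_form g {:V} vol.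
  by apply: det_volume_form => //; rewrite ?expr1n // -eV se.
have fv : is_form vol by case: vol_vol => _ [].
have v1 : ev vol e = 1 by rewrite /vol /ev mul1r [det_form _ _ _]ev_det_form_onb.
have met : G2_metric (std_form e) g vol.
  split=> // v w; apply: (form_eq_top (k := 7) (e := e) _ _ _ ob).
  - by rewrite -eV se.
  - exact: (@form_scale _ _ 7).
  - exact/(@form_scale _ _ 7)/(wedge_form (wedge_form (interior_form v fp)
      (interior_form w fp)) fp).
  - rewrite /ev -/(ev vol e) v1 mulr1.
    rewrite -[X in _ * X]/(ev (wedge (wedge (interior v (std_form e))
      (interior w (std_form e))) (std_form e)) e) std_form_cubic // mulKf // pnatr_eq0 //.
exists (std_form e); split; last by exists vol.
  split=> // v v0 /(_ (fun i => e`_i)).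
  move: (std_form_cubic v v ob se); rewrite /ev => -> /eqP.
  by rewrite mulf_eq0 pnatr_eq0 dot_eq0 (negbTE v0).
split.
  exists g, vol; split=> //; apply: (form_eq0 _ ob) => [|t st]; rewrite ?se.
    apply: (ce_diff4_form br_alt _ ob); exact: (@hodge_form _ _ _ {:V} 3 4).
  by move=> t7 t5; rewrite (fcoef_d_psi br fp fv ob se v1 tab) // dpsi.
apply: (form_eq0 _ ob) => [|t st]; rewrite ?se.
  by apply: wedge_form => //; apply: ce_diff3_form fp ob.
move=> t7 tk; rewrite (sorted_iota st t7 tk) /fcoef map_nth_iota0_id //.
by rewrite (fcoef_d_phi_phi br_alt fp ob se tab).
Qed.

End PurelyCoclosedFrames.

Lemma sorted5_in s : sorted ltn s -> size s = 5%N -> all (ltn^~ 7) s ->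
  s \in [:: [:: 0;1;2;3;4]; [:: 0;1;2;3;5]; [:: 0;1;2;3;6]; [:: 0;1;2;4;5];
    [:: 0;1;2;4;6]; [:: 0;1;2;5;6]; [:: 0;1;3;4;5]; [:: 0;1;3;4;6]; [:: 0;1;3;5;6];
    [:: 0;1;4;5;6]; [:: 0;2;3;4;5]; [:: 0;2;3;4;6]; [:: 0;2;3;5;6]; [:: 0;2;4;5;6];
    [:: 0;3;4;5;6]; [:: 1;2;3;4;5]; [:: 1;2;3;4;6]; [:: 1;2;3;5;6]; [:: 1;2;4;5;6];
    [:: 1;3;4;5;6]; [:: 2;3;4;5;6]]%N.
Proof.
move=> st s5 s7; set L := (X in s \in X).
have : all [pred t | sorted ltn t ==> (t \in L)] (tuples 7 5) by vm_compute.
by move=> /allP/(_ s (mem_tuples s5 s7))/implyP; apply.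
Qed.

(** * The equations on the structure constants, by dimension of the vertical space *)

Section Equations.
Variable R : realType.

Lemma eq_d_psi (A A' : nat -> nat -> nat -> R) s : size s = 5%N -> all (ltn^~ 7) s ->
  (forall m i j, (m < 7)%N -> (i < 7)%N -> (j < 7)%N -> A m i j = A' m i j) ->
  d_psi A s = d_psi A' s.
Proof.
move=> s5 s7 AA; rewrite /d_psi; apply: eq_big_seq => m; rewrite mem_iota /= => m7.
congr (- _); apply: eq_shuffle_sum => // -[|i [|j []]] // _ ts /=.
by apply: AA => //; apply: (allP s7); apply: (mem_subseq ts); rewrite !inE eqxx ?orbT.
Qed.

Lemma eq_d_phi_phi (A A' : nat -> nat -> nat -> R) :
  (forall m i j, (m < 7)%N -> (i < 7)%N -> (j < 7)%N -> A m i j = A' m i j) ->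
  d_phi_phi A = d_phi_phi A'.
Proof.
move=> AA; rewrite /d_phi_phi; apply: eq_shuffle_sum => // t t4 ts.
apply: eq_big_seq => m; rewrite mem_iota /= => m7.
congr (- _); apply: eq_shuffle_sum => // -[|i [|j []]] // _ ts' /=.
have in7 l : l \in [:: i; j] -> (l < 7)%N.
  by move=> /(mem_subseq ts')/(mem_subseq ts); rewrite mem_iota.
by apply: AA => //; apply: in7; rewrite !inE eqxx ?orbT.
Qed.

Lemma big_foldr (I : Type) (r : seq I) (F : I -> R) :
  \sum_(i <- r) F i = foldr (fun i x => F i + x) 0 r.
Proof. by elim: r => [|i r IH]; rewrite ?big_nil // big_cons IH. Qed.

Lemma d_phi_phiE (A : nat -> nat -> nat -> R) : d_phi_phi A =
  shuffle_sum 4 3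
    (fun t => foldr (fun m x => - shuffle_sum 2 2
       (fun t' => A m (nth 0%N t' 0) (nth 0%N t' 1)) (fun t' => (phi0 (m :: t'))%:~R) t + x)
       0 (iota 0 7))
    (fun t => (phi0 t)%:~R) (iota 0 7).
Proof. by apply: eq_shuffle_sum => // t _ _; rewrite big_foldr. Qed.

Variable q : nat -> nat -> nat -> R.

(* In [coef_vertk] the brackets lie in the span of the first [k] frame vectors,
   which are central. *)
Definition coef_vert1 (m i j : nat) : R :=
  if m is 0%N then if i is 0%N then 0 else if j is 0%N then 0 else q m i j else 0.

Definition coef_vert3 (m i j : nat) : R :=
  if before m 3 then if before 2 i then if before 2 j then q m i j else 0 else 0 else 0.

Ltac expand := rewrite /d_psi big_foldr; cbn [shuffle_sum iota foldr nth coef_vert1 coef_vert3 before];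
  rewrite /psi0 /=.

(** Their vanishing says that the 2-form [q 0] has type (1,1) for the complex structure pairing 1
    with 2, 3 with 4 and 5 with 6; [d_phi_phi_coef1] adds that its trace vanishes. Together they
    describe su(3). *)
Lemma d_psi_coef1 :
  [/\ d_psi coef_vert1 [:: 1; 2; 3; 4; 5]%N = q 0 1 4 + q 0 2 3,
      d_psi coef_vert1 [:: 1; 2; 3; 4; 6]%N = q 0 1 3 - q 0 2 4,
      d_psi coef_vert1 [:: 1; 2; 3; 5; 6]%N = - (q 0 1 6 + q 0 2 5) &
      d_psi coef_vert1 [:: 1; 2; 4; 5; 6]%N = - (q 0 1 5 - q 0 2 6)] /\
  d_psi coef_vert1 [:: 1; 3; 4; 5; 6]%N = q 0 3 6 + q 0 4 5 /\
  d_psi coef_vert1 [:: 2; 3; 4; 5; 6]%N = q 0 3 5 - q 0 4 6.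
Proof. by split; [split|split]; expand; ring. Qed.

Lemma d_phi_phi_coef1 : d_phi_phi coef_vert1 = -2 * (q 0 1 2 + q 0 3 4 + q 0 5 6).
Proof.
rewrite d_phi_phiE; cbn [shuffle_sum iota foldr nth coef_vert1].
by rewrite /phi0 /=; ring.
Qed.

(** [uphalf] sends the indices 1, 2 and 3, 4 and 5, 6 to the numbers of their planes: a
    block-diagonal form has type (1,1). *)
Lemma d_psi_coef1_diag s : sorted ltn s -> size s = 5%N -> all (ltn^~ 7) s ->
  (forall i j, (i < 7)%N -> (j < 7)%N -> uphalf i != uphalf j -> q 0 i j = 0) ->
  d_psi coef_vert1 s = 0.
Proof.
move=> st s5 s7 z.
have zs : [/\ q 0 1 3 = 0, q 0 1 4 = 0, q 0 1 5 = 0 & q 0 1 6 = 0] /\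
   [/\ q 0 2 3 = 0, q 0 2 4 = 0, q 0 2 5 = 0 & q 0 2 6 = 0] /\
   [/\ q 0 3 5 = 0, q 0 3 6 = 0, q 0 4 5 = 0 & q 0 4 6 = 0].
  by split; [split|split; [split|split]]; apply: z.
case: zs => -[z13 z14 z15 z16] [[z23 z24 z25 z26] [z35 z36 z45 z46]].
have := sorted5_in st s5 s7; rewrite !inE; do ![case/orP]; move=> /eqP ->;
  expand; rewrite ?z13 ?z14 ?z15 ?z16 ?z23 ?z24 ?z25 ?z26 ?z35 ?z36 ?z45 ?z46; ring.
Qed.

(* Up to a factor [sqrt 2], the coordinates of the self-dual part of a 2-form in
   the orthonormal basis of self-dual forms which appears in the model 3-form. *)
Definition sd_coord (a : nat -> nat -> R) (k : nat) : R :=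
  match k with
  | 0%N => a 3%N 4%N + a 5%N 6%N
  | 1%N => a 3%N 5%N - a 4%N 6%N
  | _ => - (a 3%N 6%N + a 4%N 5%N)
  end.

(** The entries of the skew part of the matrix of self-dual coordinates; [d_phi_phi_coef3] is its
    trace. *)
Lemma d_psi_coef3 :
  [/\ d_psi coef_vert3 [:: 0; 3; 4; 5; 6]%N = sd_coord (q 1) 2 - sd_coord (q 2) 1,
      d_psi coef_vert3 [:: 1; 3; 4; 5; 6]%N = sd_coord (q 2) 0 - sd_coord (q 0) 2 &
      d_psi coef_vert3 [:: 2; 3; 4; 5; 6]%N = sd_coord (q 0) 1 - sd_coord (q 1) 0].
Proof. by split; expand; ring. Qed.

Lemma d_psi_coef3_eq0 s : sorted ltn s -> size s = 5%N -> all (ltn^~ 7) s ->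
  (forall i j, (i < 3)%N -> (j < 3)%N -> sd_coord (q i) j = sd_coord (q j) i) ->
  d_psi coef_vert3 s = 0.
Proof.
move=> st s5 s7 sym; have [E0 E1 E2] := d_psi_coef3.
have := sorted5_in st s5 s7; rewrite !inE; do ![case/orP]; move=> /eqP ->;
  rewrite ?E0 ?E1 ?E2 ?(sym 2 1)%N ?(sym 2 0)%N ?(sym 1 0)%N ?subrr //; expand; ring.
Qed.

Lemma d_phi_phi_coef3 :
  d_phi_phi coef_vert3 = -2 * (sd_coord (q 0) 0 + sd_coord (q 1) 1 + sd_coord (q 2) 2).
Proof.
rewrite d_phi_phiE; cbn [shuffle_sum iota foldr nth coef_vert3 before].
by rewrite /phi0 /=; ring.
Qed.

Definition coef_vert2 (m i j : nat) : R :=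
  if before m 2 then if before 1 i then if before 1 j then q m i j else 0 else 0 else 0.

Ltac expand2 := rewrite /d_psi big_foldr; cbn [shuffle_sum iota foldr nth coef_vert2 before];
  rewrite /psi0 /=.

(** The first eight components force the contractions of both 2-forms with the third frame vector to
    vanish, which singles out the 4-plane of the last four vectors; the last three concern self-dual
    parts. *)
Lemma d_psi_coef2 :
  [/\ d_psi coef_vert2 [:: 0; 2; 3; 4; 5]%N = - q 1 2 3, d_psi coef_vert2 [:: 0; 2; 3; 4; 6]%N = q 1 2 4,
      d_psi coef_vert2 [:: 0; 2; 3; 5; 6]%N = q 1 2 5 & d_psi coef_vert2 [:: 0; 2; 4; 5; 6]%N = - q 1 2 6] /\
  [/\ d_psi coef_vert2 [:: 1; 2; 3; 4; 5]%N = q 0 2 3, d_psi coef_vert2 [:: 1; 2; 3; 4; 6]%N = - q 0 2 4,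
      d_psi coef_vert2 [:: 1; 2; 3; 5; 6]%N = - q 0 2 5 & d_psi coef_vert2 [:: 1; 2; 4; 5; 6]%N = q 0 2 6] /\
  [/\ d_psi coef_vert2 [:: 0; 3; 4; 5; 6]%N = sd_coord (q 1) 2,
      d_psi coef_vert2 [:: 1; 3; 4; 5; 6]%N = - sd_coord (q 0) 2 &
      d_psi coef_vert2 [:: 2; 3; 4; 5; 6]%N = sd_coord (q 0) 1 - sd_coord (q 1) 0].
Proof. by split; [split|split; split]; expand2; ring. Qed.

Lemma d_phi_phi_coef2 : d_phi_phi coef_vert2 = -2 * (sd_coord (q 0) 0 + sd_coord (q 1) 1).
Proof.
rewrite d_phi_phiE; cbn [shuffle_sum iota foldr nth coef_vert2 before].
by rewrite /phi0 /=; ring.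
Qed.

(* The case of a derived algebra spanned by [e_0], [e_1] and [c e_2 - s e_3], where
   [q i] (for [i < 3]) are the coefficients of the corresponding 2-forms on the
   orthonormal frame [s e_2 + c e_3, e_4, e_5, e_6] of the complement, whose first
   vector has index 3. *)
Definition coef_tilt (c s : R) (m i j : nat) : R :=
  let b k := match i, j with
    | 0, _ | 1, _ | _, 0 | _, 1 => 0%R
    | 2, 2 | 2, 3 | 3, 2 | 3, 3 => 0%R
    | 2, _ => (s * q k 3%N j)%R
    | 3, _ => (c * q k 3%N j)%R
    | _, 2 => (- (s * q k 3%N i))%R
    | _, 3 => (- (c * q k 3%N i))%R
    | _, _ => q k i j
    end%N in
  match m with
  | 0 => b 0%N | 1 => b 1%N | 2 => (c * b 2%N)%R | 3 => (- s * b 2%N)%R | _ => 0%R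
  end%N.

Ltac expand_tilt := rewrite /d_psi big_foldr;
  cbn [shuffle_sum iota foldr nth coef_tilt before]; rewrite /psi0 /=.

(** The twelve components from which [tilted_frame_balanced] solves for the coefficients [q]. *)
Lemma d_psi_tilt c s :
  [/\ d_psi (coef_tilt c s) [:: 0; 1; 2; 4; 6]%N = - (q 2 3 4 * s ^+ 2),
      d_psi (coef_tilt c s) [:: 0; 1; 2; 5; 6]%N = - (q 2 3 5 * s ^+ 2),
      d_psi (coef_tilt c s) [:: 0; 1; 4; 5; 6]%N = - (q 2 4 5 * s) &
      d_psi (coef_tilt c s) [:: 0; 2; 3; 4; 6]%N = q 1 3 4 * s] /\
  [/\ d_psi (coef_tilt c s) [:: 0; 2; 3; 5; 6]%N = q 1 3 5 * s,
      d_psi (coef_tilt c s) [:: 0; 2; 4; 5; 6]%N = - (q 1 3 6 * s + q 2 3 5 * c * s - q 2 4 6 * s),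
      d_psi (coef_tilt c s) [:: 0; 3; 4; 5; 6]%N =
        - (q 1 3 6 * c + q 1 4 5 + q 2 3 5 * c ^+ 2 - q 2 4 6 * c) &
      d_psi (coef_tilt c s) [:: 1; 2; 3; 4; 6]%N = - (q 0 3 4 * s)] /\
  [/\ d_psi (coef_tilt c s) [:: 1; 2; 3; 5; 6]%N = - (q 0 3 5 * s),
      d_psi (coef_tilt c s) [:: 1; 2; 4; 5; 6]%N = q 0 3 6 * s + q 2 3 4 * c * s + q 2 5 6 * s,
      d_psi (coef_tilt c s) [:: 1; 3; 4; 5; 6]%N =
        q 0 3 6 * c + q 0 4 5 + q 2 3 4 * c ^+ 2 + q 2 5 6 * c &
      d_psi (coef_tilt c s) [:: 2; 3; 4; 5; 6]%N =
        q 0 3 5 * c - q 0 4 6 - q 1 3 4 * c - q 1 5 6].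
Proof. by split; [split|split; split]; expand_tilt; ring. Qed.

Lemma d_phi_phi_tilt c s : d_phi_phi (coef_tilt c s) =
  2 * (q 2 3 6 * (c ^+ 2 + s ^+ 2) + q 2 4 5 * c - q 1 3 5 * c + q 1 4 6 - q 0 3 4 * c - q 0 5 6).
Proof.
rewrite d_phi_phiE; cbn [shuffle_sum iota foldr nth coef_tilt].
by rewrite /phi0 /=; ring.
Qed.

End Equations.

(** * Self-dual parts of 2-forms on an oriented 4-space *)

Section SelfDual.
Variables (R : realType) (V : vectType R) (g : {dot V for idfun}).
Implicit Types (u v w : V) (b : seq V) (U : {vspace V}).

Definition sd_comp (sigma : kform V 2) b (k : nat) : R :=
  let s i j := ev sigma [:: b`_i; b`_j] in
  match k with
  | 0 => s 0%N 1%N + s 2%N 3%N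
  | 1 => s 0%N 2%N - s 1%N 3%N
  | _ => - (s 0%N 3%N + s 1%N 2%N)
  end.

Lemma ev2_swap (sigma : kform V 2) u v : is_form sigma ->
  ev sigma [:: v; u] = - ev sigma [:: u; v].
Proof.
move=> fs; rewrite (@ev_insert _ _ _ sigma [:: v] [::] u) ?expr1 ?mulN1r //.
exact: form_perm_alternating.
Qed.

Lemma ev2_eq0 (sigma : kform V 2) u : is_form sigma -> ev sigma [:: u; u] = 0.
Proof. by move=> fs; have := ev2_swap u u fs; lra. Qed.

Variables (U : {vspace V}) (b : seq V) (vol : kform V 4).
Hypotheses (ob : onb g U b) (volP : volume_form g U vol) (vol1 : ev vol b = 1).

Let dim4 : \dim U = 4%N. Proof. by case: volP. Qed.
Let sb : size b = 4%N. Proof. by case: ob => ->. Qed.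
Let vol_form : is_form vol. Proof. by case: volP => _ []. Qed.

Lemma self_dual_part_form sigma : is_form sigma -> is_form (self_dual_part g U vol sigma).
Proof.
by move=> fs; apply: (@form_scale _ _ 2); apply: (@form_add _ _ 2) => //; apply: (@hodge_form _ _ _ U 2 2).
Qed.

Lemma ev_self_dual_part sigma i j : is_form sigma -> (i < 4)%N -> (j < 4)%N ->
  ev (self_dual_part g U vol sigma) [:: b`_i; b`_j] =
  2^-1 * (ev sigma [:: b`_i; b`_j] + 2^-1 * \sum_(k <- iota 0 4) \sum_(l <- iota 0 4)
    ev sigma [:: b`_k; b`_l] * (list_sign [:: k; l; i; j])%:~R).
Proof.
move=> fs i4 j4; rewrite [LHS]/ev /self_dual_part; congr (_ * (_ + _)).
rewrite -[hodge _ _ _ _ _]/(ev (@hodge _ _ g U 2 2 vol sigma) [:: b`_i; b`_j]).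
rewrite (hodgeE _ (form_multilinear fs) (form_multilinear vol_form) ob) dim4.
congr (_ * _); rewrite -[iota 0 4]/(index_iota 0 4) big_mkord; apply: eq_bigr => k _.
rewrite big_mkord; apply: eq_bigr => l _; congr (_ * _).
by rewrite [LHS](fcoef_top (t := [:: val k; val l; i; j]) vol_form sb) ?vol1 ?mulr1 //= !ltn_ord i4 j4.
Qed.

Lemma self_dual_part_coords sigma : is_form sigma ->
  let sd i j := ev (self_dual_part g U vol sigma) [:: b`_i; b`_j] in
  [/\ sd 0%N 1%N = 2^-1 * sd_comp sigma b 0, sd 0%N 2%N = 2^-1 * sd_comp sigma b 1 &
      sd 0%N 3%N = - (2^-1 * sd_comp sigma b 2)] /\
  [/\ sd 2%N 3%N = 2^-1 * sd_comp sigma b 0, sd 1%N 3%N = - (2^-1 * sd_comp sigma b 1) &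
      sd 1%N 2%N = - (2^-1 * sd_comp sigma b 2)].
Proof.
move=> fs sd; have z := ev2_eq0 _ fs; have sw := fun i j => ev2_swap b`_i b`_j fs.
by split; split; rewrite /sd ev_self_dual_part //= !big_cons !big_nil /= !z
  !(sw 0%N) !(sw 1%N 2%N) !(sw 1%N 3%N) !(sw 2%N 3%N); field.
Qed.

(** Each basic self-dual form is a signed sum of two orthonormal 2-forms, and enters the self-dual
    part with half the coordinate [sd_comp]; hence the factor [2 * (1/2)^2]. *)
Lemma form_dot_self_dual sigma tau : is_form sigma -> is_form tau ->
  form_dot g U (self_dual_part g U vol sigma) (self_dual_part g U vol tau) =
  2^-1 * (sd_comp sigma b 0 * sd_comp tau b 0 + sd_comp sigma b 1 * sd_comp tau b 1 +
    sd_comp sigma b 2 * sd_comp tau b 2).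
Proof.
move=> fs ft; have fs' := self_dual_part_form fs; have ft' := self_dual_part_form ft.
rewrite (form_dotE (form_multilinear fs') (form_multilinear ft') ob) dim4 /=.
rewrite !big_ord_recl !big_ord0 /fcoef /bump /=.
have sws := fun i j => ev2_swap b`_i b`_j fs'.
have swt := fun i j => ev2_swap b`_i b`_j ft'.
rewrite !(ev2_eq0 _ fs') !(ev2_eq0 _ ft') !(sws 0%N) !(sws 1%N 2%N) !(sws 1%N 3%N)
  !(sws 2%N 3%N) !(swt 0%N) !(swt 1%N 2%N) !(swt 1%N 3%N) !(swt 2%N 3%N).
have [[-> -> ->] [-> -> ->]] := self_dual_part_coords fs.
have [[-> -> ->] [-> -> ->]] := self_dual_part_coords ft.
by rewrite -[2`!]/2%N /sd_comp; field.
Qed.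

End SelfDual.

Lemma row_dot_gt0 (R : realType) m (v : 'rV[R]_m) : v != 0 -> 0 < (v *m v^T) 0 0.
Proof.
move=> v0; have [j vj] : exists j, v 0 j != 0.
  apply/existsP; apply: contraNT v0; rewrite negb_exists => /forallP z.
  by apply/eqP/rowP => j; rewrite mxE; apply/eqP; rewrite -[_ == _]negbK z.
rewrite mxE (bigD1 j) //= mxE -expr2 ltr_wpDr ?lt_def ?sqr_ge0 ?sqrf_eq0 ?vj //.
by apply: sumr_ge0 => i _; rewrite mxE -expr2 sqr_ge0.
Qed.

(** * Matrices that become symmetric and traceless after an orthogonal factor *)

Section RotationToTracelessSymmetric.
Variable R : realType.
Implicit Types M S P Q : 'M[R]_3.

Lemma mx3P (A B : 'M[R]_3) :
  A 0 0 = B 0 0 -> A 0 1 = B 0 1 -> A 0 2%:R = B 0 2%:R ->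
  A 1 0 = B 1 0 -> A 1 1 = B 1 1 -> A 1 2%:R = B 1 2%:R ->
  A 2%:R 0 = B 2%:R 0 -> A 2%:R 1 = B 2%:R 1 -> A 2%:R 2%:R = B 2%:R 2%:R -> A = B.
Proof.
have c (i : 'I_3) : [\/ i = 0, i = 1 | i = 2%:R].
  by case: i => [[|[|[|]]]] // ?; [constructor 1|constructor 2|constructor 3]; apply: val_inj.
by move=> *; apply/matrixP => i j; case: (c i) => ->; case: (c j) => ->.
Qed.

Lemma sum3 (F : 'I_3 -> R) : \sum_i F i = F 0 + F 1 + F 2%:R.
Proof.
rewrite !big_ord_recl big_ord0 addr0 addrA; congr (_ + F _ + F _); exact: val_inj.
Qed.

Lemma Cayley_Hamilton3 (A : 'M[R]_3) :
  A *m A *m A - \tr A *: (A *m A) + ((\tr A ^+ 2 - \tr (A *m A)) / 2) *: A = (\det A)%:M.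
Proof.
have -> : \det A = A 0 0 * (A 1 1 * A 2%:R 2%:R - A 1 2%:R * A 2%:R 1)
  - A 0 1 * (A 1 0 * A 2%:R 2%:R - A 1 2%:R * A 2%:R 0)
  + A 0 2%:R * (A 1 0 * A 2%:R 1 - A 1 1 * A 2%:R 0).
  rewrite (expand_det_row _ 0) sum3 /cofactor.
  have d2 (B : 'M[R]_2) : \det B = B 0 0 * B 1 1 - B 0 1 * B 1 0.
    rewrite (expand_det_row _ 0) !big_ord_recl big_ord0 /cofactor !det_mx11 !mxE addr0 /=.
    rewrite expr0 expr1 mul1r mulN1r mulrN; congr (B _ _ * B _ _ - B _ _ * B _ _);
      exact: val_inj.
  have l2 (i : 'I_3) (j k : 'I_3) (l : 'I_2) : bump i l = val k -> j = k -> lift i l = j.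
    by move=> ik ->; apply: val_inj.
  rewrite !d2 !mxE.
  rewrite !(@l2 0 1 1 0) // !(@l2 0 2%:R 2%:R 1) // !(@l2 1 0 0 0) // !(@l2 1 2%:R 2%:R 1) //.
  rewrite !(@l2 2%:R 0 0 0) // !(@l2 2%:R 1 1 1) //=.
  by rewrite expr0 expr1 expr2; ring.
by apply: mx3P; rewrite /mxtrace !(mxE, sum3) /= ?mulr1n ?mulr0n; field.
Qed.

(** With singular values [a, b, c] of [M], the condition says that some [a + b + c], up to signs,
    vanishes. The singular values of a symmetric traceless matrix are the absolute values of
    eigenvalues with sum zero. *)
Definition balanced M :=
  \tr (M *m M^T) ^+ 2 = 2 * \tr (M *m M^T *m (M *m M^T)).

Lemma balanced_rotate M P : P^T *m P = 1%:M -> balanced (P *m M) <-> balanced M.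
Proof.
move=> PP; rewrite /balanced trmx_mul.
have -> : P *m M *m (M^T *m P^T) = P *m (M *m M^T) *m P^T by rewrite !mulmxA.
move: (M *m M^T) => S.
have t1 : \tr (P *m S *m P^T) = \tr S by rewrite mxtrace_mulC mulmxA PP mul1mx.
have t2 : \tr (P *m S *m P^T *m (P *m S *m P^T)) = \tr (S *m S).
  rewrite !mulmxA -(mulmxA (P *m S)) PP mulmx1 mxtrace_mulC.
  by rewrite !mulmxA PP mul1mx.
by rewrite t1 t2.
Qed.

Lemma shifted_square S t :
  (S - (t / 2)%:M) *m (S - (t / 2)%:M) *m S =
  S *m S *m S - t *: (S *m S) + (t ^+ 2 / 4) *: S.
Proof.
rewrite !(mulmxBl, mulmxBr) -!scalar_mxM !(mul_scalar_mx, mul_mx_scalar) -!scalemxAl.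
by move: (S *m S *m S) (S *m S) => A B; apply/matrixP => i j; rewrite !mxE; field.
Qed.

(* When [S = M M^T] satisfies [(tr S)^2 = 2 tr S^2], Cayley-Hamilton reads
   [S (S - tr S / 2)^2 = det S], whence the orthogonal factor below. *)
Lemma rotate_invertible M : balanced M -> \det M != 0 ->
  exists Q, [/\ Q *m Q^T = 1%:M, (Q *m M)^T = Q *m M & \tr (Q *m M) = 0].
Proof.
rewrite /balanced; set S := M *m M^T; set t := \tr S => bal d0; set d := \det M in d0.
have ST : S^T = S by rewrite trmx_mul trmxK.
pose X := S - (t / 2)%:M.
have XT : X^T = X by rewrite linearB /= ST tr_scalar_mx.
have detS : \det S = d ^+ 2 by rewrite det_mulmx det_tr expr2.
have XXS : X *m X *m S = (d ^+ 2)%:M.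
  rewrite -detS -Cayley_Hamilton3 -/t /X shifted_square; congr (_ + _ *: _).
  by rewrite bal; field.
have Mu : M \in unitmx by rewrite unitmxE unitfE.
have MtU : M^T \in unitmx by rewrite unitmx_tr.
(* [X X S = d^2] with [S = M M^T], conjugated by the invertible matrix [M^T]. *)
have MXXM : M^T *m X *m X *m M = (d ^+ 2)%:M.
  apply: (can_inj (mulmxK MtU)); rewrite mul_scalar_mx -mul_mx_scalar -XXS.
  by move: (X) => Y; rewrite /S !mulmxA.
have XE : X = S - (t / 2)%:M by [].
clearbody X.
have QM : (d^-1 *: (M^T *m X)) *m M = d^-1 *: (M^T *m X *m M) by rewrite -scalemxAl.
(* Symmetry of [M^T X M] comes from that of [X], orthogonality is [MXXM], and the trace is
   proportional to [tr (X S) = tr S^2 - t^2 / 2], which is zero by [bal]. *)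
exists (d^-1 *: (M^T *m X)); split.
- rewrite linearZ /= trmx_mul trmxK XT -scalemxAl -scalemxAr scalerA mulmxA MXXM.
  by rewrite scale_scalar_mx -expr2 exprVn mulVf // sqrf_eq0.
- by rewrite QM linearZ /= !trmx_mul trmxK XT mulmxA.
- rewrite QM mxtraceZ mxtrace_mulC mulmxA -/S XE mulmxBr mul_mx_scalar linearB /= mxtraceZ -/t.
  have -> : t / 2 * t = t ^+ 2 / 2 by field.
  by rewrite bal [2 * _]mulrC mulfK ?pnatr_eq0 // subrr mulr0.
Qed.

(** The Householder reflection in the hyperplane orthogonal to [w] exchanges [u] with the last basis
    row; if [w = 0] the identity serves. *)
Lemma rotation_to_row (u : 'rV[R]_3) : u *m u^T = 1%:M ->
  exists P, [/\ P *m P^T = 1%:M, P^T *m P = 1%:M & row 2%:R P = u].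
Proof.
move=> u1; pose w := u - delta_mx 0 2%:R : 'rV[R]_3.
have uE : u = w + delta_mx 0 2%:R by rewrite subrK.
clearbody w; have [w0|w0] := eqVneq w 0.
  exists 1%:M; rewrite trmx1 mulmx1; split=> //.
  by rewrite row1 uE w0 add0r.
pose n : R := (w *m w^T) 0 0.
have wn : w *m w^T = n%:M by rewrite [LHS]mx11_scalar.
have n0 : n != 0 by rewrite gt_eqF // row_dot_gt0.
clearbody n; pose P := 1%:M - (2 / n) *: (w^T *m w).
have PT : P^T = P by rewrite linearB /= trmx1 linearZ /= trmx_mul trmxK.
have PP : P *m P = 1%:M.
  rewrite /P mulmxBl mul1mx mulmxBr mulmx1 -scalemxAl -scalemxAr scalerA.
  rewrite -mulmxA (mulmxA w) wn mul_scalar_mx -scalemxAr scalerA.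
  have -> : 2 / n * (2 / n) * n = 2 / n + 2 / n by field.
  by rewrite scalerDl opprB addrK subrK.
exists P; rewrite PT PP; split=> //.
have e1 : delta_mx 0 2%:R *m (delta_mx 0 2%:R : 'rV[R]_3)^T = 1%:M.
  by rewrite trmx_delta mul_delta_mx; apply/matrixP => i j; rewrite !mxE !ord1.
have nE : n = - 2 * w 0 2%:R.
  have := u1; rewrite uE linearD /= mulmxDl !mulmxDr wn e1 trmx_delta -!rowE -!colE.
  move=> /matrixP/(_ 0 0); rewrite !mxE eqxx !mulr1n; lra.
apply/rowP => j; rewrite uE /P !mxE big_ord_recl big_ord0 !mxE addr0 !ord1 eqxx /=.
rewrite [2%:R == j]eq_sym; move: n0; rewrite nE mulf_eq0 negb_or => /andP[_ w2]; by field.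
Qed.

(** Now the condition is [(x - w)^2 + (2 y)^2 = 0]: the first two rows are orthogonal and of equal
    norm [s]. Complete [p], the first row over [s], and [r], minus the second over [s], to an
    orthogonal matrix [O]. Then [O^T M = s (p^T p - r^T r)], where the minus sign in [r] makes the
    trace vanish. *)
Lemma rotate_singular M : balanced M -> row 2%:R M = 0 ->
  exists Q, [/\ Q *m Q^T = 1%:M, (Q *m M)^T = Q *m M & \tr (Q *m M) = 0].
Proof.
move=> bal M2; have m2 j : M 2%:R j = 0 by have /rowP/(_ j) := M2; rewrite !mxE.
pose x := M 0 0 ^+ 2 + M 0 1 ^+ 2 + M 0 2%:R ^+ 2.
pose w := M 1 0 ^+ 2 + M 1 1 ^+ 2 + M 1 2%:R ^+ 2.
pose y := M 0 0 * M 1 0 + M 0 1 * M 1 1 + M 0 2%:R * M 1 2%:R.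
have bal' : (x - w) ^+ 2 + (2 * y) ^+ 2 = 0.
  move: bal; rewrite /balanced /mxtrace !(mxE, sum3) !m2 /x /w /y => bal.
  by lra.
have [xw y0] : x = w /\ y = 0.
  move: bal' => /eqP; rewrite paddr_eq0 ?sqr_ge0 // !sqrf_eq0 subr_eq0 mulf_eq0 pnatr_eq0.
  by move=> /andP[/eqP-> /eqP->].
have [x0|x0] := eqVneq x 0.
  have M0 : M = 0.
    have := x0; rewrite xw => w0.
    have sq a b c : a ^+ 2 + b ^+ 2 + c ^+ 2 = 0 -> [/\ a = 0, b = 0 & c = 0 :> R].
      move=> /eqP; rewrite !paddr_eq0 ?addr_ge0 ?sqr_ge0 // !sqrf_eq0.
      by move=> /andP[/andP[/eqP-> /eqP->] /eqP->].
    have [a0 a1 a2] := sq _ _ _ x0; have [b0 b1 b2] := sq _ _ _ w0.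
    by apply: mx3P; rewrite ?m2 !mxE.
  by exists 1%:M; rewrite M0 mulmx0 trmx1 mulmx1 trmx0 mxtrace0.
have x_gt0 : 0 < x by rewrite lt_def x0 !addr_ge0 ?sqr_ge0.
pose s := Num.sqrt x; have s2 : s ^+ 2 = x by rewrite sqr_sqrtr // ltW.
have s0 : s != 0 by rewrite -sqrf_eq0 s2.
pose p (i : 'I_3) : R := s^-1 * M 0 i; pose r (i : 'I_3) : R := - s^-1 * M 1 i.
pose O := \matrix_(i < 3, j < 3) match val i, val j with
  | 0%N, _ => p j
  | 1%N, _ => r j
  | _, 0%N => p 1 * r 2%:R - p 2%:R * r 1
  | _, 1%N => p 2%:R * r 0 - p 0 * r 2%:R
  | _, _ => p 0 * r 1 - p 1 * r 0 end.
have pp : p 0 ^+ 2 + p 1 ^+ 2 + p 2%:R ^+ 2 = 1.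
  by transitivity (x / s ^+ 2); [rewrite /p /x; field|rewrite s2 mulfV].
have rr : r 0 ^+ 2 + r 1 ^+ 2 + r 2%:R ^+ 2 = 1.
  by transitivity (w / s ^+ 2); [rewrite /r /w; field|rewrite s2 -xw mulfV].
have pr : p 0 * r 0 + p 1 * r 1 + p 2%:R * r 2%:R = 0.
  by transitivity (- y / s ^+ 2); [rewrite /p /r /y; field|rewrite y0 oppr0 mul0r].
have OO : O *m O^T = 1%:M.
  apply: mx3P; rewrite !(mxE, sum3) /= ?mulr1n ?mulr0n; move: pp rr pr;
    move: (p 0) (p 1) (p 2%:R) (r 0) (r 1) (r 2%:R) => a b c d e f pp rr pr; try by lra.
  transitivity ((a ^+ 2 + b ^+ 2 + c ^+ 2) * (d ^+ 2 + e ^+ 2 + f ^+ 2) -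
    (a * d + b * e + c * f) ^+ 2); first by ring.
  by rewrite pp rr pr expr0n mulr1 subr0.
exists O^T; rewrite trmxK; split; first exact: mulmx1C.
  by apply: mx3P; rewrite !(mxE, sum3) /= !m2 /p /r; ring.
rewrite /mxtrace !(mxE, sum3) /= !m2 /p /r.
transitivity ((x - w) / s); first by rewrite /x /w; ring.
by rewrite xw subrr mul0r.
Qed.

(** When [det M = 0], an orthogonal matrix whose last row is a unit vector of the left kernel of [M]
    brings [M] to the form required by [rotate_singular]. *)
Lemma rotation_exists M : balanced M ->
  exists Q, [/\ Q *m Q^T = 1%:M, (Q *m M)^T = Q *m M & \tr (Q *m M) = 0].
Proof.
move=> bal; have [/eqP/det0P[v v0 vM]|d0] := eqVneq (\det M) 0; last exact: rotate_invertible.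
pose n : R := (v *m v^T) 0 0; have n_gt0 : 0 < n := row_dot_gt0 v0.
pose s := Num.sqrt n; have s2 : s ^+ 2 = n by rewrite sqr_sqrtr // ltW.
have s0 : s != 0 by rewrite -sqrf_eq0 s2 gt_eqF.
have vv : v *m v^T = n%:M by rewrite [LHS]mx11_scalar.
clearbody n.
have [|P [PPT PTP Pu]] := @rotation_to_row (s^-1 *: v).
  rewrite linearZ /= -scalemxAl -scalemxAr scalerA vv scale_scalar_mx -s2; congr (_%:M).
  by field.
have bal' : balanced (P *m M) by apply/balanced_rotate.
have [|Q [QQ QS Q0]] := rotate_singular bal'.
  by rewrite row_mul Pu -scalemxAl vM scaler0.
exists (Q *m P); rewrite -(mulmxA Q P M); split=> //.
by rewrite trmx_mul -mulmxA (mulmxA P) PPT mul1mx.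
Qed.

Lemma symmetric_traceless_balanced M :
  M^T = M -> \tr M = 0 -> balanced M.
Proof.
move=> sym tr0.
have s i j : M j i = M i j by rewrite -[in LHS]sym mxE.
have m22 : M 2%:R 2%:R = - M 0 0 - M 1 1 by move: tr0; rewrite /mxtrace sum3; lra.
rewrite /balanced /mxtrace !(mxE, sum3) (s 0 1) (s 0 2%:R) (s 1 2%:R) m22.
by move: (M 0 0) (M 0 1) (M 0 2%:R) (M 1 1) (M 1 2%:R) => a b c d e; ring.
Qed.

End RotationToTracelessSymmetric.

(** * Frames with three central vectors whose span contains all brackets *)

Section ThreeDimensionalVerticalSpace.
Variables (R : realType) (V : vectType R) (g : {dot V for idfun}).
Variable br : {bilinear V -> V -> V}.
Hypothesis br_alt : forall v, br v v = 0.
Implicit Types (u v w : V) (e f : seq V).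

Lemma bracket_anti u v : br u v = - br v u.
Proof.
have := br_alt (u + v); rewrite linearDl !linearDr /= !br_alt add0r addr0 => /eqP.
by rewrite addr_eq0 => /eqP.
Qed.

(** The first three vectors need not all lie in the derived algebra, so that the two-dimensional
    case fits as well, with a central unit vector of [r] added. *)
Definition adapted_frame e := [/\ onb g {:V} e, size e = 7%N,
  forall m u v, (2 < m)%N -> (m < 7)%N -> g e`_m (br u v) = 0 &
  forall i u, (i < 3)%N -> br e`_i u = 0].

Definition sd_matrix e : 'M[R]_3 := \matrix_(i, k) sd_coord (dcoef g br e i) k.

Lemma adapted_frame_dcoef e m i j : adapted_frame e ->
  (m < 7)%N -> (i < 7)%N -> (j < 7)%N ->
  dcoef g br e m i j = coef_vert3 (dcoef g br e) m i j.
Proof.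
move=> [_ _ He Hc] m7 i7 j7; rewrite /coef_vert3 !beforeE.
case: ltnP => [m3|/He]; last by rewrite /dcoef => ->.
case: ltnP => [i3|/Hc]; last by rewrite /dcoef => ->; rewrite dot0r.
case: ltnP => [//|/Hc j3].
by rewrite /dcoef bracket_anti j3 oppr0 dot0r.
Qed.

Lemma adapted_frame_purely_coclosed e : adapted_frame e ->
  (sd_matrix e)^T = sd_matrix e -> \tr (sd_matrix e) = 0 ->
  has_purely_coclosed_G2 br g.
Proof.
move=> ad sym tr0; have [ob se He Hc] := ad.
apply: (frame_purely_coclosed br_alt ob se) => [s st s5 s7|].
  rewrite (eq_d_psi s5 s7 (fun m i j => adapted_frame_dcoef ad (m := m) (i := i) (j := j))).
  apply: d_psi_coef3_eq0 => // i j i3 j3.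
  by have /matrixP/(_ (Ordinal j3) (Ordinal i3)) := sym; rewrite !mxE /= => ->.
rewrite (eq_d_phi_phi (fun m i j => adapted_frame_dcoef ad (m := m) (i := i) (j := j))).
rewrite d_phi_phi_coef3; move: tr0; rewrite /mxtrace sum3 !mxE => ->.
by rewrite mulr0.
Qed.

Definition rotate_frame (Q : 'M[R]_3) e : seq V :=
  mkseq (fun n => if (n < 3)%N then \sum_(k < 3) Q (inord n) k *: e`_k else e`_n) 7.

Lemma rotate_frame_vertical Q e i : (i < 3)%N ->
  (rotate_frame Q e)`_i = \sum_(k < 3) Q (inord i) k *: e`_k.
Proof. by move=> i3; rewrite nth_mkseq ?i3 // (ltn_trans i3). Qed.

Lemma rotate_frame_horizontal Q e i : (2 < i)%N -> (i < 7)%N ->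
  (rotate_frame Q e)`_i = e`_i.
Proof. by move=> i3 i7; rewrite nth_mkseq // ltnNge i3. Qed.

Lemma adapted_frame_rotate Q e : adapted_frame e -> Q *m Q^T = 1%:M ->
  adapted_frame (rotate_frame Q e).
Proof.
move=> [ob se He Hc] QQ; have [eV _ on] := ob; split=> //; first split=> [|? _|i j].
- by rewrite size_mkseq -eV se.
- exact: memvf.
- have low i' j' : (i' < 3)%N -> (j' < 3)%N ->
      g (rotate_frame Q e)`_i' (rotate_frame Q e)`_j' = (i' == j')%:R.
    move=> i3 j3; rewrite !rotate_frame_vertical // dot_suml.
    have /matrixP/(_ (inord i') (inord j')) := QQ; rewrite !mxE -val_eqE /= !inordK // => <-.
    apply: eq_bigr => k _; rewrite dotZl dot_sumr (bigD1 k) //= dotZr on ?se ?eqxx ?mulr1;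
      try exact: ltn_trans (ltn_ord k) _.
    rewrite big1 ?addr0 ?mxE // => l lk.
    rewrite dotZr on ?se; try exact: ltn_trans (ltn_ord _) _.
    by rewrite eq_sym val_eqE (negbTE lk) mulr0.
  have mixed i' j' : (i' < 3)%N -> (2 < j')%N -> (j' < 7)%N ->
      g (rotate_frame Q e)`_i' (rotate_frame Q e)`_j' = 0.
    move=> i3 j3 j7; rewrite rotate_frame_vertical // rotate_frame_horizontal // dot_suml.
    apply: big1 => k _; rewrite dotZl on ?se //; last exact: ltn_trans (ltn_ord k) _.
    by rewrite ltn_eqF ?mulr0 // (leq_trans (ltn_ord k)).
  rewrite size_mkseq => i7 j7; case: (ltnP i 3) => i3; case: (ltnP j 3) => j3.
  + exact: low.
  + by rewrite mixed // ltn_eqF // (leq_trans i3).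
  + by rewrite dotC mixed // gtn_eqF // (leq_trans j3).
  + by rewrite !rotate_frame_horizontal // on ?se.
- by move=> m u v m2 m7; rewrite rotate_frame_horizontal // He.
- move=> i u i3; rewrite rotate_frame_vertical //.
  rewrite (big_morph (fun x => br x u) (id1 := 0) (op1 := +%R)) => [|x y|].
  + apply: big1 => k _; rewrite linearZl_LR /= Hc ?scaler0 //.
  + by rewrite linearDl.
  + by rewrite linear0l.
Qed.

Lemma sd_matrix_rotate Q e : adapted_frame e ->
  sd_matrix (rotate_frame Q e) = Q *m sd_matrix e.
Proof.
move=> ad; apply/matrixP => i k; rewrite !mxE.
have E a b : (2 < a)%N -> (a < 7)%N -> (2 < b)%N -> (b < 7)%N ->
    dcoef g br (rotate_frame Q e) i a b = \sum_(l < 3) Q i l * dcoef g br e l a b.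
  move=> a2 a7 b2 b7; rewrite /dcoef rotate_frame_vertical // !rotate_frame_horizontal //.
  by rewrite dot_suml inord_val; apply: eq_bigr => l _; rewrite dotZl.
under eq_bigr do rewrite mxE.
by rewrite /sd_coord; case: (val k) => [|[|n]]; rewrite !E // -?sumrN -?big_split ?sumrN
  -?sumrB /= -?sumrN; apply: eq_bigr => l _; ring.
Qed.

Lemma balanced_frame_purely_coclosed e : adapted_frame e -> balanced (sd_matrix e) ->
  has_purely_coclosed_G2 br g.
Proof.
move=> ad /rotation_exists[Q [QQ QS Q0]].
apply: (adapted_frame_purely_coclosed (adapted_frame_rotate ad QQ));
  by rewrite sd_matrix_rotate.
Qed.

End ThreeDimensionalVerticalSpace.

(** * Covectors and Gram matrices on a 2-step nilpotent metric Lie algebra *)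

Section NilpotentMetricLieAlgebras.
Variables (R : realType) (n : vectType R) (br : {bilinear n -> n -> n}).
Variable g : {dot n for idfun}.
Hypotheses (br_lie : lie_bracket br) (n_2step : two_step_nilpotent br).
Implicit Types (u v w z : n) (e b : seq n).

Local Notation n' := (derived_algebra br).

Lemma br_alt v : br v v = 0.
Proof. by case: br_lie. Qed.

Lemma bracket_derived x y : br x y \in n'.
Proof.
rewrite (coord_vbasis (memvf x)) (coord_vbasis (memvf y)).
rewrite (big_morph (fun u => br u _) (id1 := 0) (op1 := +%R)) => [|u v|]; last 2 first.
- by rewrite linearDl.
- by rewrite linear0l.
apply: memv_suml => i _; rewrite linearZl_LR /= memvZ //.
rewrite linear_sumr /=; apply: memv_suml => j _; rewrite linearZr_LR /= memvZ //.
by apply/memv_span/allpairsP; exists ((vbasis {:n})`_i, (vbasis {:n})`_j);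
  split=> //=; apply: mem_nth; rewrite size_tuple.
Qed.

Lemma derived_central z x : z \in n' -> br z x = 0.
Proof. by case: n_2step => _ H /H. Qed.

Lemma derived_central_r z x : z \in n' -> br x z = 0.
Proof. by move=> zn; rewrite (bracket_anti br_alt) derived_central ?oppr0. Qed.

Lemma mem_horizontal x : reflect (forall z, z \in n' -> g x z = 0) (x \in horizontal br g).
Proof. exact: orthov_dotP. Qed.

Definition covector z : kform n 1 := fun x => g z (x ord0).

Lemma covector_form z : is_form (covector z).
Proof.
split=> [x i a u v|x i j]; last by rewrite !ord1.
by rewrite /covector /= (ord1 i) /= dotDr dotZr.
Qed.

Lemma covector_form_on (U : {vspace n}) z : z \in U -> form_on g U (covector z).
Proof.
move=> zU; split; first exact: covector_form.
by move=> x i /orthov_dotP H; rewrite /covector dotC -[ord0](ord1 i) H.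
Qed.

Lemma form_on_covector (U : {vspace n}) zeta : form_on g U zeta ->
  exists2 z, z \in U & zeta = covector z.
Proof.
move=> [fz vz]; have [e ob] := onb_exists g U; have [se eU on] := ob.
have [e' ob'] := onb_extend on (fun x _ => memvf x).
exists (\sum_(i < size e) ev zeta [:: e`_i] *: e`_i).
  by apply: memv_suml => i _; apply/memvZ/eU/mem_nth.
apply: funext => x; rewrite /covector dot_suml evE /=.
have -> : [seq x i | i <- enum 'I_1] = [:: x ord0] by rewrite enum_ordSl enum_ord0 /=.
rewrite (ev_head_expand _ (form_multilinear fz) ob' (memvf _)) size_cat big_split_ord /=.
rewrite [X in _ + X]big1 ?addr0 => [|i _].
  by apply: eq_bigr => i _; rewrite nth_cat ltn_ord dotZl mulrC.
rewrite [ev _ _](vz _ ord0) ?mulr0 //=; have [_ sub _] := onb_orthov ob ob'.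
by apply: sub; rewrite nth_cat ltnNge leq_addr addKn mem_nth.
Qed.

Lemma form_dot_covector (U : {vspace n}) z z' : z \in U ->
  form_dot g U (covector z) (covector z') = g z z'.
Proof.
move=> zU; have [e ob] := onb_exists g U; have [se eU on] := ob.
rewrite (form_dotE (form_multilinear (covector_form z)) (form_multilinear (covector_form z')) ob).
rewrite -[1`!]/1%N invr1 mul1r /= (dot_onb _ ob zU) se.
by apply: eq_bigr => i _; rewrite /fcoef /ev /covector /= !(dotC g _ e`_i).
Qed.

Lemma orthonormal_covectors m (zeta : 'I_m -> kform n 1) (U : {vspace n}) :
  orthonormal_cobasis g U zeta ->
  exists2 z : 'I_m -> n, (forall i, z i \in U) /\ (forall i, zeta i = covector (z i)) &
    forall i j, g (z i) (z j) = (i == j)%:R.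
Proof.
move=> [on dots _]; have /choice[z zP] : forall i, exists z, z \in U /\ zeta i = covector z.
  by move=> i; have [z] := form_on_covector (on i); exists z.
exists z => [|i j]; first by split=> i; case: (zP i).
have [ziU zi] := zP i; have [zjU zj] := zP j.
by rewrite -(form_dot_covector _ ziU) -zi -zj.
Qed.

Lemma onb_orthonormal_cobasis (U : {vspace n}) m e : onb g U e -> size e = m ->
  orthonormal_cobasis g U (fun i : 'I_m => covector e`_i).
Proof.
move=> ob sm; have [se eU on] := ob.
have mem (i : 'I_m) : e`_i \in U by apply/eU/mem_nth; rewrite sm.
split=> [i|i j|alpha /form_on_covector[z zU ->]]; first exact: covector_form_on.
  by rewrite form_dot_covector // on ?sm.
exists (fun i => g e`_i z) => x; rewrite /covector {1}(onb_expand ob zU) dot_suml sm.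
by apply: eq_bigr => i _; rewrite dotZl.
Qed.

Lemma ce_diff_covector z : ce_diff br (covector z) = fun x => -1 * dcovector g br z x.
Proof.
apply: funext => x; rewrite [LHS]evE [dcovector _ _ _ x]evE !enum_ordSl enum_ord0 /=.
by rewrite ev_ce_diff /= !big_cons !big_nil /= !addr0 add0r expr1.
Qed.

Lemma ce_diff_covector_form z : is_form (ce_diff br (covector z)).
Proof. rewrite ce_diff_covector; exact/form_scale/dcovector_form/br_alt. Qed.

Definition sd_rows m (z : 'I_m -> n) b : 'M[R]_(m, 3) :=
  \matrix_(i, k) sd_comp (dcovector g br (z i)) b k.

Lemma form_dot_sd_rows m (z : 'I_m -> n) (U : {vspace n}) b vol i j :
  onb g U b -> volume_form g U vol -> ev vol b = 1 ->
  form_dot g U (self_dual_part g U vol (ce_diff br (covector (z i))))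
    (self_dual_part g U vol (ce_diff br (covector (z j)))) =
  2^-1 * (sd_rows z b *m (sd_rows z b)^T) i j.
Proof.
move=> ob volP v1; rewrite (form_dot_self_dual ob volP v1); try exact: ce_diff_covector_form.
have E y k : sd_comp (ce_diff br (covector y)) b k = - sd_comp (dcovector g br y) b k.
  rewrite ce_diff_covector /sd_comp /ev; case: k => [|[|k]]; ring.
by rewrite !E !mxE sum3 !mxE /sd_comp /=; ring.
Qed.

Lemma orthonormal_change m (z z' : 'I_m -> n) (U : {vspace n}) : \dim U = m ->
  (forall i, z i \in U) -> (forall i j, g (z i) (z j) = (i == j)%:R) ->
  (forall i, z' i \in U) -> (forall i j, g (z' i) (z' j) = (i == j)%:R) ->
  exists2 C : 'M[R]_m, C *m C^T = 1%:M & forall i, z' i = \sum_j C i j *: z j.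
Proof.
move=> dU zU zz zU' zz'.
pose e := [seq z i | i <- enum 'I_m].
have se : size e = m by rewrite size_map size_enum_ord.
have ez (i : 'I_m) : e`_i = z i by rewrite (nth_map i) ?size_enum_ord // nth_ord_enum.
have ob : onb g U e.
  split=> [|x /mapP[i _ ->]//|i j]; rewrite se // => im jm.
  by rewrite -[i]/(val (Ordinal im)) -[j]/(val (Ordinal jm)) !ez zz.
have zE i : z' i = \sum_j g (z j) (z' i) *: z j.
  by rewrite {1}(onb_expand ob (zU' i)) se; apply: eq_bigr => j _; rewrite ez.
exists (\matrix_(i, j) g (z j) (z' i)) => [|i].
  apply/matrixP => i j; rewrite !mxE -zz' {1}(zE i) dot_suml.
  by apply: eq_bigr => k _; rewrite !mxE dotZl.
by rewrite {1}zE; apply: eq_bigr => j _; rewrite mxE.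
Qed.

Lemma sd_rows_change m (z z' : 'I_m -> n) (C : 'M[R]_m) b :
  (forall i, z' i = \sum_j C i j *: z j) -> sd_rows z' b = C *m sd_rows z b.
Proof.
move=> zE; apply/matrixP => i k; rewrite !mxE; under eq_bigr do rewrite mxE.
have E x y : ev (dcovector g br (z' i)) [:: x; y] =
    \sum_j C i j * ev (dcovector g br (z j)) [:: x; y].
  by rewrite ev_dcovector zE dot_suml; apply: eq_bigr => j _; rewrite dotZl.
by rewrite /sd_comp; case: (val k) => [|[|l]]; rewrite !E -?sumrN -?big_split ?sumrN
  -?sumrB /= -?sumrN; apply: eq_bigr => j _; ring.
Qed.

End NilpotentMetricLieAlgebras.

(** * Real eigenvectors and the normal form of skew bilinear forms *)

Section SkewNormalForm.
Import complex.
Variable R : realType.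

Lemma symmetric_eigenvector m (S : 'M[R]_m.+1) : S^T = S ->
  exists a (v : 'rV[R]_m.+1), v != 0 /\ v *m S = a *: v.
Proof.
move=> sym; pose T := map_mx (real_complex R) S.
have [[a b] /eigenvalueP[w wT w0]] : exists l, eigenvalue T l.
  have /closed_rootP[l rl] : size (char_poly T) != 1%N by rewrite size_char_poly.
  by exists l; rewrite eigenvalue_root_char.
(* Symmetry of [S] forces the imaginary part [b] of the eigenvalue to vanish, so the
   real and imaginary parts of [w] are eigenvectors. *)
pose x := map_mx (@complex.Re R) w; pose y := map_mx (@complex.Im R) w.
have ReD : {morph @complex.Re R : u v / u + v} by case=> ? ? [].
have ImD : {morph @complex.Im R : u v / u + v} by case=> ? ? [].
have ReM (u : R[i]) (c : R) : complex.Re (u * real_complex R c) = complex.Re u * c.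
  by case: u => ? ? /=; ring.
have ImM (u : R[i]) (c : R) : complex.Im (u * real_complex R c) = complex.Im u * c.
  by case: u => ? ? /=; ring.
have xS : x *m S = a *: x - b *: y.
  apply/rowP => j; have := congr1 (fun u : 'rV_m.+1 => complex.Re (u 0 j)) wT.
  rewrite !mxE (big_morph _ ReD (erefl : complex.Re 0 = 0)) => H.
  under eq_bigr => k _ do rewrite mxE -ReM.
  rewrite (eq_bigr (fun k => complex.Re (w 0 k * T k j))) ?H => [|k _]; last by rewrite !mxE.
  by case: (w 0 j).
have yS : y *m S = b *: x + a *: y.
  apply/rowP => j; have := congr1 (fun u : 'rV_m.+1 => complex.Im (u 0 j)) wT.
  rewrite !mxE (big_morph _ ImD (erefl : complex.Im 0 = 0)) => H.
  under eq_bigr => k _ do rewrite mxE -ImM.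
  rewrite (eq_bigr (fun k => complex.Im (w 0 k * T k j))) ?H => [|k _]; last by rewrite !mxE.
  by case: (w 0 j) => c d /=; rewrite addrC.
have tr1 (M : 'M[R]_1) : M 0 0 = M^T 0 0 by rewrite mxE.
have xy : (x *m y^T) 0 0 = (y *m x^T) 0 0.
  by rewrite !mxE; apply: eq_bigr => k _; rewrite !mxE mulrC.
have bxy : b * ((x *m x^T) 0 0 + (y *m y^T) 0 0) = 0.
  have : (x *m S *m y^T) 0 0 = (y *m S *m x^T) 0 0.
    by rewrite (tr1 (x *m S *m y^T)) !trmx_mul trmxK sym mulmxA.
  rewrite xS yS -scaleNr !mulmxDl -!scalemxAl ![(_ + _ : 'M_1) 0 0]mxE ![(_ *: _ : 'M_1) 0 0]mxE xy.
  by lra.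
have [x0|x0] := eqVneq x 0; last have [y0|y0] := eqVneq y 0.
- have y0 : y != 0.
    apply: contra_neq w0 => y0; apply/rowP => j.
    have /(congr1 (fun u : 'rV_m.+1 => u 0 j)) := x0; have /(congr1 (fun u : 'rV_m.+1 => u 0 j)) := y0.
    by rewrite !mxE; case: (w 0 j) => c d /= -> ->.
  by exists a, y; split=> //; rewrite yS x0 scaler0 add0r.
- by exists a, x; split=> //; rewrite xS y0 scaler0 subr0.
have b0 : b = 0.
  apply/eqP; move/eqP: bxy; rewrite mulf_eq0 => /orP[//|].
  by rewrite gt_eqF // addr_gt0 // row_dot_gt0.
by exists a, x; split=> //; rewrite xS b0 scale0r subr0.
Qed.

(** In odd size, [det A = det A^T = - det A]. *)
Lemma skew_kernel m (A : 'M[R]_m) : A^T = - A -> odd m ->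
  exists2 v : 'rV[R]_m, v != 0 & v *m A = 0.
Proof.
move=> skew om; apply/det0P/eqP.
by have := det_tr A; rewrite skew -scaleN1r detZ -signr_odd om expr1; lra.
Qed.

End SkewNormalForm.

Section SkewForms.
Variables (R : realType) (V : vectType R) (g : {dot V for idfun}) (al : V -> V -> R).
Hypothesis al_linear : forall a x x' y, al (a *: x + x') y = a * al x y + al x' y.
Hypothesis al_skew : forall x y, al y x = - al x y.
Implicit Types (x y u w : V) (U : {vspace V}) (b e : seq V).

Lemma skew_suml m (c : 'I_m -> R) (x : 'I_m -> V) y :
  al (\sum_i c i *: x i) y = \sum_i c i * al (x i) y.
Proof.
have al0 : al 0 y = 0 by have := al_linear 1 0 0 y; rewrite scaler0 addr0; lra.
have alD u w : al (u + w) y = al u y + al w y.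
  by have := al_linear 1 u w y; rewrite scale1r mul1r.
rewrite (big_morph (al^~ y) alD al0); apply: eq_bigr => i _.
by have := al_linear (c i) (x i) 0 y; rewrite addr0 al0 addr0.
Qed.

Lemma skew_sumr m (c : 'I_m -> R) (x : 'I_m -> V) y :
  al y (\sum_i c i *: x i) = \sum_i c i * al y (x i).
Proof.
by rewrite al_skew skew_suml -sumrN; apply: eq_bigr => i _; rewrite (al_skew y) mulrN opprK.
Qed.

Definition seq_comb b m (v : 'rV[R]_m) : V := \sum_i v 0 i *: b`_i.

Definition skew_mx b m : 'M[R]_m := \matrix_(i, j) al b`_i b`_j.

Lemma skew_mx_tr b m : (skew_mx b m)^T = - skew_mx b m.
Proof. by apply/matrixP => i j; rewrite !mxE. Qed.

Lemma skew_seq_comb b m (v w : 'rV[R]_m) :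
  al (seq_comb b v) (seq_comb b w) = (v *m skew_mx b m *m w^T) 0 0.
Proof.
rewrite skew_sumr mxE; apply: eq_bigr => j _; rewrite skew_suml mulrC !mxE.
by congr (_ * _); apply: eq_bigr => i _; rewrite mxE.
Qed.

Lemma seq_comb_in U b m (v : 'rV[R]_m) : onb g U b -> size b = m -> seq_comb b v \in U.
Proof.
move=> [_ bU _] sb; apply: memv_suml => i _; apply/memvZ/bU/mem_nth.
by rewrite sb.
Qed.

Lemma dot_seq_comb U b m (v w : 'rV[R]_m) : onb g U b -> size b = m ->
  g (seq_comb b v) (seq_comb b w) = (v *m w^T) 0 0.
Proof.
move=> [_ _ on] sb; rewrite dot_suml mxE; apply: eq_bigr => i _.
rewrite dotZl dot_sumr (bigD1 i) //= dotZr on ?sb // eqxx mulr1 mxE big1 ?addr0 // => j.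
by rewrite -val_eqE eq_sym => ij; rewrite dotZr on ?sb // (negbTE ij) mulr0.
Qed.

Lemma seq_comb_onto U b m y : onb g U b -> size b = m -> y \in U ->
  exists w : 'rV[R]_m, y = seq_comb b w.
Proof.
move=> ob sb yU; exists (\row_i g b`_i y); rewrite {1}(onb_expand ob yU) sb.
by apply: eq_bigr => i _; rewrite mxE.
Qed.

Lemma unit_row m (v : 'rV[R]_m) : v != 0 -> exists2 a : R, a != 0 & ((a *: v) *m (a *: v)^T) 0 0 = 1.
Proof.
move=> /row_dot_gt0; set d := _ 0 0 => d0; have s0 : Num.sqrt d != 0 by rewrite sqrtr_eq0 -ltNge.
exists (Num.sqrt d)^-1; first by rewrite invr_eq0.
rewrite linearZ /= -scalemxAl -scalemxAr ![(_ *: _ : 'M_1) 0 0]mxE -/d.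
by rewrite -[X in _ * (_ * X) = _](sqr_sqrtr (ltW d0)); field.
Qed.

Lemma skew_plane U k : \dim U = k.+1.*2 -> exists u w c,
  [/\ u \in U, w \in U & [/\ g u u = 1, g w w = 1 & g u w = 0]] /\
  forall y, y \in U -> al u y = c * g w y /\ al w y = - c * g u y.
Proof.
move=> dU; have [b ob] := onb_exists g U; have sb : size b = k.*2.+2 by case: ob => ->.
pose A := skew_mx b k.*2.+2; have AT : A^T = - A := skew_mx_tr _ _.
(* An eigenvector [v] of [A A^T = - A^2] spans an invariant plane with [v A], unless
   [v A = 0]; then [A] also has a kernel on the odd-dimensional complement of [v]. *)
have [|a [v0 [v00 v0S]]] := @symmetric_eigenvector R _ (A *m A^T).
  by rewrite trmx_mul trmxK.
have [t t0 v1] := unit_row v00; move: v1; set v := t *: v0 => v1.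
have vS : v *m (A *m A^T) = a *: v by rewrite /v -scalemxAl v0S !scalerA mulrC.
have dotE := fun v v' => dot_seq_comb v v' ob sb.
clearbody v; have wa : ((v *m A) *m (v *m A)^T) 0 0 = a.
  by rewrite trmx_mul mulmxA -(mulmxA v) vS -scalemxAl mxE v1 mulr1.
have vv : (v *m (v *m A)^T) 0 0 = 0.
  have tr1 (M : 'M[R]_1) : M 0 0 = M^T 0 0 by rewrite mxE.
  have : (v *m (v *m A)^T) 0 0 = (v *m A *m v^T) 0 0 by rewrite tr1 trmx_mul trmxK.
  by rewrite trmx_mul AT mulNmx mulmxN mulmxA [(- _ : 'M_1) 0 0]mxE; lra.
have [w0|w0] := eqVneq (v *m A) 0.
  set u := seq_comb b v; have uU : u \in U := seq_comb_in v ob sb.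
  have u1 : g u u = 1 by rewrite dotE.
  have al_u y : y \in U -> al u y = 0.
    by move=> /(seq_comb_onto ob sb)[w ->]; rewrite skew_seq_comb w0 mul0mx mxE.
  have [||e oe] := @onb_extend _ _ g U [:: u].
  - by case=> [|i] [|j].
  - by move=> x; rewrite inE => /eqP ->.
  have [se eU one] := oe; have {}se : size e = k.*2.+1 by move: se; rewrite dU => -[].
  have obe : onb g <<e>>%VS e.
    have on : orthonormal_seq g e by move=> i j ie je; apply: (one i.+1 j.+1).
    by split; [have /eqP := orthonormal_seq_free on|move=> x; apply: memv_span|].
  have [|w1 w10 w1A] := skew_kernel (skew_mx_tr e k.*2.+1); first by rewrite /= odd_double.
  have [s s0 ss] := unit_row w10; set w := s *: w1 in ss.
  have wA : w *m skew_mx e k.*2.+1 = 0 by rewrite -scalemxAl w1A scaler0.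
  clearbody w.
  have alw i : (i < k.*2.+1)%N -> al (seq_comb e w) e`_i = 0.
    move=> ik; transitivity ((w *m skew_mx e k.*2.+1) 0 (Ordinal ik)); last by rewrite wA mxE.
    by rewrite skew_suml mxE; apply: eq_bigr => l _; rewrite mxE.
  have wU : seq_comb e w \in U.
    apply: memv_suml => i _; apply/memvZ/eU; rewrite inE mem_nth ?orbT //.
    by rewrite se.
  have uw : g u (seq_comb e w) = 0.
    rewrite dot_sumr big1 // => i _; have := one 0%N i.+1.
    by rewrite /= se => H; rewrite dotZr (H isT (ltn_ord i)) mulr0.
  exists u, (seq_comb e w), 0; split=> [|y yU]; first by split=> //; split=> //; rewrite (dot_seq_comb _ _ obe).
  rewrite al_u // oppr0 !mul0r; split=> //.
  rewrite (onb_expand oe yU) /= skew_sumr big_ord_recl /= al_skew al_u // oppr0 mulr0 add0r.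
  rewrite big1 // => i _; rewrite [al _ _]alw ?mulr0 // -se; exact: ltn_ord.
have a0 : 0 < a by rewrite -wa row_dot_gt0.
(* The norm of [v A], which is orthogonal to [v]; dividing by it gives the second unit vector of the
   plane. *)
pose c := Num.sqrt a; have c2 : c ^+ 2 = a by rewrite sqr_sqrtr // ltW.
have c0 : c != 0 by rewrite sqrtr_eq0 -ltNge.
clearbody c.
exists (seq_comb b v), (seq_comb b (c^-1 *: (v *m A))), c; split.
  split; try exact: seq_comb_in ob sb; rewrite !dotE v1; split=> //.
    by rewrite linearZ /= -scalemxAl -scalemxAr ![(_ *: _ : 'M_1) 0 0]mxE wa -c2; field.
  by rewrite linearZ /= -scalemxAr [(_ *: _ : 'M_1) 0 0]mxE vv mulr0.
move=> y /(seq_comb_onto ob sb)[w ->]; rewrite !skew_seq_comb !dotE -/A; split.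
  by rewrite -[in RHS]scalemxAl [in RHS]mxE mulrA mulfV // mul1r.
rewrite -!scalemxAl -(mulmxA v) -[A in X in _ *: (v *m (_ *m X) *m _)]opprK -AT.
by rewrite mulmxN mulmxN vS mulNmx -scalemxAl !mxE -c2; field.
Qed.

(** An invariant plane from [skew_plane] is split off. On the orthogonal complement [al u] and
    [al w] vanish, being multiples of [g w] and [g u], and the induction continues there. *)
Lemma skew_normal_form k U : \dim U = k.*2 -> exists2 e, onb g U e &
  forall i j, (i < k.*2)%N -> (j < k.*2)%N -> i./2 != j./2 -> al e`_i e`_j = 0.
Proof.
elim: k U => [|k IH] U dU; first by have [e oe] := onb_exists g U; exists e.
have [u [w [c [[uU wU [u1 w1 uw]] H]]]] := skew_plane dU.
have [||f of_] := @onb_extend _ _ g U [:: u; w].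
- by case=> [|[|i]] [|[|j]] //= _ _; rewrite ?(dotC g w u).
- by move=> x; rewrite !inE => /orP[] /eqP ->.
have [sf fU onf] := of_; have {}sf : size f = k.*2 by move: sf; rewrite dU => -[].
have on : orthonormal_seq g f by move=> i j fi fj; apply: (onf i.+2 j.+2).
have obf : onb g <<f>>%VS f.
  by split; [have /eqP := orthonormal_seq_free on|move=> x; apply: memv_span|].
have perp y : y \in <<f>>%VS -> g u y = 0 /\ g w y = 0.
  move=> yf; rewrite (onb_expand obf yf) !dot_sumr; split; rewrite big1 // => i _; rewrite dotZr.
    by rewrite (onf 0%N i.+2 isT (ltn_ord i)) mulr0.
  by rewrite (onf 1%N i.+2 isT (ltn_ord i)) mulr0.
have sub y : y \in <<f>>%VS -> y \in U.
  move=> yf; rewrite (onb_expand obf yf); apply: memv_suml => i _.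
  by apply/memvZ/fU; rewrite !inE mem_nth ?orbT.
have [|e oe He] := IH <<f>>%VS; first by case: obf => <-.
have [se eU one] := oe; have {}se : size e = k.*2 by rewrite se; case: obf => <-.
have ein i : (i < k.*2)%N -> e`_i \in <<f>>%VS by move=> ik; apply/eU/mem_nth; rewrite se.
exists [:: u, w & e].
  split=> [|x|]; first by rewrite /= se dU.
    by rewrite !inE => /or3P[/eqP ->|/eqP ->|/eU /sub].
  case=> [|[|i]] [|[|j]] //=; rewrite ?se ?(dotC g w u) // => ik jk; rewrite ?one ?se //.
  - by case: (perp e`_j (ein j jk)).
  - by case: (perp e`_j (ein j jk)).
  - by rewrite dotC; case: (perp e`_i (ein i ik)).
  - by rewrite dotC; case: (perp e`_i (ein i ik)).
have al0 y : y \in <<f>>%VS -> al u y = 0 /\ al w y = 0.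
  by move=> yf; have [-> ->] := H y (sub y yf); have [-> ->] := perp y yf; rewrite !mulr0.
case=> [|[|i]] [|[|j]] //= ik jk ij; last exact: He.
- by case: (al0 e`_j (ein j jk)).
- by case: (al0 e`_j (ein j jk)).
- by rewrite al_skew; case: (al0 e`_i (ein i ik)) => -> _; rewrite oppr0.
- by rewrite al_skew; case: (al0 e`_i (ein i ik)) => _ ->; rewrite oppr0.
Qed.

End SkewForms.

Lemma lfun_traceE (R : realType) (W : vectType R) (f : 'End(W)) :
  lfun_trace f = \sum_i coord (vbasis {:W}) i (f (vbasis {:W})`_i).
Proof.
rewrite /lfun_trace /mxtrace; apply: eq_bigr => i _.
by rewrite !mxE /= passmx.vecof_delta.
Qed.

(** * Traces of endomorphisms in orthonormal bases, and the map [j] *)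

Section Operators.
Variables (R : realType) (V : vectType R) (g : {dot V for idfun}) (U : {vspace V}).
Variables (b : seq V) (m : nat).
Hypotheses (ob : onb g U b) (sb : size b = m).
Implicit Types f h : 'End(subvs_of U).

Definition operator_mx f : 'M[R]_m := \matrix_(i, j) g b`_j (vsval (f (vsproj U b`_i))).

Lemma onb_mem (i : 'I_m) : b`_i \in U.
Proof. by case: ob => _ bU _; apply/bU/mem_nth; rewrite sb. Qed.

Lemma subvs_expand (x : subvs_of U) :
  x = \sum_(i < m) g b`_i (vsval x) *: vsproj U b`_i.
Proof.
apply: subvs_inj; rewrite linear_sum {1}(onb_expand ob (subvsP x)) sb.
by apply: eq_bigr => i _; rewrite linearZ /= vsprojK // onb_mem.
Qed.

(** [lfun_trace] is computed in the basis [vbasis]; expanding each basis in the other gives the same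
    double sum in both orders. *)
Lemma lfun_trace_onb f : lfun_trace f = \tr (operator_mx f).
Proof.
rewrite lfun_traceE; set B := vbasis _.
transitivity (\sum_(j < m) \sum_(i < \dim {:subvs_of U}) g b`_j (vsval B`_i) * coord B i (f (vsproj U b`_j))).
  rewrite exchange_big; apply: eq_bigr => i _ /=.
  rewrite {1}(subvs_expand B`_i) !linear_sum /=; apply: eq_bigr => j _.
  by rewrite !linearZ.
apply: eq_bigr => j _; rewrite mxE; set x := f _.
rewrite {2}(coord_vbasis (memvf x)) linear_sum dot_sumr /=; apply: eq_bigr => i _.
by rewrite linearZ /= mulrC.
Qed.

(** The order is reversed because row [i] contains the image of [b_i]. *)
Lemma operator_mx_comp f h : operator_mx (f \o h)%VF = operator_mx h *m operator_mx f.
Proof.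
apply/matrixP => i j; rewrite !mxE comp_lfunE {1}(subvs_expand (h _)) !linear_sum.
by apply: eq_bigr => k _; rewrite !linearZ /= !mxE.
Qed.

End Operators.

Section TraceOfJ.
Variables (R : realType) (n : vectType R) (br : {bilinear n -> n -> n}).
Variable g : {dot n for idfun}.
Local Notation r := (horizontal br g).

(** The endomorphism [F], written in an orthonormal basis, belongs to the set defining [jmap], so
    the default 0 of [xget] does not occur. *)
Lemma jmapP z (x y : subvs_of r) :
  g (vsval (jmap br g z x)) (vsval y) = g z (br (vsval x) (vsval y)).
Proof.
have [b ob] := onb_exists g r.
pose F (x : subvs_of r) : subvs_of r :=
  \sum_(i < size b) g z (br (vsval x) b`_i) *: vsproj r b`_i.
have linF : linear F.
  move=> a u v; rewrite /F scaler_sumr -big_split /=; apply: eq_bigr => i _.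
  by rewrite linearPl dotDr dotZr scalerA -scalerDl.
pose Fl := HB.pack_for {linear subvs_of r -> subvs_of r} F
  (GRing.isSemilinear.Build R _ _ _ F (GRing.semilinear_linear linF)).
rewrite /jmap; case: xgetP => [J -> HJ|/(_ (linfun Fl))[]]; first exact: HJ.
move=> u v; rewrite lfunE /= linear_sum dot_suml.
rewrite [in RHS](onb_expand ob (subvsP v)) linear_sumr dot_sumr; apply: eq_bigr => i _.
rewrite linearZ /= vsprojK; last by case: ob => _ bU _; apply/bU/mem_nth.
by rewrite dotZl linearZr_LR dotZr mulrC.
Qed.

Lemma operator_mx_jmap b m z : onb g r b -> size b = m ->
  operator_mx g b m (jmap br g z) = \matrix_(i, j) g z (br b`_i b`_j).
Proof.
move=> ob sb; apply/matrixP => i j; rewrite !mxE dotC.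
by rewrite -[b`_j](vsprojK (onb_mem ob sb j)) jmapP !vsprojK ?(onb_mem ob sb).
Qed.

End TraceOfJ.

(** * Trace identities for skew matrices of size six *)

Section SkewTraces.
Variables (R : realType) (a : nat -> nat -> R).
Hypothesis a_skew : forall i j, a j i = - a i j.

Let A : 'M[R]_6 := \matrix_(i, j) a i.+1 j.+1.

Let sq i j := \sum_(k <- iota 1 6) a i k * a k j.

Lemma sum_ord6 (F : nat -> R) : \sum_(i < 6) F i.+1 = \sum_(i <- iota 1 6) F i.
Proof. by rewrite !big_ord_recl big_ord0 !big_cons big_nil. Qed.

Lemma sq_mx (i j : 'I_6) : (A *m A) i j = sq i.+1 j.+1.
Proof.
rewrite mxE /sq -(sum_ord6 (fun k => a i.+1 k * a k j.+1)).
by apply: eq_bigr => k _; rewrite !mxE.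
Qed.

Lemma trace_sq : \tr (A *m A) = \sum_(i <- iota 1 6) sq i i.
Proof. by rewrite -(sum_ord6 (fun i => sq i i)); apply: eq_bigr => i _; rewrite sq_mx. Qed.

Lemma sq_sym i j : sq j i = sq i j.
Proof. by apply: eq_bigr => k _; rewrite (a_skew i k) (a_skew k j); ring. Qed.

(** [A^2] is symmetric, so the trace of its square is the sum of the squares of its entries. *)
Lemma trace_fourth : \tr (A *m A *m A *m A) =
  \sum_(i <- iota 1 6) \sum_(j <- iota 1 6) sq i j ^+ 2.
Proof.
rewrite -(mulmxA (A *m A)) -(sum_ord6 (fun i => \sum_(j <- iota 1 6) sq i j ^+ 2)).
apply: eq_bigr => i _; rewrite mxE -(sum_ord6 (fun j => sq i.+1 j ^+ 2)).
by apply: eq_bigr => j _; rewrite !sq_mx (sq_sym i.+1) expr2.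
Qed.

Lemma diag0 i : a i i = 0.
Proof. by have := a_skew i i; lra. Qed.

(** The equations define su(3), whose elements have complex eigenvalues [i a, i b, i c] with
    [a + b + c = 0]; for such numbers [(a^2 + b^2 + c^2)^2 = 2 (a^4 + b^4 + c^4)]. *)
Lemma special_unitary_traces :
  a 1 4 + a 2 3 = 0 -> a 1 3 - a 2 4 = 0 -> a 1 6 + a 2 5 = 0 -> a 1 5 - a 2 6 = 0 ->
  a 3 6 + a 4 5 = 0 -> a 3 5 - a 4 6 = 0 -> a 1 2 + a 3 4 + a 5 6 = 0 ->
  \tr (A *m A) ^+ 2 = 4 * \tr (A *m A *m A *m A).
Proof.
move=> H1 H2 H3 H4 H5 H6 H7.
have E14 : a 1 4 = - a 2 3 by lra.
have E13 : a 1 3 = a 2 4 by lra.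
have E16 : a 1 6 = - a 2 5 by lra.
have E15 : a 1 5 = a 2 6 by lra.
have E36 : a 3 6 = - a 4 5 by lra.
have E35 : a 3 5 = a 4 6 by lra.
have E56 : a 5 6 = - a 1 2 - a 3 4 by lra.
clear H1 H2 H3 H4 H5 H6 H7.
rewrite trace_sq trace_fourth /sq !big_cons !big_nil.
rewrite !diag0 !(a_skew 1) !(a_skew 2 3) !(a_skew 2 4) !(a_skew 2 5) !(a_skew 2 6)
  !(a_skew 3 4) !(a_skew 3 5) !(a_skew 3 6) !(a_skew 4 5) !(a_skew 4 6) !(a_skew 5 6).
rewrite E14 E13 E16 E15 E36 E35 E56.
move: (a 1 2) (a 2 3) (a 2 4) (a 2 5) (a 2 6) (a 3 4) (a 4 5) (a 4 6); clear.
by move=> *; ring.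
Qed.

Lemma normal_form_traces :
  (forall i j, (i < 7)%N -> (j < 7)%N -> uphalf i != uphalf j -> a i j = 0) ->
  \tr (A *m A) = -2 * (a 1 2 ^+ 2 + a 3 4 ^+ 2 + a 5 6 ^+ 2) /\
  \tr (A *m A *m A *m A) = 2 * (a 1 2 ^+ 4 + a 3 4 ^+ 4 + a 5 6 ^+ 4).
Proof.
move=> a0; rewrite trace_sq trace_fourth /sq !big_cons !big_nil.
rewrite !diag0 !(a_skew 1) !(a_skew 2 3) !(a_skew 2 4) !(a_skew 2 5) !(a_skew 2 6)
  !(a_skew 3 4) !(a_skew 3 5) !(a_skew 3 6) !(a_skew 4 5) !(a_skew 4 6) !(a_skew 5 6).
rewrite (a0 1 3) ?(a0 1 4) ?(a0 1 5) ?(a0 1 6) ?(a0 2 3) ?(a0 2 4) ?(a0 2 5) ?(a0 2 6)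
  ?(a0 3 5) ?(a0 3 6) ?(a0 4 5) ?(a0 4 6) //.
by split; ring.
Qed.

End SkewTraces.

(** The difference of the two sides is, up to sign, Heron's product of the four factors [x + y + w],
    [x + y - w], [x - y + w], [x - y - w]. *)
Lemma sign_choice (R : realType) (x y w : R) :
  (x ^+ 2 + y ^+ 2 + w ^+ 2) ^+ 2 = 2 * (x ^+ 4 + y ^+ 4 + w ^+ 4) ->
  exists s t : R, [/\ s ^+ 2 = 1, t ^+ 2 = 1 & x + s * y + t * w = 0].
Proof.
move=> H; have /eqP : (x + y + w) * (x + y - w) * (x - y + w) * (x - y - w) = 0.
  transitivity (2 * (x ^+ 4 + y ^+ 4 + w ^+ 4) - (x ^+ 2 + y ^+ 2 + w ^+ 2) ^+ 2); first by ring.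
  by rewrite H subrr.
rewrite !mulf_eq0 -!orbA => /or4P[] /eqP E;
  [exists 1, 1|exists 1, (-1)|exists (-1), 1|exists (-1), (-1)];
  by split; [ring|ring|rewrite -[RHS]E; ring].
Qed.

Lemma onb_signs (R : realType) (V : vectType R) (g : {dot V for idfun}) (U : {vspace V})
    b m (s : nat -> R) : onb g U b -> size b = m -> (forall i, s i ^+ 2 = 1) ->
  onb g U (mkseq (fun i => s i *: b`_i) m).
Proof.
move=> [sb bU on] sm s2; split=> [|x /mapP[i]|i j]; rewrite ?size_mkseq -?sm //.
  by rewrite mem_iota => /= ib ->; apply/memvZ/bU/mem_nth.
move=> ib jb; rewrite !nth_mkseq // dotZl dotZr on //.
by have [<-|] := eqVneq; rewrite ?mulr0 // mulr1 -expr2 s2.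
Qed.

(** * From G2-structures to frames, and orientations of 4-planes *)

Section Classification.
Variables (R : realType) (n : vectType R) (br : {bilinear n -> n -> n}).
Variable g : {dot n for idfun}.
Hypotheses (br_lie : lie_bracket br) (n_2step : two_step_nilpotent br).
Hypothesis dim7 : \dim {:n} = 7%N.
Implicit Types (u v w z : n) (e b : seq n) (U : {vspace n}).

Local Notation n' := (derived_algebra br).
Local Notation r := (horizontal br g).
Local Notation br_alt := (br_alt br_lie).

(** The vector [w] is a unit normal to [u], [v] and [u x v], which exists in dimension seven. The
    clause on [e_2] records that it is [u x v], hence common to all frames with the same first two
    vectors. *)
Lemma purely_coclosed_adapted : has_purely_coclosed_G2 br g ->
  exists phi : kform n 3, [/\ is_form phi,
    forall u v, exists w, [/\ g w w = 1, g u w = 0, g v w = 0 & ev phi [:: u; v; w] = 0] &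
    forall u v w, g u u = 1 -> g v v = 1 -> g w w = 1 -> g u v = 0 -> g u w = 0 -> g v w = 0 ->
      ev phi [:: u; v; w] = 0 -> exists e,
      [/\ onb g {:n} e, [/\ e`_0 = u, e`_1 = v & e`_3 = w],
        forall x, g e`_2 x = ev phi [:: u; v; x],
        forall s, size s = 5%N -> all (ltn^~ 7) s -> d_psi (dcoef g br e) s = 0 &
        d_phi_phi (dcoef g br e) = 0]].
Proof.
move=> [phi [[fp _] pc [vol met]]]; exists phi; split=> // [u v|u v w u1 v1 w1 uv uw vw uvw].
  have [b ob] := onb_exists g {:n}.
  have [|w w1 wU] := @unit_normal_sub _ _ g phi vol met <<[:: u; v; cross phi b u v]>>.
    exact: leq_ltn_trans (dim_span _) _.
  exists w; split=> //; [| |rewrite -(dot_cross fp ob)]; apply/wU/memv_span;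
    by rewrite !inE eqxx ?orbT.
have [b ob'] := onb_exists g {:n}.
have [e [ob [e0 e1 e3] ve tab]] := G2_adapted_basis fp met ob' u1 v1 w1 uv uw vw uvw.
have [dpsi dphi] := purely_coclosed_frame br_alt fp pc met ob ve tab.
have se : size e = 7%N by case: ob => ->.
exists e; split=> // x; rewrite [in RHS](onb_expand ob (memvf x)).
rewrite (@linear_sum_scale _ _ (fun z => ev phi [:: u; v; z]) e (fun i => g e`_i x)); last first.
  by move=> a y y'; apply: ev3_linear.
have E l : (l < 7)%N -> ev phi [:: u; v; e`_l] = (l == 2)%:R.
  move=> l7; have := @table_fcoef _ _ phi e [:: 0; 1; l]%N fp tab erefl.
  rewrite /= l7 => /(_ isT); rewrite /fcoef /= e0 e1 => ->.
  by case: l l7 => [|[|[|[|[|[|[|l]]]]]]] // _; rewrite /phi0 /=; ring.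
have i2 : (2 < size e)%N by rewrite se.
rewrite (bigD1 (Ordinal i2)) //= E // eqxx mulr1 big1 ?addr0 // => i; rewrite -val_eqE /= => i2'.
by rewrite E -?se // (negbTE i2') mulr0.
Qed.

Lemma onb_swap U b : onb g U b -> size b = 4%N -> onb g U [:: b`_1; b`_0; b`_2; b`_3].
Proof.
move=> [sb bU on] s4; split=> [|x|i j]; first by rewrite -sb s4.
  by rewrite !inE => /or4P[] /eqP ->; apply/bU/mem_nth; rewrite s4.
case: i j => [|[|[|[|i]]]] [|[|[|[|j]]]] //= _ _; by rewrite on ?s4.
Qed.

Lemma oriented_onb U (vol : kform n 4) : \dim U = 4%N -> volume_form g U vol ->
  exists b, [/\ onb g U b, size b = 4%N & ev vol b = 1].
Proof.
move=> dU volP; have [b ob] := onb_exists g U.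
have sb : size b = 4%N by case: ob => ->.
have fv : is_form vol by case: volP => _ [].
have /eqP := volume_form_onb volP ob; rewrite sqrf_eq1 => /orP[/eqP v1|/eqP v1].
  by exists b.
exists [:: b`_1; b`_0; b`_2; b`_3]; split=> //; first exact: onb_swap.
rewrite (@ev_insert _ _ _ vol [:: b`_1] [:: b`_2; b`_3] b`_0) //; last exact: form_perm_alternating.
have bE : b = [:: b`_0; b`_1; b`_2; b`_3] by rewrite -[LHS](map_nth_iota0_id sb).
by rewrite expr1 /= -bE v1 mulrNN mulr1.
Qed.

Lemma onb_vertical_horizontal e b : onb g n' e -> onb g r b -> onb g {:n} (e ++ b).
Proof. exact: onb_orthov_compl. Qed.

Lemma dim_horizontal : (\dim n' + \dim r)%N = 7%N.
Proof.
have [e ob] := onb_exists g n'; have [b ob'] := onb_exists g r.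
have [se _ _] := ob; have [sb _ _] := ob'.
by have [] := onb_vertical_horizontal ob ob'; rewrite size_cat se sb dim7.
Qed.

(** * Three-dimensional derived algebra *)

Lemma sd_matrix_rows e : sd_matrix g br e =
  sd_rows br g (fun i : 'I_3 => e`_i) [:: e`_3; e`_4; e`_5; e`_6].
Proof.
by apply/matrixP => i k; rewrite !mxE /sd_coord /sd_comp; case: (val k) => [|[|l]].
Qed.

Lemma gram_balanced (M : 'M[R]_3) (S : 'M[R]_3) : S = 2^-1 *: (M *m M^T) ->
  (\tr S) ^+ 2 = 2 * \tr (S *m S) <-> balanced M.
Proof.
move=> ->; rewrite /balanced -scalemxAl -scalemxAr !mxtraceZ.
by split=> H; lra.
Qed.

Lemma self_dual_gram (z : 'I_3 -> n) U b (vol : kform n 4) :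
  onb g U b -> volume_form g U vol -> ev vol b = 1 ->
  \matrix_(i < 3, j < 3) form_dot g U
    (self_dual_part g U vol (ce_diff br (covector g (z i))))
    (self_dual_part g U vol (ce_diff br (covector g (z j)))) =
  2^-1 *: (sd_rows br g z b *m (sd_rows br g z b)^T).
Proof.
move=> ob volP v1; apply/matrixP => i j.
by rewrite mxE (form_dot_sd_rows br_lie z i j ob volP v1) [RHS]mxE.
Qed.

Definition gram_condition (vol : kform n 4) :=
  forall zeta : 'I_3 -> kform n 1, orthonormal_cobasis g n' zeta ->
    let sd i := self_dual_part g r vol (ce_diff br (zeta i)) in
    let S := \matrix_(i < 3, j < 3) form_dot g r (sd i) (sd j) in
    (\tr S) ^+ 2 = 2 * \tr (S *m S).

(** Another orthonormal basis multiplies the matrix of self-dual coordinates by an orthogonal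
    matrix, and [balanced] is invariant under that. *)
Lemma balanced_all_cobases (z : 'I_3 -> n) b (vol : kform n 4) : \dim n' = 3%N ->
  (forall i, z i \in n') -> (forall i j, g (z i) (z j) = (i == j)%:R) ->
  onb g r b -> volume_form g r vol -> ev vol b = 1 -> balanced (sd_rows br g z b) ->
  gram_condition vol.
Proof.
move=> d3 zU zz ob volP v1 bal zeta /orthonormal_covectors[z' [zU' zeta_z] zz'] sd S.
have [C CC zC] := orthonormal_change d3 zU zz zU' zz'.
have SE : S = 2^-1 *: (sd_rows br g z' b *m (sd_rows br g z' b)^T).
  by rewrite -(self_dual_gram z' ob volP v1); apply/matrixP => i j; rewrite !mxE /sd !zeta_z.
apply/(gram_balanced SE); rewrite (sd_rows_change _ _ _ zC).
apply/balanced_rotate => //; exact: mulmx1C.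
Qed.

Lemma purely_coclosed_of_self_dual3 (vol : kform n 4) : \dim n' = 3%N -> volume_form g r vol ->
  gram_condition vol ->
  has_purely_coclosed_G2 br g.
Proof.
move=> d3 volP H; have dr : \dim r = 4%N by have := dim_horizontal; rewrite d3 => -[].
have [b [ob sb v1]] := oriented_onb dr volP.
have [z oz] := onb_exists g n'; have [sz zU _] := oz; rewrite d3 in sz.
have := H _ (onb_orthonormal_cobasis oz sz); cbv zeta.
rewrite (self_dual_gram (fun i : 'I_3 => z`_i) ob volP v1) => /(gram_balanced (M := sd_rows _ _ _ _) erefl) bal.
have eb (i : nat) : (z ++ b)`_(3 + i) = b`_i by rewrite nth_cat sz ltnNge leq_addr addKn.
have ez i : (i < 3)%N -> (z ++ b)`_i = z`_i by move=> i3; rewrite nth_cat sz i3.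
apply: (balanced_frame_purely_coclosed br_alt (e := z ++ b)).
  split=> [||m u v m2 m7|i u i3].
  - exact: onb_vertical_horizontal.
  - by rewrite size_cat sz sb.
  - have [_ bU _] := ob; rewrite -(subnKC m2) eb; apply/mem_horizontal; last exact: bracket_derived.
    by apply/bU/mem_nth; rewrite sb ltn_subLR.
  - by rewrite ez // derived_central //; apply/zU/mem_nth; rewrite sz.
rewrite sd_matrix_rows (eb 0%N) (eb 1%N) (eb 2%N) (eb 3%N).
have <- : b = [:: b`_0; b`_1; b`_2; b`_3] by rewrite -[LHS](map_nth_iota0_id sb).
by congr (balanced (sd_rows _ _ _ _)): bal; apply: funext => i; rewrite ez.
Qed.

Lemma seq7E e : size e = 7%N -> e = [:: e`_0; e`_1; e`_2; e`_3; e`_4; e`_5; e`_6].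
Proof. by move=> se; rewrite -[LHS](map_nth_iota0_id se). Qed.

(** Cancelling powers of [s] makes the equations kill or identify coefficients one after the other,
    until the matrix of self-dual coordinates is symmetric and traceless, as for a coassociative
    complement. *)
Lemma tilted_frame_balanced e (z : nat -> n) (c s : R) : \dim n' = 3%N ->
  onb g {:n} e -> onb g n' [:: z 0%N; z 1%N; z 2%N] ->
  z 0%N = e`_0 -> z 1%N = e`_1 -> z 2%N = c *: e`_2 - s *: e`_3 ->
  c ^+ 2 + s ^+ 2 = 1 -> s != 0 ->
  (forall t, size t = 5%N -> all (ltn^~ 7) t -> d_psi (dcoef g br e) t = 0) ->
  d_phi_phi (dcoef g br e) = 0 ->
  exists b, onb g r b /\ balanced (sd_rows br g (fun i : 'I_3 => z i) b).
Proof.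
move=> d3 ob oz z0 z1 z2 cs s0 dpsi dphi.
have se : size e = 7%N by case: ob => ->.
have [_ _ on] := ob; have [_ zU _] := oz.
(* [h] is the unit vector orthogonal to [z_2] in the plane of [e_2] and [e_3], so that [b] is a
   frame of [r]. *)
pose h := s *: e`_2 + c *: e`_3; pose b := [:: h; e`_4; e`_5; e`_6].
have obz : onb g {:n} ([:: z 0%N; z 1%N; z 2%N] ++ b).
  split=> [|? _|]; [by rewrite dim7|exact: memvf|].
  have ss : s * s = 1 - c * c by rewrite -!expr2; lra.
  by case=> [|[|[|[|[|[|[|i]]]]]]] // [|[|[|[|[|[|[|j]]]]]]] // _ _ /=;
    rewrite /h ?z0 ?z1 ?z2 ?(dotDl, dotDr, dotNl, dotNr, dotZl, dotZr) !on ?se //=;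
    rewrite ?(mulr0, mulr1, addr0, add0r, oppr0, subr0) //; lra.
have obb : onb g r b := onb_orthov oz obz.
exists b; split=> //.
have hn y : y \in n' -> g h y = 0.
  move=> yn; have [_ /(_ h) bU _] := obb; apply: (mem_horizontal br g h _ y yn).
  by apply: bU; rewrite inE eqxx.
have en m y : (3 < m)%N -> (m < 7)%N -> y \in n' -> g e`_m y = 0.
  move=> m3 m7 yn; have [_ /(_ e`_m) bU _] := obb; apply: (mem_horizontal br g _ _ y yn).
  apply: bU; rewrite !inE; move: m3 m7.
  by case: m => [|[|[|[|[|[|[|m]]]]]]] //= _ _; rewrite eqxx ?orbT.
have zc i v : (i < 3)%N -> br (z i) v = 0.
  move=> i3; rewrite (derived_central n_2step) // zU // !inE.
  by case: i i3 => [|[|[|i]]] // _; rewrite eqxx ?orbT.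
have e2E : e`_2 = c *: z 2%N + s *: h.
  rewrite z2 /h scalerBr scalerDr !scalerA addrACA -scalerDl -!expr2 cs scale1r.
  by rewrite (mulrC s) addNr addr0.
have e3E : e`_3 = - s *: z 2%N + c *: h.
  rewrite z2 /h scalerBr scalerDr !scalerA addrACA -scalerDl -[- ((- s * s) *: _)]scaleNr -scalerDl.
  have -> : - s * c + c * s = 0 by ring.
  have -> : - (- s * s) + c * c = 1 by rewrite -cs; ring.
  by rewrite scale0r add0r scale1r.
(* The frame with [h] in place of [e_3], matching the indexing of [coef_tilt]. *)
pose fr (i : nat) := if i == 3%N then h else e`_i.
pose q k i j := g (z k) (br (fr i) (fr j)).
clearbody h.
have brl v : br e`_2 v = s *: br h v.
  by rewrite e2E linearDl !linearZl_LR /= zc // scaler0 add0r.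
have brl' v : br e`_3 v = c *: br h v.
  by rewrite e3E linearDl !linearZl_LR /= zc // scaler0 add0r.
have brr v : br v e`_2 = s *: br v h.
  by rewrite (bracket_anti br_alt) brl -scalerN -(bracket_anti br_alt).
have brr' v : br v e`_3 = c *: br v h.
  by rewrite (bracket_anti br_alt) brl' -scalerN -(bracket_anti br_alt).
have br0 v : br e`_0 v = 0 by rewrite -z0 zc.
have br1 v : br e`_1 v = 0 by rewrite -z1 zc.
have br0' v : br v e`_0 = 0 by rewrite (bracket_anti br_alt) br0 oppr0.
have br1' v : br v e`_1 = 0 by rewrite (bracket_anti br_alt) br1 oppr0.
have brh : br h h = 0 := br_alt h.
have dn x y : br x y \in n' := bracket_derived br x y.
have dcE m i j : (m < 7)%N -> (i < 7)%N -> (j < 7)%N ->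
    dcoef g br e m i j = coef_tilt q c s m i j.
  have ge2 y : y \in n' -> g e`_2 y = c * g (z 2%N) y.
    by move=> yn; rewrite e2E dotDl !dotZl hn // mulr0 addr0.
  have ge3 y : y \in n' -> g e`_3 y = - s * g (z 2%N) y.
    by move=> yn; rewrite e3E dotDl !dotZl hn // mulr0 addr0.
  have tilt k : (i < 7)%N -> (j < 7)%N -> g (z k) (br e`_i e`_j) = match i, j with
    | 0%N, _ | 1%N, _ | _, 0%N | _, 1%N => 0
    | 2%N, 2%N | 2%N, 3%N | 3%N, 2%N | 3%N, 3%N => 0
    | 2%N, _ => s * q k 3%N j
    | 3%N, _ => c * q k 3%N j
    | _, 2%N => - (s * q k 3%N i)
    | _, 3%N => - (c * q k 3%N i)
    | _, _ => q k i j
    end.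
    move=> _ _; case: i => [|[|[|[|i]]]]; case: j => [|[|[|[|j]]]];
      rewrite ?br0 ?br1 ?br0' ?br1' ?brl ?brl' ?brr ?brr' ?brh ?scaler0 ?dot0r ?dotZr //;
      by rewrite /q /fr /= (bracket_anti br_alt) dotNr ?mulrN.
  move=> m7 i7 j7; rewrite /dcoef; case: m m7 => [|[|[|[|m]]]] m7.
  - by rewrite -z0 tilt.
  - by rewrite -z1 tilt.
  - by rewrite ge2 // tilt.
  - by rewrite ge3 // tilt.
  - by rewrite en.
have T t : size t = 5%N -> all (ltn^~ 7) t -> d_psi (coef_tilt q c s) t = 0.
  by move=> t5 t7; rewrite -(eq_d_psi t5 t7 dcE) dpsi.
have dphi' : d_phi_phi (coef_tilt q c s) = 0 by rewrite -(eq_d_phi_phi dcE).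
have rowsE : sd_rows br g (fun i : 'I_3 => z i) b = \matrix_(i, k) sd_coord (q i) k.
  apply/matrixP => i k; rewrite !mxE /sd_coord /sd_comp.
  by case: (val k) => [|[|l]].
have [[E1 E2 E3 E4] [[E5 E6 E7 E8] [E9 E10 E11 E12]]] := d_psi_tilt q c s.
rewrite !T // in E1 E2 E3 E4 E5 E6 E7 E8 E9 E10 E11 E12.
move: dphi'; rewrite d_phi_phi_tilt cs => E13.
have cancel x : x * s = 0 -> x = 0 by move/eqP; rewrite mulf_eq0 (negbTE s0) orbF => /eqP.
have cancel2 x : x * s ^+ 2 = 0 -> x = 0.
  by move/eqP; rewrite mulf_eq0 sqrf_eq0 (negbTE s0) orbF => /eqP.
have q234 : q 2%N 3%N 4%N = 0 by apply: cancel2; lra.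
have q235 : q 2%N 3%N 5%N = 0 by apply: cancel2; lra.
have q245 : q 2%N 4%N 5%N = 0 by apply: cancel; lra.
have q134 : q 1%N 3%N 4%N = 0 by apply: cancel; lra.
have q135 : q 1%N 3%N 5%N = 0 by apply: cancel; lra.
have q034 : q 0%N 3%N 4%N = 0 by apply: cancel; lra.
have q035 : q 0%N 3%N 5%N = 0 by apply: cancel; lra.
have q136 : q 1%N 3%N 6%N = q 2%N 4%N 6%N.
  apply/eqP; rewrite -subr_eq0; apply/eqP/cancel; move: E6; rewrite q235; lra.
have q036 : q 0%N 3%N 6%N = - q 2%N 5%N 6%N.
  apply/eqP; rewrite -subr_eq0; apply/eqP/cancel; move: E10; rewrite q234; lra.
have q145 : q 1%N 4%N 5%N = 0 by move: E7; rewrite q235 q136; lra.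
have q045 : q 0%N 4%N 5%N = 0 by move: E11; rewrite q234 q036; lra.
have q046 : q 0%N 4%N 6%N = - q 1%N 5%N 6%N by move: E12; rewrite q035 q134; lra.
rewrite rowsE; apply: symmetric_traceless_balanced; last first.
  rewrite /mxtrace sum3 !mxE /= q245 q034 q135.
  by move: E13; rewrite q245 q135 q034; lra.
by apply: mx3P; rewrite !mxE /= ?q034 ?q035 ?q036 ?q045 ?q046 ?q134 ?q135 ?q136 ?q145 ?q234
  ?q235 ?q245; ring.
Qed.

Lemma onb_prefix3 e : \dim n' = 3%N -> onb g {:n} e ->
  (forall i, (i < 3)%N -> e`_i \in n') ->
  onb g n' [:: e`_0; e`_1; e`_2] /\ onb g r [:: e`_3; e`_4; e`_5; e`_6].
Proof.
move=> d3 ob en; have [sV _ on] := ob; have se : size e = 7%N by rewrite sV.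
have oz : onb g n' [:: e`_0; e`_1; e`_2].
  split=> [|x|i j]; first by rewrite d3.
    by rewrite !inE => /or3P[] /eqP ->; apply: en.
  by case: i j => [|[|[|i]]] [|[|[|j]]] //= _ _; rewrite on ?se.
split=> //; have obE : onb g {:n} ([:: e`_0; e`_1; e`_2] ++ [:: e`_3; e`_4; e`_5; e`_6]).
  by rewrite /= -(seq7E se).
exact: onb_orthov oz obE.
Qed.

Lemma associative_frame_balanced e : \dim n' = 3%N -> onb g {:n} e ->
  (forall i, (i < 3)%N -> e`_i \in n') ->
  (forall t, size t = 5%N -> all (ltn^~ 7) t -> d_psi (dcoef g br e) t = 0) ->
  d_phi_phi (dcoef g br e) = 0 ->
  balanced (sd_matrix g br e).
Proof.
move=> d3 ob en dpsi dphi; have [oz obr] := onb_prefix3 d3 ob en.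
have se : size e = 7%N by case: ob => ->.
have ad : adapted_frame g br e.
  split=> // [m u v m2 m7|i u i3]; last by rewrite (derived_central n_2step) ?en.
  apply: (mem_horizontal br g); last exact: bracket_derived.
  have [_ sub _] := obr; apply: sub; rewrite !inE; move: m2 m7.
  by case: m => [|[|[|[|[|[|[|m]]]]]]] //= _ _; rewrite eqxx ?orbT.
have dcE m i j (m7 : (m < 7)%N) (i7 : (i < 7)%N) (j7 : (j < 7)%N) :=
  adapted_frame_dcoef br_alt ad m7 i7 j7.
have [] := d_psi_coef3 (dcoef g br e).
rewrite -!(eq_d_psi _ _ dcE) // !dpsi // => E1 E2 E3.
move: dphi; rewrite (eq_d_phi_phi dcE) d_phi_phi_coef3 => E4.
apply: symmetric_traceless_balanced; last by rewrite /mxtrace sum3 !mxE; lra.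
by apply: mx3P; rewrite !mxE //; lra.
Qed.

Lemma self_dual_of_purely_coclosed3 : \dim n' = 3%N ->
  has_purely_coclosed_G2 br g ->
  exists vol : kform n 4, volume_form g r vol /\ gram_condition vol.
Proof.
move=> d3 /purely_coclosed_adapted[phi [fp exw frames]].
suff [z [b [zU zz ob bal]]] : exists (z : 'I_3 -> n) b, [/\ forall i, z i \in n',
    forall i j, g (z i) (z j) = (i == j)%:R, onb g r b & balanced (sd_rows br g z b)].
  have dr : \dim r = 4%N by have := dim_horizontal; rewrite d3 => -[].
  have volP : volume_form g r (fun x => 1 * @det_form R n g 4 b x).
    by apply: det_volume_form; rewrite ?expr1n.
  exists (fun x => 1 * @det_form R n g 4 b x); split=> //.
  apply: (balanced_all_cobases d3 zU zz ob volP _ bal).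
  have [sb _ on] := ob; rewrite dr in sb.
  by rewrite /ev mul1r; apply: (ev_det_form_onb sb on).
(* [c] is the value of [phi] on [n']: if [c = 1] or [c = -1], then [n'] is associative
   and [e_0, e_1, e_2] spans it; otherwise the unit vector [x] of the plane of [z_2]
   and [e_2] orthogonal to [e_2] gives a frame in which [z_2 = c e_2 - s e_3], [s <> 0]. *)
have [zs oz] := onb_exists g n'; have [sz zU on] := oz; rewrite d3 in sz.
have zin i : (i < 3)%N -> zs`_i \in n' by move=> i3; apply/zU/mem_nth; rewrite sz.
have [w [w1 w0w w1w pw]] := exw zs`_0 zs`_1.
have [|||e [ob [e0 e1 e3] e2 dpsi dphi]] := frames zs`_0 zs`_1 w _ _ w1 _ w0w w1w pw;
  try by rewrite on ?sz.
have se : size e = 7%N by case: ob => ->.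
have [_ _ one] := ob.
set c := ev phi [:: zs`_0; zs`_1; zs`_2].
have cE : g e`_2 zs`_2 = c by rewrite e2.
have norm : g (zs`_2 - c *: e`_2) (zs`_2 - c *: e`_2) = 1 - c ^+ 2.
  rewrite dotDl !dotDr !dotNl !dotNr !dotZl !dotZr (dotC g zs`_2 e`_2) cE on ?sz // one ?se //=.
  by ring.
have [c1|c1] := eqVneq (1 - c ^+ 2) 0.
  have zE : zs`_2 = c *: e`_2.
    by apply/eqP; rewrite -subr_eq0 -(dot_eq0 g) norm c1.
  have e2n : e`_2 \in n'.
    have -> : e`_2 = c *: zs`_2 by rewrite zE scalerA -expr2 -[c ^+ 2](subKr 1) c1 subr0 scale1r.
    by apply/memvZ/zin.
  have en i : (i < 3)%N -> e`_i \in n'.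
    case: i => [|[|[|i]]] // _; first by rewrite e0 zin.
    by rewrite e1 zin.
  have [oz' obr] := onb_prefix3 d3 ob en.
  exists (fun i : 'I_3 => e`_i), [:: e`_3; e`_4; e`_5; e`_6]; split=> //.
  - by move=> i; apply: en.
  - by move=> i j; rewrite one ?se //; apply: ltn_trans (ltn_ord _) _.
  - by rewrite -sd_matrix_rows; apply: associative_frame_balanced.
have pos : 0 < 1 - c ^+ 2.
  rewrite lt_def c1 -norm; have [->|y0] := eqVneq (zs`_2 - c *: e`_2) 0; first by rewrite dot0r lexx.
  by rewrite ltW // dot_gt0.
pose s := Num.sqrt (1 - c ^+ 2); have s2 : s ^+ 2 = 1 - c ^+ 2 by rewrite sqr_sqrtr // ltW.
have s0 : s != 0 by rewrite -sqrf_eq0 s2.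
pose x := - s^-1 *: (zs`_2 - c *: e`_2).
have x1 : g x x = 1.
  rewrite dotZl dotZr norm -s2; field; exact: s0.
have orthx y : g y zs`_2 = 0 -> g y e`_2 = 0 -> g y x = 0.
  by move=> y1 y2; rewrite dotZr dotDr dotNr dotZr y1 y2; ring.
have e01 i : (i < 2)%N -> g zs`_i x = 0.
  move=> i2; apply: orthx; first by rewrite on ?sz ?(ltn_trans i2) // ltn_eqF.
  by case: i i2 => [|[|i]] // _; rewrite -?e0 -?e1 one ?se.
have px : ev phi [:: zs`_0; zs`_1; x] = 0.
  rewrite -e2 dotZr dotDr dotNr dotZr cE one ?se //=; ring.
have [|||f [obf [f0 f1 f3] f2 dpsi' dphi']] :=
  frames zs`_0 zs`_1 x _ _ x1 _ (e01 0%N isT) (e01 1%N isT) px; try by rewrite on ?sz.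
(* Both are the cross product of [z_0] and [z_1], which makes the relation between [z_2], [e_2] and
   [x] a relation in the frame [f]. *)
have ef : f`_2 = e`_2 by apply: (dot_inj (g := g)) => y; rewrite f2 e2.
have zE : zs`_2 = c *: f`_2 - s *: f`_3.
  by rewrite f3 ef /x scalerA mulrN mulfV // scaleN1r opprK addrC subrK.
have zsE : zs = [:: zs`_0; zs`_1; zs`_2] by rewrite -[LHS](map_nth_iota0_id sz).
have oz3 : onb g n' [:: zs`_0; zs`_1; zs`_2] by rewrite -zsE.
have [|b [obr bal]] := @tilted_frame_balanced f
  (fun i => zs`_i) c s d3 obf oz3 (esym f0) (esym f1) zE _ s0 dpsi' dphi'.
  by rewrite s2; ring.
exists (fun i : 'I_3 => zs`_i), b; split=> // [i|i j]; first exact: zin.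
by rewrite on ?sz.
Qed.

(** * Two-dimensional derived algebra *)

Definition conformal_condition U (vol : kform n 4) :=
  forall zeta : 'I_2 -> kform n 1, orthonormal_cobasis g n' zeta ->
    let sd i := self_dual_part g U vol (ce_diff br (zeta i)) in
    form_dot g U (sd ord0) (sd ord_max) = 0 /\
    form_norm g U (sd ord0) = form_norm g U (sd ord_max).

(** A scalar Gram matrix is unchanged by an orthogonal change of basis, so one cobasis decides for
    all. *)
Lemma conformal_cobases (z : 'I_2 -> n) U b (vol : kform n 4) (a : R) : \dim n' = 2%N ->
  (forall i, z i \in n') -> (forall i j, g (z i) (z j) = (i == j)%:R) ->
  onb g U b -> volume_form g U vol -> ev vol b = 1 ->
  sd_rows br g z b *m (sd_rows br g z b)^T = a%:M ->
  conformal_condition U vol.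
Proof.
move=> d2 zU zz ob volP v1 MM zeta /orthonormal_covectors[z' [zU' zeta_z] zz'] sd.
have [C CC zC] := orthonormal_change d2 zU zz zU' zz'.
have MM' : sd_rows br g z' b *m (sd_rows br g z' b)^T = a%:M.
  rewrite (sd_rows_change _ _ _ zC) trmx_mul mulmxA -(mulmxA C) MM.
  by rewrite mul_mx_scalar -scalemxAl CC scalemx1.
have E i j : form_dot g U (sd i) (sd j) = 2^-1 * (a%:M : 'M[R]_2) i j.
  by rewrite -MM' -(form_dot_sd_rows br_lie z' i j ob volP v1) /sd !zeta_z.
by rewrite /form_norm !E !mxE /= mulr0.
Qed.

Lemma self_dual_of_purely_coclosed2 : \dim n' = 2%N -> has_purely_coclosed_G2 br g ->
  exists (rt : {vspace n}) (vol : kform n 4),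
    [/\ \dim rt = 4%N, (rt <= r)%VS, volume_form g rt vol,
        forall zeta : kform n 1, form_on g n' zeta -> form_on g rt (ce_diff br zeta)
      & conformal_condition rt vol].
Proof.
move=> d2 /purely_coclosed_adapted[phi [fp exw frames]].
have [zs oz] := onb_exists g n'; have [sz zU on] := oz; rewrite d2 in sz.
have zin i : (i < 2)%N -> zs`_i \in n' by move=> i2; apply/zU/mem_nth; rewrite sz.
have [w [w1 w0w w1w pw]] := exw zs`_0 zs`_1.
have [|||e [ob [e0 e1 e3] e2 dpsi dphi]] := frames zs`_0 zs`_1 w _ _ w1 _ w0w w1w pw;
  try by rewrite on ?sz.
have [sV _ one] := ob; have se : size e = 7%N by rewrite sV.
have oz' : onb g n' [:: e`_0; e`_1].
  split=> [|x|i j]; first by rewrite d2.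
    by rewrite !inE e0 e1 => /orP[] /eqP ->; apply: zin.
  by case: i j => [|[|i]] [|[|j]] //= _ _; rewrite one ?se.
have obr : onb g r [:: e`_2; e`_3; e`_4; e`_5; e`_6].
  by apply: (onb_orthov oz'); rewrite /= -(seq7E se).
have hor m : (1 < m)%N -> (m < 7)%N -> e`_m \in r.
  move=> m1 m7; have [_ sub _] := obr; apply: sub; rewrite !inE; move: m1 m7.
  by case: m => [|[|[|[|[|[|[|m]]]]]]] //= _ _; rewrite eqxx ?orbT.
have c0 x : br e`_0 x = 0 by rewrite e0 (derived_central n_2step) ?zin.
have c1 x : br e`_1 x = 0 by rewrite e1 (derived_central n_2step) ?zin.
have dcE m i j : (m < 7)%N -> (i < 7)%N -> (j < 7)%N ->
    dcoef g br e m i j = coef_vert2 (dcoef g br e) m i j.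
  move=> m7 i7 j7; rewrite /coef_vert2 !beforeE; case: ltnP => m2; last first.
    by apply: (mem_horizontal br g _ (hor m m2 m7)); exact: bracket_derived.
  case: i i7 => [|[|i]] // i7; rewrite /dcoef ?c0 ?c1 ?dot0r //.
  by case: j j7 => [|[|j]] // j7;
    rewrite (bracket_anti br_alt) ?c0 ?c1 ?oppr0 ?dot0r.
have [[F1 F2 F3 F4] [[F5 F6 F7 F8] [F9 F10 F11]]] := d_psi_coef2 (dcoef g br e).
move: F1 F2 F3 F4 F5 F6 F7 F8 F9 F10 F11; rewrite -!(eq_d_psi _ _ dcE) // !dpsi //.
move=> F1 F2 F3 F4 F5 F6 F7 F8 F9 F10 F11.
move: dphi; rewrite (eq_d_phi_phi dcE) d_phi_phi_coef2 => F12.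
(* The first eight equations make [e_2] central, so the 4-plane can be the span of the last four
   frame vectors. *)
have c2 x : br e`_2 x = 0.
  rewrite (onb_expand ob (memvf x)) linear_sumr /= big1 // => i _.
  rewrite linearZr_LR /=; suff -> : br e`_2 e`_i = 0 by rewrite scaler0.
  apply: (onb_eq oz' (bracket_derived br _ _) (mem0v _)) => m m2; rewrite dot0r.
  have -> : g [:: e`_0; e`_1]`_m (br e`_2 e`_i) = dcoef g br e m 2 i.
    by case: m m2 => [|[|m]].
  have := ltn_ord i; rewrite [X in (_ < X)%N -> _]se.
  case: (val i) => [|[|[|[|[|[|[|k]]]]]]] // _; case: m m2 => [|[|m]] // _; try lra;
    by rewrite /dcoef ?(br_alt e`_2) ?(bracket_anti br_alt e`_2) ?c0 ?c1 ?oppr0 dot0r.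
pose b := [:: e`_3; e`_4; e`_5; e`_6].
have onb' : orthonormal_seq g b.
  by case=> [|[|[|[|i]]]] [|[|[|[|j]]]] //= _ _; rewrite one ?se.
have bsub : {subset b <= <<b>>%VS} by move=> x; apply: memv_span.
have db : \dim <<b>>%VS = 4%N by have /eqP := orthonormal_seq_free onb'.
have obb : onb g <<b>>%VS b by split; rewrite ?db.
have volP : volume_form g <<b>>%VS (fun x => 1 * @det_form R n g 4 b x).
  by apply: det_volume_form; rewrite ?expr1n.
exists <<b>>%VS, (fun x => 1 * @det_form R n g 4 b x); split=> //.
- by apply/span_subvP => x; rewrite !inE => /or4P[] /eqP ->; apply: hor.
- move=> zeta /form_on_covector[z zn ->]; split; first exact: ce_diff_covector_form.
  have Z x y : x \in orthov g <<b>>%VS -> br x y = 0.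
    move=> /orthov_dotP xb; rewrite (onb_expand ob (memvf x)).
    rewrite (seq7E se) /= !big_ord_recl big_ord0 /= /bump /=.
    rewrite !(dotC g _ x) ![g x e`_(_.+3)]xb ?scale0r ?addr0; last 4 first.
    by apply: bsub; rewrite !inE eqxx ?orbT.
    by apply: bsub; rewrite !inE eqxx ?orbT.
    by apply: bsub; rewrite !inE eqxx ?orbT.
    by apply: bsub; rewrite !inE eqxx ?orbT.
    by rewrite !linearDl !linearZl_LR /= c0 c1 c2 !scaler0 !addr0.
  move=> x i xi; rewrite ce_diff_covector /dcovector.
  suff -> : br (x ord0) (x ord_max) = 0 by rewrite dot0r mulr0.
  case: (unliftP ord0 i) xi => [k|] -> xi; last exact: Z.
  have kE : lift ord0 k = ord_max by apply: val_inj; case: k {xi} => -[].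
  by rewrite (bracket_anti br_alt) Z ?oppr0 // -kE.
have MM : sd_rows br g (fun i : 'I_2 => e`_i) b =
    \matrix_(i, k) sd_coord (dcoef g br e i) k.
  by apply/matrixP => i k; rewrite !mxE /sd_coord /sd_comp; case: (val k) => [|[|l]].
apply: (conformal_cobases (z := fun i : 'I_2 => e`_i) (b := b)
  (a := sd_coord (dcoef g br e 0%N) 0 ^+ 2 + sd_coord (dcoef g br e 0%N) 1 ^+ 2)) => //.
- by move=> i; case: i => -[|[|i]] //= _; rewrite ?e0 ?e1 zin.
- by move=> i j; rewrite one ?se //; apply: ltn_trans (ltn_ord _) _.
- by rewrite /ev mul1r; apply: (ev_det_form_onb _ onb').
(* The rows of self-dual coordinates are [(A, B, 0)] and [(B, -A, 0)]: orthogonal, with common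
   square norm [A^2 + B^2]. *)
have G0 : sd_coord (dcoef g br e 0%N) 2 = 0 by lra.
have G1 : sd_coord (dcoef g br e 1%N) 2 = 0 by lra.
have G2 : sd_coord (dcoef g br e 1%N) 0 = sd_coord (dcoef g br e 0%N) 1 by lra.
have G3 : sd_coord (dcoef g br e 1%N) 1 = - sd_coord (dcoef g br e 0%N) 0 by lra.
rewrite MM; move: (@sd_coord R) G0 G1 G2 G3 => S G0 G1 G2 G3.
apply/matrixP => i j; rewrite !mxE sum3 !mxE.
by case: i j => -[|[|i]] // i2 [[|[|j]]] // j2; rewrite -val_eqE /= ?G0 ?G1 ?G2 ?G3; ring.
Qed.

Lemma purely_coclosed_of_self_dual2 (rt : {vspace n}) (vol : kform n 4) : \dim n' = 2%N ->
  \dim rt = 4%N -> (rt <= r)%VS -> volume_form g rt vol ->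
  (forall zeta : kform n 1, form_on g n' zeta -> form_on g rt (ce_diff br zeta)) ->
  conformal_condition rt vol ->
  has_purely_coclosed_G2 br g.
Proof.
move=> d2 drt rtr volP on_rt H; have [b [ob sb v1]] := oriented_onb drt volP.
have [z oz] := onb_exists g n'; have [sz zU onz] := oz; rewrite d2 in sz.
have [_ bU on_b] := ob.
have bz i j : (i < 4)%N -> (j < 2)%N -> g b`_i z`_j = 0.
  move=> i4 j2; apply: (mem_horizontal br g); last by apply/zU/mem_nth; rewrite sz.
  by apply/(subvP rtr)/bU/mem_nth; rewrite sb.
have zb i j : (i < 4)%N -> (j < 2)%N -> g z`_j b`_i = 0 by move=> *; rewrite dotC bz.
have on6 : orthonormal_seq g [:: z`_0; z`_1; b`_0; b`_1; b`_2; b`_3].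
  by case=> [|[|[|[|[|[|i]]]]]] [|[|[|[|[|[|j]]]]]] //= _ _;
    rewrite ?bz ?zb ?onz ?on_b ?sz ?sb.
have [|f [_ f1 fo]] := unit_normal on6 (fun x _ => memvf x); first by rewrite dim7.
have fz i : (i < 2)%N -> g z`_i f = 0.
  by case: i => [|[|i]] // _; [apply: (fo 0%N)|apply: (fo 1%N)].
have fb i : (i < 4)%N -> g b`_i f = 0 by move=> i4; have := fo i.+2 i4; case: i i4 => [|[|[|[|]]]].
have fz' i : (i < 2)%N -> g f z`_i = 0 by move=> ?; rewrite dotC fz.
have fb' i : (i < 4)%N -> g f b`_i = 0 by move=> ?; rewrite dotC fb.
pose e := [:: z`_0; z`_1; f; b`_0; b`_1; b`_2; b`_3].
have obe : onb g {:n} e.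
  split=> [|? _|]; [by rewrite dim7|exact: memvf|].
  by case=> [|[|[|[|[|[|[|i]]]]]]] [|[|[|[|[|[|[|j]]]]]]] //= _ _;
    rewrite ?bz ?zb ?fz ?fb ?fz' ?fb' ?onz ?on_b ?sz ?sb.
have frt : f \in orthov g rt.
  apply/orthov_dotP => y yU; rewrite (onb_expand ob yU) dot_sumr big1 // => i _.
  by rewrite dotZr fb' ?mulr0 // -sb.
(* [f] is orthogonal to [rt], so every [d zeta] vanishes on [f, x]; for [zeta] dual to [[f, x]] this
   gives [|[f, x]|^2 = 0]. *)
have fc x : br f x = 0.
  have [_ /(_ (fun i => if i == ord0 then f else x) ord0 frt)] :=
    on_rt _ (covector_form_on g (bracket_derived br f x)).
  by rewrite ce_diff_covector /dcovector /= mulN1r => /eqP; rewrite oppr_eq0 dot_eq0 => /eqP.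
have fh y : y \in n' -> g f y = 0.
  move=> yU; rewrite (onb_expand oz yU) dot_sumr big1 // => i _.
  by rewrite dotZr fz' ?mulr0 // -sz.
have ad : adapted_frame g br e.
  split=> // [m u v m2 m7|i u].
    have -> : e`_m = b`_(m - 3) by case: m m2 m7 => [|[|[|[|[|[|[|]]]]]]].
    apply: (mem_horizontal br g); last exact: bracket_derived.
    by apply/(subvP rtr)/bU/mem_nth; rewrite sb ltn_subLR.
  case: i => [|[|[|i]]] // _ /=.
    by apply: (derived_central n_2step); apply/zU/mem_nth; rewrite sz.
  by apply: (derived_central n_2step); apply/zU/mem_nth; rewrite sz.
apply: (balanced_frame_purely_coclosed br_alt (e := e) ad).
have bE : b = [:: b`_0; b`_1; b`_2; b`_3] by rewrite -[LHS](map_nth_iota0_id sb).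
have [] := H _ (onb_orthonormal_cobasis oz sz); cbv zeta; rewrite /form_norm.
pose zf := fun i : 'I_2 => z`_i; pose M := sd_rows br g zf b; pose G := sd_matrix g br e *m (sd_matrix g br e)^T.
rewrite !(form_dot_sd_rows br_lie zf _ _ ob volP v1) -/M => G01 G00.
have nn i : 0 <= (M *m M^T) i i.
  by rewrite !mxE; apply: sumr_ge0 => k _; rewrite [_^T k i]mxE -expr2 sqr_ge0.
have {}G00 : (M *m M^T) ord0 ord0 = (M *m M^T) ord_max ord_max.
  have p i : 0 <= 2^-1 * (M *m M^T) i i by rewrite mulr_ge0 ?nn ?invr_ge0.
  have := congr1 (fun x => x ^+ 2) G00; rewrite !sqr_sqrtr //; lra.
have {}G01 : (M *m M^T) ord0 ord_max = 0 by lra.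
have row (i : 'I_3) (i' : 'I_2) k : val i = val i' -> sd_matrix g br e i k = M i' k.
  rewrite sd_matrix_rows !mxE bE /= => ii.
  suff -> : e`_i = zf i' by [].
  by rewrite /zf -ii; case: i i' ii => -[|[|[|]]] // ? [[|[|]]].
(* [f] is orthogonal to the derived algebra, so the third row of self-dual coordinates is zero. *)
have row2 k : sd_matrix g br e 2%:R k = 0.
  have Z i j : dcoef g br e 2 i j = 0 by rewrite /dcoef fh // bracket_derived.
  by rewrite mxE /sd_coord /= !Z !addr0 subr0 oppr0; case: (val k) => [|[|]].
have GM (i j : 'I_3) (i' j' : 'I_2) : val i = val i' -> val j = val j' ->
    G i j = (M *m M^T) i' j'.
  move=> ii jj; rewrite !mxE; apply: eq_bigr => k _.
  by rewrite [_^T k j]mxE [_^T k j']mxE (row i i') ?(row j j').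
have G2 i : G 2%:R i = 0 by rewrite mxE big1 // => k _; rewrite row2 mul0r.
have Gs i j : G i j = G j i by rewrite !mxE; apply: eq_bigr => k _; rewrite !mxE mulrC.
rewrite /balanced -/G.
(* The Gram matrix is [diag(a, a, 0)], for which [(2 a)^2 = 2 (a^2 + a^2)]. *)
have g00 := GM 0 0 ord0 ord0 erefl erefl; have g01 := GM 0 1 ord0 ord_max erefl erefl.
have g11 := GM 1 1 ord_max ord_max erefl erefl; rewrite G01 in g01; rewrite -G00 -g00 in g11.
clearbody G; rewrite /mxtrace !sum3 !mxE !sum3 !G2 !(Gs _ 2%:R) !G2 (Gs 1 0) g01 g11; ring.
Qed.

(** * One-dimensional derived algebra *)

Section OneDimensionalDerivedAlgebra.
Hypothesis dim1 : \dim n' = 1%N.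

Lemma trace_jmap b z : onb g r b -> size b = 6%N ->
  let A := \matrix_(i < 6, j < 6) g z (br b`_i b`_j) in let J := jmap br g z in
  lfun_trace (J \o J)%VF = \tr (A *m A) /\
  lfun_trace (J \o (J \o (J \o J)))%VF = \tr (A *m A *m A *m A).
Proof.
move=> ob sb A J; rewrite !(lfun_trace_onb ob sb) !(operator_mx_comp ob sb).
by rewrite (operator_mx_jmap z ob sb).
Qed.

Lemma onb_center e : onb g {:n} e -> e`_0 \in n' ->
  [/\ onb g n' [:: e`_0], onb g r [:: e`_1; e`_2; e`_3; e`_4; e`_5; e`_6] &
    forall m i j, (m < 7)%N -> (i < 7)%N -> (j < 7)%N ->
      dcoef g br e m i j = coef_vert1 (dcoef g br e) m i j].
Proof.
move=> ob e0; have [sV _ one] := ob; have se : size e = 7%N by rewrite sV.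
have oz : onb g n' [:: e`_0].
  split=> [|x|i j]; first by rewrite dim1.
    by rewrite inE => /eqP ->.
  by case: i j => [|i] [|j] //= _ _; rewrite one ?se.
have obr : onb g r [:: e`_1; e`_2; e`_3; e`_4; e`_5; e`_6].
  by apply: (onb_orthov oz); rewrite /= -(seq7E se).
split=> // [[|m]] i j m7 i7 j7 /=.
  case: i i7 => [|i] i7; first by rewrite /dcoef (derived_central n_2step) // dot0r.
  by case: j j7 => [|j] j7 //; rewrite /dcoef (derived_central_r br_lie n_2step) // dot0r.
apply: (mem_horizontal br g); last exact: bracket_derived.
have [_ sub _] := obr; apply: sub; rewrite !inE; move: m7.
by case: m => [|[|[|[|[|[|m]]]]]] //= _; rewrite eqxx ?orbT.
Qed.

Lemma traces_of_purely_coclosed1 : has_purely_coclosed_G2 br g ->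
  forall z, z \in n' -> let J := jmap br g z in
    lfun_trace (J \o J)%VF ^+ 2 = 4 * lfun_trace (J \o (J \o (J \o J)))%VF.
Proof.
move=> /purely_coclosed_adapted[phi [fp exw frames]] z zn J.
have [zs oz] := onb_exists g n'; have [sz zU on] := oz; rewrite dim1 in sz.
have z0n : zs`_0 \in n' by apply/zU/mem_nth; rewrite sz.
have [|||v [_ v1 z0v]] := @unit_normal _ _ g {:n} [:: zs`_0].
- by case=> [|i] [|j] //= _ _; rewrite on ?sz.
- by move=> x _; apply: memvf.
- by rewrite dim7.
have [w [w1 z0w vw pw]] := exw zs`_0 v.
have [||e [ob [e0 _ _] _ dpsi dphi]] := frames zs`_0 v w _ v1 w1 _ z0w vw pw.
- by rewrite on ?sz.
- exact: (z0v 0%N).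
have [|oz' obr dcE] := onb_center ob; first by rewrite e0.
have [c zE] : exists c, z = c *: e`_0.
  by exists (g e`_0 z); rewrite {1}(onb_expand oz' zn) big_ord_recl big_ord0 addr0.
(* The su(3) equations are linear, so they pass from the unit vector [e_0] to its multiple [z]. *)
pose q i j := g z (br e`_i e`_j).
have qE i j : q i j = c * dcoef g br e 0 i j by rewrite /q zE dotZl.
have q_skew i j : q j i = - q i j by rewrite /q (bracket_anti br_alt) dotNr.
have := special_unitary_traces q_skew.
have [[E1 E2 E3 E4] [E5 E6]] := d_psi_coef1 (dcoef g br e).
move: E1 E2 E3 E4 E5 E6; rewrite -!(eq_d_psi _ _ dcE) // !dpsi //.
move=> E1 E2 E3 E4 E5 E6; move: dphi; rewrite (eq_d_phi_phi dcE) d_phi_phi_coef1 => E7.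
have [-> ->] := trace_jmap z obr erefl.
have -> : \matrix_(i < 6, j < 6) g z (br [:: e`_1; e`_2; e`_3; e`_4; e`_5; e`_6]`_i
    [:: e`_1; e`_2; e`_3; e`_4; e`_5; e`_6]`_j) = \matrix_(i, j) q i.+1 j.+1.
  apply/matrixP => i j; rewrite !mxE /q.
  by case: i j => -[|[|[|[|[|[|i]]]]]] // i6 [[|[|[|[|[|[|j]]]]]]].
apply; rewrite !qE -?mulrDr -?mulrBr.
- by rewrite -E1 mulr0.
- by rewrite -E2 mulr0.
- by rewrite -[X in _ * X]opprK -E3 oppr0 mulr0.
- by rewrite -[X in _ * X]opprK -E4 oppr0 mulr0.
- by rewrite -E5 mulr0.
- by rewrite -E6 mulr0.
- by suff -> : dcoef g br e 0 1 2 + dcoef g br e 0 3 4 + dcoef g br e 0 5 6 = 0;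
    [rewrite mulr0|lra].
Qed.

Lemma purely_coclosed_of_traces1 :
  (forall z, z \in n' -> let J := jmap br g z in
    lfun_trace (J \o J)%VF ^+ 2 = 4 * lfun_trace (J \o (J \o (J \o J)))%VF) ->
  has_purely_coclosed_G2 br g.
Proof.
have [zs oz] := onb_exists g n'; have [sz zU on] := oz; rewrite dim1 in sz.
set z := zs`_0; have zn : z \in n' by apply/zU/mem_nth; rewrite sz.
have zsE : zs = [:: z] by rewrite -[LHS](map_nth_iota0_id sz).
move=> /(_ z zn); cbv zeta.
pose al x y := g z (br x y).
have al_skew x y : al y x = - al x y by rewrite /al (bracket_anti br_alt) dotNr.
have al_lin c x x' y : al (c *: x + x') y = c * al x y + al x' y.
  by rewrite /al linearPl dotDr dotZr.
have dr : \dim r = 3.*2 by have := dim_horizontal; rewrite dim1 => -[].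
have [b ob b0] := skew_normal_form g al_lin al_skew dr.
have sb : size b = 6%N by case: ob => ->.
(* Indices are shifted by one, index 0 being that of the vertical vector, so that the planes are
   given by [uphalf] as in the frame equations. *)
pose a i j := match i, j with i'.+1, j'.+1 => al b`_i' b`_j' | _, _ => 0 end.
have a_skew i j : a j i = - a i j.
  by case: i j => [|i] [|j] /=; rewrite ?oppr0 // al_skew.
have a0 i j : (i < 7)%N -> (j < 7)%N -> uphalf i != uphalf j -> a i j = 0.
  case: i j => [|i] [|j] //= i7 j7 ij; apply: b0 => //.
have [-> ->] := trace_jmap z ob sb; have [-> ->] := normal_form_traces a_skew a0.
move=> H; have [|s [t [s2 t2 st]]] := @sign_choice _ (a 1%N 2%N) (a 3%N 4%N) (a 5%N 6%N).
  by move: H; rewrite exprMn; lra.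
(* Indices here are those of [b], one less than in the frame: reversing [b_2] and [b_4] multiplies
   the coefficients of the second and third planes by [s] and [t], which makes the trace vanish. *)
pose sg i := if i == 2%N then s else if i == 4%N then t else 1.
have sg2 i : sg i ^+ 2 = 1 by rewrite /sg; case: ifP => // _; case: ifP => // _; rewrite expr1n.
have obf := onb_signs ob sb sg2; set f := mkseq _ _ in obf.
have obe : onb g {:n} (z :: f) by rewrite zsE in oz; exact: onb_vertical_horizontal oz obf.
have [//|_ _ dcE] := onb_center obe.
have fE i j : (i < 7)%N -> (j < 7)%N -> dcoef g br (z :: f) 0 i j = sg i.-1 * sg j.-1 * a i j.
  case: i j => [|i] [|j] i7 j7; rewrite /dcoef /= ?(derived_central n_2step _ zn) ?dot0r ?mulr0 //.
    by rewrite (derived_central_r br_lie n_2step) // dot0r.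
  by rewrite !nth_mkseq // linearZl_LR /= !linearZr_LR /= mulrA.
apply: (frame_purely_coclosed br_alt obe) => [//|x sx x5 x7|].
  rewrite (eq_d_psi x5 x7 dcE) d_psi_coef1_diag // => i j i7 j7 ij.
  by rewrite fE // a0 // mulr0.
rewrite (eq_d_phi_phi dcE) d_phi_phi_coef1 !fE // /sg /= !mul1r !mulr1 st mulr0.
by [].
Qed.

End OneDimensionalDerivedAlgebra.

End Classification.

Theorem theorem1p3 (R : realType) (n : vectType R)
    (br : {bilinear n -> n -> n}) (g : {dot n for idfun})
    (br_lie : lie_bracket br) (n_dim7 : \dim {:n} = 7%N)
    (n_2step : two_step_nilpotent br) :
  let n' := derived_algebra br in
  let r := horizontal br g in
  [/\ \dim n' = 1%N ->
        (has_purely_coclosed_G2 br g <->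
         forall z, z \in n' ->
           let j := jmap br g z in
           lfun_trace (j \o j)%VF ^+ 2 =
           4 * lfun_trace (j \o (j \o (j \o j)))%VF),
      \dim n' = 2%N ->
        (has_purely_coclosed_G2 br g <->
         exists (rt : {vspace n}) (vol : kform n 4),
           [/\ \dim rt = 4%N,
               (rt <= r)%VS,
               volume_form g rt vol,
               forall zeta : kform n 1,
                 form_on g n' zeta -> form_on g rt (ce_diff br zeta)
             & forall zeta : 'I_2 -> kform n 1,
                 orthonormal_cobasis g n' zeta ->
                 let sd i := self_dual_part g rt vol (ce_diff br (zeta i)) in
                 form_dot g rt (sd ord0) (sd ord_max) = 0 /\
                 form_norm g rt (sd ord0) = form_norm g rt (sd ord_max)])
    & \dim n' = 3%N ->
        (has_purely_coclosed_G2 br g <->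
         exists vol : kform n 4,
           volume_form g r vol /\
           forall zeta : 'I_3 -> kform n 1,
             orthonormal_cobasis g n' zeta ->
             let sd i := self_dual_part g r vol (ce_diff br (zeta i)) in
             let S := \matrix_(i < 3, j < 3) form_dot g r (sd i) (sd j) in
             (\tr S) ^+ 2 = 2 * \tr (S *m S))].
Proof.
move=> n' r; split=> dn; split.
- exact: traces_of_purely_coclosed1.
- exact: purely_coclosed_of_traces1.
- exact: self_dual_of_purely_coclosed2.
- by move=> [rt [vol [drt rtr volP on_rt H]]]; apply: (purely_coclosed_of_self_dual2 _ _ _ _ drt rtr volP).
- exact: self_dual_of_purely_coclosed3.
- by move=> [vol [volP H]]; apply: (purely_coclosed_of_self_dual3 _ _ _ _ volP).
Qed.
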